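(* Let $f\in M_o$. If $H$ is a $p$-periodic Herman ring of $f$, then the bounded component of $\widehat{\mathbb{C}}\setminus H$ contains an essential singularity of $f^p$. In particular, $\mathcal{F}(f)$ has no invariant Herman ring. Further, if $f$ has only one pole, then Herman rings of $f$ of period $2$ do not exist.
   Context: $\widehat{\mathbb{C}}=\mathbb{C}\cup\{\infty\}$. For a transcendental meromorphic $f:\mathbb{C}\to\widehat{\mathbb{C}}$, the Fatou set $\mathcal{F}(f)$ is the set of $z\in\widehat{\mathbb{C}}$ having a neighborhood on which all iterates $f^n$ are defined and form a normal family. A Fatou component is a connected component of $\mathcal{F}(f)$. For a Fatou component $U$, $U_n$ denotes the Fatou component containing $f^n(U)$; $U$ is $p$-periodic if $p$ is the least natural number with $U_p=U$, and invariant if $p=1$. A Herman ring is a $p$-periodic doubly connected Fatou component $H$ on which $f^p$ is conformally conjugate to an irrational rotation of an annulus; the bounded component of $\widehat{\mathbb{C}}\setminus H$ is the one not containing $\infty$. $M$ is the class of transcendental meromorphic functions $f:\mathbb{C}\to\widehat{\mathbb{C}}$ having either at least two poles, or exactly one pole which is not an omitted value. $O_f$ is the set of omitted values of $f$ (values in $\widehat{\mathbb{C}}$ not taken by $f$ on $\mathbb{C}$; for $f\in M$ these are finite and there are at most two). $M_o=\{f\in M: O_f\neq\emptyset\}$. The essential singularities of $f^p$ are $\infty$ together with the points $z\in\mathbb{C}$ with $f^k(z)=\infty$ for some $1\le k\le p-1$. *)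

(* Defs.v *)
From HB Require Import structures.
From mathcomp Require Import all_boot all_order all_algebra.
From mathcomp Require Import complex.
From mathcomp Require Import all_classical all_reals all_analysis.

Set Implicit Arguments.
Unset Strict Implicit.
Unset Printing Implicit Defensive.

Import Order.TTheory GRing.Theory Num.Theory.
Import numFieldTopology.Exports numFieldNormedType.Exports.

Local Open Scope classical_set_scope.
Local Open Scope ring_scope.

(* The topology and norm of C = R[i], as a normed space over itself. *)
HB.instance Definition _ (R : realType) :=
  NormedModule.copy R[i] (R[i]^o).

(* The Riemann sphere: [Some z] is the point z of C, [None] is infinity. *)
Definition sphere (R : realType) : topologicalType :=
  one_point_compactification R[i].

Section HermanRings.
Context {R : realType}.
Local Notation C := R[i].
Local Notation S := (sphere R).
Local Notation normc := ComplexField.Normc.normc.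

Definition infty : S := None.
Definition fin (z : C) : S := Some z.

Definition chordal (z w : S) : R :=
  match z, w with
  | Some a, Some b =>
      2 * normc (a - b) /
        (Num.sqrt (1 + normc a ^+ 2) * Num.sqrt (1 + normc b ^+ 2))
  | Some a, None | None, Some a => 2 / Num.sqrt (1 + normc a ^+ 2)
  | None, None => 0
  end.

(* The default value 0 at infinity is never used: [holomorphic_at] asks for
   finite values near the point. *)
Definition finite_part (f : C -> S) (z : C) : C := odflt 0 (f z).

Definition holomorphic_at (f : C -> S) (a : C) : Prop :=
  \forall z \near a, f z <> infty /\ derivable (finite_part f) z 1.

Definition poles (f : C -> S) : set C := [set a | f a = infty].

Definition meromorphic (f : C -> S) : Prop :=
  (forall a, ~ poles f a -> holomorphic_at f a) /\
  (forall a, poles f a ->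
     (\forall z \near a^', holomorphic_at f z) /\ f z @[z --> a^'] --> infty).

(* Since f is meromorphic, it is enough to compare with p / q where q <> 0. *)
Definition rational_function (f : C -> S) : Prop :=
  exists p q : {poly C}, q != 0 /\
    forall z, q.[z] != 0 -> f z = fin (p.[z] / q.[z]).

Definition transcendental_meromorphic (f : C -> S) : Prop :=
  meromorphic f /\ ~ rational_function f.

Definition omitted_values (f : C -> S) : set S := ~` range f.

Definition class_M (f : C -> S) : Prop :=
  transcendental_meromorphic f /\
  ((exists a b, a <> b /\ poles f a /\ poles f b) \/
   (exists a, poles f = [set a] /\ ~ omitted_values f (fin a))).

Definition class_Mo (f : C -> S) : Prop :=
  class_M f /\ omitted_values f !=set0.

(* f^n as a total map on the sphere. f is undefined at infinity; the junk
   convention is that infinity is mapped to itself, so that f^n(z) is genuinely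
   defined exactly when [iterate_defined f n z]. *)
Definition iterate (f : C -> S) (n : nat) : S -> S := iter n (obind f).

Definition iterate_defined (f : C -> S) (n : nat) (z : S) : Prop :=
  forall k, (k < n)%N -> iterate f k z <> infty.

Definition normal_family (U : set S) (F : set (S -> S)) : Prop :=
  forall s : nat -> S -> S, (forall n, F (s n)) ->
  exists (phi : nat -> nat) (g : S -> S),
    {homo phi : m n / (m < n)%N} /\
    forall K : set S, compact K -> K `<=` U ->
    forall e : R, 0 < e ->
      \forall n \near \oo, forall z, K z -> chordal (s (phi n) z) (g z) < e.

Definition fatou_set (f : C -> S) : set S :=
  [set z | exists U : set S, [/\ open U, U z,
     (forall n w, U w -> iterate_defined f n w) &
     normal_family U [set iterate f n | n in [set n | (0 < n)%N]]]].

Definition components (A : set S) : set (set S) :=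
  [set connected_component A z | z in A].

Definition fatou_component (f : C -> S) (U : set S) : Prop :=
  components (fatou_set f) U.

(* V is U_n, the Fatou component containing f^n(U). *)
Definition is_iterated_component (f : C -> S) (n : nat) (U V : set S) : Prop :=
  fatou_component f V /\ iterate f n @` U `<=` V.

Definition periodic_component (f : C -> S) (p : nat) (U : set S) : Prop :=
  [/\ fatou_component f U, (0 < p)%N, is_iterated_component f p U U &
      forall k, (0 < k < p)%N -> ~ is_iterated_component f k U U].

(* To be used for domains U of the sphere. *)
Definition doubly_connected (U : set S) : Prop :=
  exists A B, A <> B /\ components (~` U) = [set A; B].

Definition annulus (r : R) : set C := [set z | 1 < normc z < r].

(* e^(2 pi i t) *)
Definition rotation_factor (t : R) : C :=
  Complex (cos (2 * pi * t)) (sin (2 * pi * t)).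

(* psi is the inverse of the usual uniformisation H -> annulus. *)
Definition conjugate_to_irrational_rotation (g : S -> S) (H : set S) : Prop :=
  exists (r t : R) (psi : C -> C),
    [/\ 1 < r, irrational t,
        (forall z, annulus r z -> derivable psi z 1),
        set_bij (annulus r) H (fin \o psi) &
        forall z, annulus r z ->
          g (fin (psi z)) = fin (psi (rotation_factor t * z))].

Definition herman_ring (f : C -> S) (p : nat) (H : set S) : Prop :=
  [/\ periodic_component f p H, doubly_connected H &
      conjugate_to_irrational_rotation (iterate f p) H].

Definition bounded_complement_component (H B : set S) : Prop :=
  components (~` H) B /\ ~ B infty.

(* The convention that [iterate] fixes infinity adds no point here: if
   iterate f k (fin z) = infty, then the genuine f^j(z) is infinity for the
   least such j <= k. *)
Definition essential_singularities (f : C -> S) (p : nat) : set S :=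
  [set infty] `|`
  [set fin z | z in [set z | exists k, (1 <= k <= p.-1)%N /\
                                       iterate f k (fin z) = infty]].

End HermanRings.

(* Main.v *)
Require Import Defs.
From mathcomp Require Import all_boot all_order all_algebra.
From mathcomp Require Import complex zify ring lra.
From mathcomp Require Import all_classical all_reals all_analysis.

(* Let gamma be the image in H of a circle of the annulus, with sides D (containing the bounded
   component B) and E (containing infinity), and suppose that B contains no essential singularity
   of F = f^p.  The image under F of the compact set D u gamma is a union of components of the
   complement of F(gamma) = gamma, up to gamma itself.  As F rotates H, it maps D n H into itself.
   If F has a pole in D, its image contains E, D and gamma, so F and hence f omits no value.
   Otherwise F maps D u gamma into itself; since the rotations F^n on gamma have uniformly
   convergent subsequences, so do the iterates on D by the maximum principle, D lies in the Fatou
   set, and B = D \ H is both open and closed, which is absurd.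

   If f has a single pole a and p = 2, then a lies in B.  Let gamma1 = f(gamma).  The same
   argument shows that f(D u gamma) = E1 u gamma1 and f(D1 u gamma1) = E u gamma, where E1 and D1
   are the sides of gamma1, and a and the omitted value lie in both D and D1.  The curves gamma
   and gamma1 are therefore nested, and f maps the closed region between them into itself.  That
   region lies in the Fatou set, and this again makes one of the components of the complement of
   H open and closed.

   The only complex analysis needed is the maximum principle, which is derived from Goursat's
   theorem; in its form below, differentiability is not required at the zeros of the function, so
   that it applies to 1 / (F - w) without an analysis of the poles of F. *)

Set Implicit Arguments.
Unset Strict Implicit.
Unset Printing Implicit Defensive.

Import Order.TTheory GRing.Theory Num.Theory.
Import numFieldTopology.Exports numFieldNormedType.Exports.

Local Open Scope classical_set_scope.
Local Open Scope ring_scope.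

(** * Complex differentiability *)

(** The Jordan curve theorem is avoided. The sides of gamma are assembled from the two components of
    the complement of H, each glued to one half of the ring. This requires the two ends of the
    annulus to run into different components, which holds because a component approached by neither
    end would be open, while the sphere is connected. The complement of f(H) has no such given
    description, so its sides are defined by the image itself: the covered side contains infinity,
    the uncovered one the omitted value.

    Normality concerns all iterates of f, not only those of F. An exponent n = qp + k has finitely
    many residues k, and on gamma f^n is f^k after a rotation by the q-th power of a number of
    modulus 1, so compactness of the unit circle is enough. The maximum principle, applied to
    differences of iterates, then carries the Cauchy estimates from the curves to the region that
    they bound.

    The final openness of B comes from intersecting a side of gamma with the Fatou set minus H,
    which is open since the plane is locally connected. *)

Section Differentiability.
Context {R : realType}.
Local Notation C := R[i].
Local Notation nc := (@ComplexField.Normc.normc R).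

(* A record rather than a definition, to keep unification from unfolding [derivable]. *)
Record cdiff (g : C -> C) (z : C) : Prop := CDiff { derivable_of_cdiff : derivable g z 1 }.

Lemma cdiffM (g h : C -> C) z :
  cdiff g z -> cdiff h z -> cdiff (fun x => g x * h x) z.
Proof. by move=> [dg] [dh]; split; have := @derivableM C C g h z 1 dg dh. Qed.

Lemma cdiffB (g h : C -> C) z :
  cdiff g z -> cdiff h z -> cdiff (fun x => g x - h x) z.
Proof. by move=> [dg] [dh]; split; have := @derivableB C C C g h z 1 dg dh. Qed.

Lemma cdiffD (g h : C -> C) z :
  cdiff g z -> cdiff h z -> cdiff (fun x => g x + h x) z.
Proof. by move=> [dg] [dh]; split; have := @derivableD C C C g h z 1 dg dh. Qed.

Lemma cdiffV (g : C -> C) z : g z != 0 -> cdiff g z -> cdiff (fun x => (g x)^-1) z.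
Proof. by move=> g0 [dg]; split; exact: (derivableV g0 dg). Qed.

Lemma cdiff_id z : cdiff (fun x => x) z.
Proof. by split; exact: derivable_id. Qed.

Lemma cdiff_cst c z : cdiff (fun=> c) z.
Proof. by split; exact: derivable_cst. Qed.

Lemma cdiffX (g : C -> C) z n : cdiff g z -> cdiff (fun x => g x ^+ n) z.
Proof.
move=> dg; elim: n => [|n ih]; first exact: cdiff_cst.
by under eq_fun do rewrite exprS; exact: cdiffM.
Qed.

Lemma cdiff_comp (g h : C -> C) z : cdiff g (h z) -> cdiff h z -> cdiff (fun x => g (h x)) z.
Proof.
move=> [/derivable1_diffP h1] [/derivable1_diffP h2]; split; apply/derivable1_diffP.
exact: differentiable_comp h2 h1.
Qed.

Lemma cdiff_continuous (g : C -> C) z : cdiff g z -> {for z, continuous g}.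
Proof. by move=> [/derivable1_diffP/differentiable_continuous]. Qed.

Lemma cdiff_near (f g : C -> C) z : (\forall w \near z, f w = g w) -> cdiff f z -> cdiff g z.
Proof. by move=> fg [df]; split; exact: near_eq_derivable fg df. Qed.

Lemma normC_normc (z : C) : `|z| = (nc z)%:C%C.
Proof. by case: z => a b; rewrite normc_def. Qed.

Lemma nbhs_normcP (z : C) A :
  nbhs z A <-> exists2 r : R, 0 < r & forall w, nc (w - z) < r -> A w.
Proof.
split.
  move=> /nbhs_ballP [e /= e0 eA].
  move: e0 eA; case: e => a b; rewrite ltcE /= => /andP[/eqP -> a0] eA.
  exists a => // w hw; apply: eA.
  by rewrite -ball_normE /ball_ /= distrC normC_normc ltcR.
move=> [r r0 hr]; apply/nbhs_ballP; exists (r%:C)%C => /=; first by rewrite ltcR.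
by move=> w; rewrite -ball_normE /ball_ /= distrC normC_normc ltcR; exact: hr.
Qed.

End Differentiability.

Section Normc.
Context {R : realType}.
Local Notation C := R[i].
Local Notation nc := (@ComplexField.Normc.normc R).
Local Notation Re := (@complex.Re R).
Local Notation Im := (@complex.Im R).

Lemma ncM (x y : C) : nc (x * y) = nc x * nc y.
Proof. exact: ComplexField.Normc.normcM. Qed.
Lemma ncN (x : C) : nc (- x) = nc x. Proof. exact: normcN. Qed.
Lemma ncD (x y : C) : nc (x + y) <= nc x + nc y. Proof. exact: le_normcD. Qed.
Lemma ncC (x y : C) : nc (x - y) = nc (y - x). Proof. by rewrite -ncN opprB. Qed.
Lemma nc0 : nc 0 = 0. Proof. exact: ComplexField.Normc.normc0. Qed.
Lemma nc1 : nc 1 = 1. Proof. exact: ComplexField.Normc.normc1. Qed.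
Lemma ncV (x : C) : nc x^-1 = (nc x)^-1. Proof. exact: ComplexField.Normc.normcV. Qed.
Lemma nc_ge0 (x : C) : 0 <= nc x. Proof. by case: x => a b /=; rewrite sqrtr_ge0. Qed.
Lemma ncX (x : C) n : nc (x ^+ n) = nc x ^+ n.
Proof. by elim: n => [|n ih]; rewrite ?expr0 ?nc1 // !exprS ncM ih. Qed.
Lemma nc_eq0 (x : C) : (nc x == 0) = (x == 0).
Proof.
by apply/eqP/eqP => [|->]; [exact: ComplexField.Normc.eq0_normc|exact: nc0].
Qed.
Lemma nc_gt0 (x : C) : (0 < nc x) = (x != 0).
Proof. by rewrite lt_def nc_eq0 nc_ge0 andbT. Qed.
Lemma ncR (x : R) : nc (x%:C)%C = `|x|.
Proof. by rewrite /= expr0n /= addr0 sqrtr_sqr. Qed.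
Lemma ler_Re_nc (x : C) : `|Re x| <= nc x.
Proof. by case: x => a b /=; rewrite -sqrtr_sqr ler_sqrt ?lerDl ?addr_ge0 ?sqr_ge0. Qed.
Lemma ler_Im_nc (x : C) : `|Im x| <= nc x.
Proof. by case: x => a b /=; rewrite -sqrtr_sqr ler_sqrt ?lerDr ?addr_ge0 ?sqr_ge0. Qed.
Lemma nc_le_ReIm (x : C) : nc x <= `|Re x| + `|Im x|.
Proof.
case: x => a b /=; rewrite -[leRHS]ger0_norm ?addr_ge0 // -sqrtr_sqr ler_sqrt ?sqr_ge0 //.
by rewrite sqrrD !real_normK ?num_real // lerD2r lerDl mulrn_wge0 // mulr_ge0.
Qed.
(** Multiplying the error by [nc (w - z)] instead of dividing by it lets [w = z] be included, so
    that the estimate can be used on a whole rectangle containing the point. *)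
Lemma cdiffP (g : C -> C) z : cdiff g z ->
  exists d : C, forall e : R, 0 < e -> exists2 r : R, 0 < r &
    forall w, nc (w - z) < r -> nc (g w - g z - d * (w - z)) <= e * nc (w - z).
Proof.
move=> [/cvg_ex[/= d /cvgrPdist_lt dP]]; exists d => e e0.
have := dP (e%:C)%C; rewrite ltcR => /(_ e0).
rewrite near_withinE => /nbhs_normcP[r r0 hr]; exists r => // w wr.
have [->|wz] := eqVneq w z; first by rewrite !subrr mulr0 subrr nc0 mulr0.
have wz0 : w - z != 0 by rewrite subr_eq0.
have := hr (w - z); rewrite subr0 => /(_ wr wz0).
rewrite normC_normc ltcR /= /shift /= /GRing.scale /= mulr1 subrK => /ltW h.
have -> : g w - g z - d * (w - z) = - ((d - (w - z)^-1 * (g w - g z)) * (w - z)).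
  by field.
by rewrite ncN ncM ler_wpM2r // nc_ge0.
Qed.

End Normc.

(** * Goursat's theorem *)

Section RealIntegrals.
Context {R : realType}.

Definition rint (h : R -> R) (a b : R) : R :=
  (\int[lebesgue_measure]_(x in `[a, b]) h x)%R.

Definition cont_on (h : R -> R) (a b : R) :=
  forall x, a <= x <= b -> {for x, continuous h}.

Lemma rint_integrable h a b : cont_on h a b ->
  (@lebesgue_measure R).-integrable `[a, b] (EFin \o h).
Proof.
move=> ch; apply: continuous_compact_integrable; first exact: segment_compact.
by apply: continuous_in_subspaceT => x; rewrite inE /= in_itv /= => /ch.
Qed.

Lemma rint_cst (k a b : R) : a <= b -> rint (fun=> k) a b = k * (b - a).
Proof.
move=> ab; rewrite /rint Rintegral_cst //= lebesgue_measure_itv /= lte_fin.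
move: ab; rewrite le_eqVlt => /predU1P[->|ab]; first by rewrite ltxx subrr /= mulr0.
by rewrite ab.
Qed.

Lemma rintD h k a b : cont_on h a b -> cont_on k a b ->
  rint (fun x => h x + k x) a b = rint h a b + rint k a b.
Proof. by move=> ch ck; apply: RintegralD => //; exact: rint_integrable. Qed.

Lemma le_rint (h k : R -> R) (a b : R) : cont_on h a b -> cont_on k a b ->
  (forall x, a <= x <= b -> h x <= k x) -> rint h a b <= rint k a b.
Proof.
move=> ch ck hk; apply: le_Rintegral => //; first exact: rint_integrable.
exact: rint_integrable.
Qed.

Lemma eq_rint (h k : R -> R) (a b : R) : (forall x, a <= x <= b -> h x = k x) -> rint h a b = rint k a b.
Proof. by move=> hk; apply: eq_Rintegral => x; rewrite inE /= in_itv /=; exact: hk. Qed.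

Lemma cont_onW (h : R -> R) (a b c d : R) : cont_on h a b -> a <= c -> d <= b -> cont_on h c d.
Proof.
by move=> ch ac db x /andP[cx xd]; apply: ch; rewrite (le_trans ac) //= (le_trans xd).
Qed.

Lemma cont_on_cst k a b : cont_on (fun=> k) a b.
Proof. by move=> x _; exact: cvg_cst. Qed.

Lemma rint_split (h : R -> R) (a m b : R) : a <= m <= b -> cont_on h a b ->
  rint h a b = rint h a m + rint h m b.
Proof.
move=> /andP[am mb] ch.
have := @Rintegral_itvB R h (BLeft a) (BRight b) m (rint_integrable ch).
rewrite !bnd_simp => /(_ am mb) E.
have F := @Rintegral_itv_obnd_cbnd R m (BRight b) h.
rewrite /rint -F; first by rewrite -E addrC subrK.
have I := rint_integrable (cont_onW ch am (lexx b)).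
by apply: (integrableS _ _ _ I) => //=; apply: subset_itvr; rewrite bnd_simp.
Qed.

Lemma rint_dist (h : R -> R) (a b k M : R) : a <= b -> cont_on h a b ->
  (forall x, a <= x <= b -> `|h x - k| <= M) ->
  `|rint h a b - k * (b - a)| <= M * (b - a).
Proof.
move=> ab ch hM; rewrite ler_distl -mulrBl -mulrDl -!rint_cst //.
by apply/andP; split; apply: le_rint => //; try exact: cont_on_cst;
  move=> x /hM; rewrite ler_distl => /andP[].
Qed.

Lemma nested_segments (a w : nat -> R) :
  (forall n, a n <= a n.+1) -> (forall n, a n.+1 + w n.+1 <= a n + w n) ->
  (forall n, 0 <= w n) -> exists z, forall n, a n <= z <= a n + w n.
Proof.
move=> aS wS w0.
have am : nondecreasing_seq a by apply/nondecreasing_seqP.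
have wm : nonincreasing_seq (fun n => a n + w n) by apply/nonincreasing_seqP.
have ub m n : a m <= a n + w n.
  case: (leqP m n) => mn; first by rewrite (le_trans (am _ _ mn)) // lerDl.
  by apply: le_trans (wm _ _ (ltnW mn)); rewrite lerDl.
exists (sup (range a)) => n; apply/andP; split.
  apply: sup_upper_bound; last by exists n.
  by split; [exists (a 0%N), 0%N|exists (a 0%N + w 0%N) => _ [m _ <-]].
apply: sup_le_ub; first by exists (a 0%N), 0%N.
by move=> _ [m _ <-].
Qed.

End RealIntegrals.

(** * Contour integrals over rectangles *)

Section Contours.
Context {R : realType}.
Local Notation C := R[i].
Local Notation nc := (@ComplexField.Normc.normc R).
Local Notation Re := (@complex.Re R).
Local Notation Im := (@complex.Im R).

Lemma continuous_normcP (f : C -> R) z :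
  (forall e : R, 0 < e -> exists2 r : R, 0 < r & forall w, nc (w - z) < r -> `|f w - f z| < e) ->
  {for z, continuous f}.
Proof.
move=> h A /nbhs_ballP[e /= e0 eA]; have [r r0 hr] := h e e0.
apply/nbhs_normcP; exists r => // w /hr hw; apply: eA.
by rewrite /ball /= distrC.
Qed.

Lemma continuous_Re : continuous Re.
Proof.
move=> z; apply: continuous_normcP => e e0; exists e => // w; apply: le_lt_trans.
by apply: le_trans (ler_Re_nc _); case: w z => a b [c d].
Qed.

Lemma continuous_Im : continuous Im.
Proof.
move=> z; apply: continuous_normcP => e e0; exists e => // w; apply: le_lt_trans.
by apply: le_trans (ler_Im_nc _); case: w z => a b [c d].
Qed.

Lemma continuous_Complex : continuous (fun p : R * R => Complex p.1 p.2 : C).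
Proof.
move=> [x y] A /= /nbhs_normcP[r r0 rA].
have r20 : 0 < r / 2 by rewrite divr_gt0.
have [P Q] : (\forall x' \near x, `|x - x'| < r / 2) /\ \forall y' \near y, `|y - y'| < r / 2.
  by split; apply/nbhs_ballP; exists (r / 2).
exists ([set x' | `|x - x'| < r / 2], [set y' | `|y - y'| < r / 2]) => // -[x' y'] /= [hx hy].
apply: rA; apply: le_lt_trans (nc_le_ReIm _) _.
by rewrite /= [r]splitr ltrD // distrC.
Qed.

Lemma continuous_Complexl y : continuous (fun x : R => Complex x y : C).
Proof.
move=> x A /= /nbhs_normcP[r r0 rA]; apply/nbhs_ballP; exists r => // x' hx.
apply: rA; apply: le_lt_trans (nc_le_ReIm _) _.
by rewrite /= subrr normr0 addr0 distrC.
Qed.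

Lemma continuous_Complexr x : continuous (fun y : R => Complex x y : C).
Proof.
move=> y A /= /nbhs_normcP[r r0 rA]; apply/nbhs_ballP; exists r => // y' hy.
apply: rA; apply: le_lt_trans (nc_le_ReIm _) _.
by rewrite /= subrr normr0 add0r distrC.
Qed.

Definition cont_rect (F : C -> C) (a b c d : R) :=
  forall x y, a <= x <= b -> c <= y <= d -> {for (Complex x y), continuous F}.

(* Real part of the integral of F along the boundary of [a, b] x [c, d]. *)
Definition contour (F : C -> C) (a b c d : R) : R :=
  rint (fun x => Re (F (Complex x c)) - Re (F (Complex x d))) a b -
  rint (fun y => Im (F (Complex b y)) - Im (F (Complex a y))) c d.

Lemma cont_rect_Re F a b c d y : cont_rect F a b c d -> c <= y <= d ->
  cont_on (fun x => Re (F (Complex x y))) a b.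
Proof.
move=> cF cyd x axb.
apply: (@continuous_comp _ _ _ (fun x => F (Complex x y)) Re); last exact: continuous_Re.
apply: (@continuous_comp _ _ _ (fun x => Complex x y) F); last exact: cF.
exact: continuous_Complexl.
Qed.

Lemma cont_rect_Im F a b c d x : cont_rect F a b c d -> a <= x <= b ->
  cont_on (fun y => Im (F (Complex x y))) c d.
Proof.
move=> cF axb y cyd.
apply: (@continuous_comp _ _ _ (fun y => F (Complex x y)) Im); last exact: continuous_Im.
apply: (@continuous_comp _ _ _ (fun y => Complex x y) F); last exact: cF.
exact: continuous_Complexr.
Qed.

Lemma cont_onB h k (a b : R) : cont_on h a b -> cont_on k a b ->
  cont_on (fun x => h x - k x) a b.
Proof. by move=> ch ck x axb; apply: cvgB; [exact: ch|exact: ck]. Qed.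

Lemma cont_rectW F a b c d a' b' c' d' : cont_rect F a b c d ->
  a <= a' -> b' <= b -> c <= c' -> d' <= d -> cont_rect F a' b' c' d'.
Proof.
move=> cF aa bb cc dd x y /andP[ax xb] /andP[cy yd]; apply: cF; apply/andP; split.
- exact: le_trans ax.
- exact: le_trans bb.
- exact: le_trans cy.
- exact: le_trans dd.
Qed.

Lemma contour_splitx F a m b c d : a <= m <= b -> c <= d -> cont_rect F a b c d ->
  contour F a b c d = contour F a m c d + contour F m b c d.
Proof.
move=> amb cd cF; have /andP[am mb] := amb; have ab := le_trans am mb.
rewrite /contour (rint_split amb); last first.
  by apply: cont_onB; apply: (cont_rect_Re cF); rewrite ?lexx ?cd.
have -> : rint (fun y => Im (F (Complex b y)) - Im (F (Complex a y))) c d =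
  rint (fun y => Im (F (Complex b y)) - Im (F (Complex m y))) c d +
  rint (fun y => Im (F (Complex m y)) - Im (F (Complex a y))) c d.
  rewrite -rintD.
  - by apply: eq_rint => x _; rewrite addrA subrK.
  - by apply: cont_onB; apply: (cont_rect_Im cF); rewrite ?lexx ?amb ?ab.
  - by apply: cont_onB; apply: (cont_rect_Im cF); rewrite ?lexx ?amb ?ab.
ring.
Qed.

Lemma contour_splity F a b c m d : a <= b -> c <= m <= d -> cont_rect F a b c d ->
  contour F a b c d = contour F a b c m + contour F a b m d.
Proof.
move=> ab cmd cF; have /andP[cm md] := cmd; have cd := le_trans cm md.
rewrite /contour (rint_split cmd); last first.
  by apply: cont_onB; apply: (cont_rect_Im cF); rewrite ?lexx ?ab.
have -> : rint (fun x => Re (F (Complex x c)) - Re (F (Complex x d))) a b =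
  rint (fun x => Re (F (Complex x c)) - Re (F (Complex x m))) a b +
  rint (fun x => Re (F (Complex x m)) - Re (F (Complex x d))) a b.
  rewrite -rintD.
  - by apply: eq_rint => x _; rewrite addrA subrK.
  - by apply: cont_onB; apply: (cont_rect_Re cF); rewrite ?lexx ?cmd ?cd.
  - by apply: cont_onB; apply: (cont_rect_Re cF); rewrite ?lexx ?cmd ?cd.
ring.
Qed.

Lemma ReB (u v : C) : Re (u - v) = Re u - Re v.
Proof. by case: u v => ? ? []. Qed.

Lemma ImB (u v : C) : Im (u - v) = Im u - Im v.
Proof. by case: u v => ? ? []. Qed.

Lemma Re_mul_vertical (be : C) x c d :
  Re (be * (Complex x c - Complex x d)) = Im be * (d - c).
Proof. by case: be => p q /=; ring. Qed.

Lemma Im_mul_horizontal (be : C) y a b :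
  Im (be * (Complex b y - Complex a y)) = Im be * (b - a).
Proof. by case: be => p q /=; ring. Qed.

(** An affine function has integral 0 around a rectangle: the constant drops out of both
    differences, and the linear term contributes [Im be] times the area to each of the two
    integrals, which cancel. What is left is the error [M] times the perimeter. *)
Lemma contour_affine F a b c d (z al be : C) M : a <= b -> c <= d -> cont_rect F a b c d ->
  (forall x y, a <= x <= b -> c <= y <= d ->
     nc (F (Complex x y) - al - be * (Complex x y - z)) <= M) ->
  `|contour F a b c d| <= 2 * M * ((b - a) + (d - c)).
Proof.
move=> ab cd cF hM.
have h1 : `|rint (fun x => Re (F (Complex x c)) - Re (F (Complex x d))) a b -
    Im be * (d - c) * (b - a)| <= 2 * M * (b - a).
  apply: rint_dist => //.
    by apply: cont_onB; apply: (cont_rect_Re cF); rewrite ?lexx ?cd.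
  move=> x axb.
  have k1 := le_trans (ler_Re_nc _) (hM x c axb (introT andP (conj (lexx c) cd))).
  have k2 := le_trans (ler_Re_nc _) (hM x d axb (introT andP (conj cd (lexx d)))).
  rewrite mulr_natl mulr2n; apply: le_trans (lerD k1 k2); apply: le_trans (ler_normB _ _).
  rewrite le_eqVlt; apply/orP; left; apply/eqP; congr `| _ |.
  rewrite -(Re_mul_vertical be x) -!ReB; congr Re; ring.
have h2 : `|rint (fun y => Im (F (Complex b y)) - Im (F (Complex a y))) c d -
    Im be * (b - a) * (d - c)| <= 2 * M * (d - c).
  apply: rint_dist => //.
    by apply: cont_onB; apply: (cont_rect_Im cF); rewrite ?lexx ?ab.
  move=> y cyd.
  have k1 := le_trans (ler_Im_nc _) (hM b y (introT andP (conj ab (lexx b))) cyd).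
  have k2 := le_trans (ler_Im_nc _) (hM a y (introT andP (conj (lexx a) ab)) cyd).
  rewrite mulr_natl mulr2n; apply: le_trans (lerD k1 k2); apply: le_trans (ler_normB _ _).
  rewrite le_eqVlt; apply/orP; left; apply/eqP; congr `| _ |.
  rewrite -(Im_mul_horizontal be y) -!ImB; congr Im; ring.
rewrite mulrDr; apply: le_trans (lerD h1 h2); apply: le_trans (ler_normB _ _).
rewrite /contour le_eqVlt; apply/orP; left; apply/eqP; congr `| _ |; ring.
Qed.

End Contours.

Section Goursat.
Context {R : realType}.
Local Notation C := R[i].
Local Notation nc := (@ComplexField.Normc.normc R).

(** The contours of the four quarters add up to the whole, as common sides are traversed in opposite
    directions; so one of them carries at least a fourth of it. *)
Lemma contour_quarter (F : C -> C) (a b c d : R) : a <= b -> c <= d -> cont_rect F a b c d ->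
  exists a' c', [/\ a <= a', a' + (b - a) / 2 <= b, c <= c', c' + (d - c) / 2 <= d &
    `|contour F a b c d| <= 4 * `|contour F a' (a' + (b - a) / 2) c' (c' + (d - c) / 2)|].
Proof.
move=> ab cd cF.
set u := (b - a) / 2; set v := (d - c) / 2.
have u0 : 0 <= u by rewrite divr_ge0 // subr_ge0.
have v0 : 0 <= v by rewrite divr_ge0 // subr_ge0.
have bE : b = a + u + u by rewrite /u; field.
have dE : d = c + v + v by rewrite /v; field.
have mx : a <= a + u <= b by rewrite bE !lerDl u0.
have my : c <= c + v <= d by rewrite dE !lerDl v0.
have /andP[mx1 mx2] := mx; have /andP[my1 my2] := my.
have cFl : cont_rect F a (a + u) c d by exact: (cont_rectW cF).
have cFr : cont_rect F (a + u) b c d by exact: (cont_rectW cF).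
have E : contour F a b c d =
    contour F a (a + u) c (c + v) + contour F a (a + u) (c + v) (c + v + v) +
   (contour F (a + u) (a + u + u) c (c + v) + contour F (a + u) (a + u + u) (c + v) (c + v + v)).
  by rewrite (contour_splitx mx cd cF) (contour_splity mx1 my cFl) (contour_splity mx2 my cFr) -dE -bE.
apply: contrapT => nex.
have small a' c' : a <= a' -> a' + u <= b -> c <= c' -> c' + v <= d ->
    `|contour F a' (a' + u) c' (c' + v)| < `|contour F a b c d| / 4.
  move=> h1 h2 h3 h4; rewrite ltNge; apply/negP => h; apply: nex; exists a', c'; split => //.
  by rewrite mulrC -ler_pdivrMr.
have ble : a + u + u <= b by rewrite -bE.
have dle : c + v + v <= d by rewrite -dE.
have s1 := small a c (lexx _) mx2 (lexx _) my2.
have s2 := small a (c + v) (lexx _) mx2 my1 dle.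
have s3 := small (a + u) c mx1 ble (lexx _) my2.
have s4 := small (a + u) (c + v) mx1 ble my1 dle.
have := le_trans (ler_normD _ _) (lerD (ler_normD _ _) (ler_normD _ _)).
move=> /(_ _ _ (contour F a (a + u) c (c + v)) (contour F a (a + u) (c + v) (c + v + v))
  (contour F (a + u) (a + u + u) c (c + v)) (contour F (a + u) (a + u + u) (c + v) (c + v + v))).
rewrite -E; lra.
Qed.

Lemma goursat (F : C -> C) (a b c d : R) : a <= b -> c <= d ->
  (forall x y, a <= x <= b -> c <= y <= d -> cdiff F (Complex x y)) ->
  contour F a b c d = 0.
Proof.
move=> ab cd dF.
have cF : cont_rect F a b c d by move=> x y hx hy; apply: cdiff_continuous; exact: dF.
apply/eqP; rewrite -normr_eq0; apply/eqP; apply: contrapT => W0.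
have {W0}W0 : 0 < `|contour F a b c d| by rewrite lt_def normr_ge0 andbT; apply/eqP.
set eta := `|contour F a b c d| in W0.
pose h n : R := 2^-1 ^+ n.
have h0 n : 0 < h n by rewrite exprn_gt0 // invr_gt0.
have hS n : h n.+1 = h n / 2 by rewrite /h exprS mulrC.
pose u n := (b - a) * h n; pose v n := (d - c) * h n.
have u0 n : 0 <= u n by rewrite mulr_ge0 ?subr_ge0 // ltW.
have v0 n : 0 <= v n by rewrite mulr_ge0 ?subr_ge0 // ltW.
have uS n : u n.+1 = u n / 2 by rewrite /u hS mulrA.
have vS n : v n.+1 = v n / 2 by rewrite /v hS mulrA.
(* After [n] bisections the sides are scaled by [h n = 2^-n], and the contour still has modulus at
   least [eta / 4^n = eta * h n ^+ 2]. *)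
pose good (p : nat * (R * R)) := [/\ a <= p.2.1, p.2.1 + u p.1 <= b, c <= p.2.2, p.2.2 + v p.1 <= d &
  eta * h p.1 ^+ 2 <= `|contour F p.2.1 (p.2.1 + u p.1) p.2.2 (p.2.2 + v p.1)|].
(* [good p -> good q] is an implication because dependent choice wants a successor of every state;
   one that is not good just keeps its corner. *)
pose rel (p q : nat * (R * R)) := [/\ q.1 = p.1.+1, good p -> good q,
   p.2.1 <= q.2.1 /\ q.2.1 + u q.1 <= p.2.1 + u p.1 &
   p.2.2 <= q.2.2 /\ q.2.2 + v q.1 <= p.2.2 + v p.1].
have step p : {q | rel p q}.
  apply: cid; case: p => n [x y].
  have [[/= g1 g2 g3 g4 g5]|ng] := pselect (good (n, (x, y))); last first.
    exists (n.+1, (x, y)); split => //=; split=> //; rewrite lerD2l ?uS ?vS ler_pdivrMr //.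
      by rewrite ler_peMr // ?u0 // ler1n.
    by rewrite ler_peMr // ?v0 // ler1n.
  have xu : x <= x + u n by rewrite lerDl.
  have yv : y <= y + v n by rewrite lerDl.
  have [x' [y' [k1 k2 k3 k4 k5]]] := contour_quarter xu yv (cont_rectW cF g1 g2 g3 g4).
  move: k2 k4 k5; rewrite ![_ + _ - _]addrC !addKr -uS -vS => k2 k4 k5.
  exists (n.+1, (x', y')); split => //= _; split => /=.
  - exact: le_trans k1.
  - exact: le_trans g2.
  - exact: le_trans k3.
  - exact: le_trans g4.
  - have -> : eta * h n.+1 ^+ 2 = eta * h n ^+ 2 / 4 by rewrite hS; field.
    by rewrite ler_pdivrMr // [leRHS]mulrC; exact: le_trans k5.
have [s [s0 sS]] := dependent_choice step (0%N, (a, c)).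
have sn n : (s n).1 = n by elim: n => [|n ih]; [rewrite s0|have [-> _ _ _] := sS n; rewrite ih].
have u00 : u 0%N = b - a by rewrite /u /h expr0 mulr1.
have v00 : v 0%N = d - c by rewrite /v /h expr0 mulr1.
have gs n : good (s n).
  elim: n => [|n ih]; last by have [_ + _ _] := sS n; exact.
  by rewrite s0; split; rewrite /= ?u00 ?v00 ?subrKC // /h expr0 expr1n mulr1.
have [zx hzx] : exists z, forall n, (s n).2.1 <= z <= (s n).2.1 + u n.
  apply: nested_segments => // n; have [_ _ [h1 h2] _] := sS n => //.
  by move: h2; rewrite !sn.
have [zy hzy] : exists z, forall n, (s n).2.2 <= z <= (s n).2.2 + v n.
  apply: nested_segments => // n; have [_ _ _ [h1 h2]] := sS n => //.
  by move: h2; rewrite !sn.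
have dz : cdiff F (Complex zx zy).
  by apply: dF; [have := hzx 0%N|have := hzy 0%N]; rewrite s0 /= ?u00 ?v00 subrKC.
have [D hD] := cdiffP dz.
pose L := (b - a) + (d - c).
have L0 : 0 <= L by rewrite addr_ge0 // subr_ge0.
(* The distance to the limit point and half the perimeter are at most [L * h n], so a relative error
   [e] bounds the contour by [2 * e * (L * h n) ^+ 2]; this [e] makes the bound smaller than
   [eta * h n ^+ 2]. Taking [L + 1] covers a degenerate rectangle with [L = 0]. *)
have e0 : 0 < eta / (4 * (L + 1) ^+ 2).
  by rewrite divr_gt0 // mulr_gt0 // exprn_gt0 // ltr_wpDl.
have [r r0 hr] := hD _ e0.
have [n nr] : exists n, L * h n < r.
  have : (fun n => h n) @ \oo --> (0 : R) by apply: cvg_expr; rewrite ger0_norm ?invf_lt1 ?invr_ge0 ?ltr1n.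
  move/cvgrPdist_lt => /(_ (r / (L + 1))) [|N _ hN]; first by rewrite divr_gt0 // ltr_wpDl.
  exists N; have := hN N (leqnn N); rewrite sub0r normrN ger0_norm ?ltW //.
  rewrite ltr_pdivlMr ?ltr_wpDl // mulrC; apply: le_lt_trans.
  by rewrite ler_wpM2r ?lerDl ?ler01 // ltW.
have [g1 g2 g3 g4 g5] := gs n; rewrite sn in g2 g4 g5.
set x := (s n).2.1 in g1 g2 g5; set y := (s n).2.2 in g3 g4 g5.
have xu : x <= x + u n by rewrite lerDl.
have yv : y <= y + v n by rewrite lerDl.
have uvL : u n + v n = L * h n by rewrite /u /v -mulrDl.
have hM x' y' : x <= x' <= x + u n -> y <= y' <= y + v n ->
    nc (F (Complex x' y') - F (Complex zx zy) - D * (Complex x' y' - Complex zx zy)) <=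
    eta / (4 * (L + 1) ^+ 2) * (L * h n).
  move=> hx' hy'.
  have d1 : `|x' - zx| <= u n by have := hzx n; rewrite -/x ler_norml; move: hx'; lra.
  have d2 : `|y' - zy| <= v n by have := hzy n; rewrite -/y ler_norml; move: hy'; lra.
  have d3 : nc (Complex x' y' - Complex zx zy) <= L * h n.
    by apply: le_trans (nc_le_ReIm _) _; rewrite -uvL /= lerD.
  apply: le_trans (hr _ (le_lt_trans d3 nr)) _.
  by rewrite ler_wpM2l // ltW.
have := contour_affine xu yv (cont_rectW cF g1 g2 g3 g4) hM.
rewrite ![_ + _ - _]addrC !addKr uvL => /(le_trans g5).
have -> : 2 * (eta / (4 * (L + 1) ^+ 2) * (L * h n)) * (L * h n) =
  (eta * h n ^+ 2) * (L ^+ 2 / (2 * (L + 1) ^+ 2)).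
  by field; rewrite gt_eqF // ltr_wpDl.
rewrite -ler_pdivrMl ?mulr_gt0 ?exprn_gt0 // mulVf ?gt_eqF ?mulr_gt0 ?exprn_gt0 //.
rewrite ler_pdivlMr ?mulr_gt0 ?exprn_gt0 ?ltr_wpDl // mul1r.
by move: L0; nra.
Qed.

End Goursat.

(** * The maximum principle *)

Section ExceptionalPoint.
Context {R : realType}.
Local Notation C := R[i].
Local Notation nc := (@ComplexField.Normc.normc R).
Local Notation Re := (@complex.Re R).
Local Notation Im := (@complex.Im R).

Lemma near_neq (z c : C) : z <> c -> \forall w \near z, w != c.
Proof.
move=> zc; apply/nbhs_normcP; exists (nc (z - c)).
  by rewrite nc_gt0 subr_eq0; apply/eqP.
move=> w wz; apply/eqP => wc; move: wz; rewrite wc ncC ltxx //.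
Qed.

Lemma continuous_ncP (g : C -> C) z : {for z, continuous g} <->
  forall e : R, 0 < e -> exists2 r : R, 0 < r & forall w, nc (w - z) < r -> nc (g w - g z) < e.
Proof.
split=> [cg e e0|h A /nbhs_normcP[e e0 eA]].
  by apply/nbhs_normcP; apply: (cg [set w | nc (w - g z) < e]); apply/nbhs_normcP; exists e.
by have [r r0 hr] := h e e0; apply/nbhs_normcP; exists r => // w /hr/eA.
Qed.

(** Cutting out a small square about 0 leaves four rectangles to which [goursat] applies, and the
    contour of the small square is arbitrarily small because [F] is continuous, hence bounded, near
    0. *)
Lemma goursat_except (F : C -> C) (s : R) : 0 < s ->
  (forall (x y : R), - s <= x <= s -> - s <= y <= s -> {for (Complex x y), continuous F}) ->
  (forall (x y : R), - s <= x <= s -> - s <= y <= s -> Complex x y != 0 -> cdiff F (Complex x y)) ->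
  contour F (- s) s (- s) s = 0.
Proof.
move=> s0 cF dF.
have cR (a b c d : R) : - s <= a -> b <= s -> - s <= c -> d <= s -> cont_rect F a b c d.
  move=> h1 h2 h3 h4 x y /andP[ax xb] /andP[cy yd]; apply: cF; apply/andP; split.
  - exact: le_trans ax.
  - exact: le_trans h2.
  - exact: le_trans cy.
  - exact: le_trans h4.
apply/eqP; rewrite -normr_eq0 eq_le normr_ge0 andbT; apply/ler_addgt0Pl => eta eta0; rewrite addr0.
have c0 : {for 0, continuous F} by apply: (cF 0 0); rewrite oppr_le0 ltW.
have [r r0 hr] := (continuous_ncP F 0).1 c0 1 ltr01.
(* On the square of half-side [e], the bound [r / 4] keeps the modulus below [r], where [F] stays
   within 1 of [F 0]; the perimeter is [8 * e], whence [eta / 8]. *)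
pose e := Num.min s (Num.min (r / 4) (eta / 8)).
have e0 : 0 < e by rewrite !lt_min s0 !divr_gt0.
have es : e <= s by rewrite ge_min lexx.
have er : e <= r / 4 by rewrite !ge_min lexx orbT.
have ee : e <= eta / 8 by rewrite !ge_min lexx !orbT.
have ms : - s <= s by lra.
have me1 : - s <= - e <= s by apply/andP; split; lra.
have me2 : - e <= e <= s by apply/andP; split; lra.
have mse : - s <= e by lra.
have /andP[m1 m2] := me1; have /andP[m3 m4] := me2.
rewrite (contour_splitx me1 ms (cR _ _ _ _ _ _ _ _)) //.
rewrite (contour_splitx me2 ms (cR _ _ _ _ _ _ _ _)) //.
rewrite (contour_splity m3 me1 (cR _ _ _ _ _ _ _ _)) //.
rewrite (contour_splity m3 me2 (cR _ _ _ _ _ _ _ _)) //.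
have G (a b c d : R) : a <= b -> c <= d -> - s <= a -> b <= s -> - s <= c -> d <= s ->
    (forall (x y : R), a <= x <= b -> c <= y <= d -> x != 0 \/ y != 0) -> contour F a b c d = 0.
  move=> ab cd h1 h2 h3 h4 n0; apply: (@goursat R F a b c d ab cd) => x y hx hy; apply: (dF x y).
  - by move: hx => /andP[? ?]; apply/andP; split; lra.
  - by move: hy => /andP[? ?]; apply/andP; split; lra.
  - by rewrite eq_complex /= negb_and; apply/orP; exact: n0.
rewrite (G (- s) (- e)) //; last first.
  by move=> x y /andP[? ?] _; left; apply/eqP => x0; move: e0; lra.
rewrite (G e s) //; last first.
  by move=> x y /andP[? ?] _; left; apply/eqP => x0; move: e0; lra.
rewrite (G _ _ (- s) (- e)) //; last first.
  by move=> x y _ /andP[? ?]; right; apply/eqP => x0; move: e0; lra.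
rewrite (G _ _ e s) //; last first.
  by move=> x y _ /andP[? ?]; right; apply/eqP => x0; move: e0; lra.
rewrite !add0r !addr0.
apply: le_trans (@contour_affine R F _ _ _ _ 0 (F 0) 0 1 m3 m3 (cR _ _ _ _ _ _ _ _) _) _ => //.
  move=> x y /andP[x1 x2] /andP[y1 y2]; rewrite mul0r subr0; apply/ltW/hr.
  rewrite subr0; apply: le_lt_trans (nc_le_ReIm _) _ => /=.
  have h1 : `|x| <= e by rewrite ler_norml x1.
  have h2 : `|y| <= e by rewrite ler_norml y1.
  by move: h1 h2; lra.
by move: ee; lra.
Qed.

Lemma Re_ndivi x y : Re ((0 -i* 1)%C / Complex x y) = - y / (x ^+ 2 + y ^+ 2).
Proof. by rewrite /=; ring. Qed.
Lemma Im_ndivi x y : Im ((0 -i* 1)%C / Complex x y) = - (x / (x ^+ 2 + y ^+ 2)).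
Proof. by rewrite /=; ring. Qed.

(* The contour integral of h / (i z) over the square vanishes, whereas that of 1 / (i z) is 2 pi. *)
Lemma vanishing_center_not_near1 (h : C -> C) (s : R) : 0 < s ->
  (forall (x y : R), - s <= x <= s -> - s <= y <= s -> cdiff h (Complex x y)) ->
  h 0 = 0 ->
  ~ (forall (x y : R), - s <= x <= s -> - s <= y <= s -> `|x| = s \/ `|y| = s ->
       nc (1 - h (Complex x y)) <= 4^-1).
Proof.
move=> s0 dh h0 near1.
have s00 : - s <= 0 <= s by apply/andP; split; lra.
have d0 : cdiff h 0 by exact: (dh 0 0).
have [d hd] := cdiffP d0.
(* [0 -i* 1] is [1 / i]. Since [h 0 = 0], the derivative [d] is the limit of [h z / z] at 0; this
   only makes [F] continuous there, hence [goursat_except]. *)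
pose F z := (if z == 0 then d else h z / z) * (0 -i* 1)%C.
have dF (x y : R) : - s <= x <= s -> - s <= y <= s -> Complex x y != 0 -> cdiff F (Complex x y).
  move=> hx hy z0.
  apply: (@cdiff_near R (fun z => h z * z^-1 * (0 -i* 1)%C)).
    by apply: filterS (near_neq (elimN eqP z0)) => w w0; rewrite /F (negbTE w0).
  apply: cdiffM; last exact: cdiff_cst.
  by apply: cdiffM; [exact: dh|apply: cdiffV => //; exact: cdiff_id].
have cF : cont_rect F (- s) s (- s) s.
  move=> x y hx hy.
  have [z0|z0] := eqVneq (Complex x y) 0; last by apply: cdiff_continuous; exact: dF.
  rewrite z0; apply/continuous_ncP => e e0.
  have e20 : 0 < e / 2 by rewrite divr_gt0.
  have [r r0 hr] := hd _ e20; exists r => // w wr; rewrite /F eqxx.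
  case: eqVneq => [_|w0]; first by rewrite subrr nc0.
  rewrite -mulrBl ncM [X in _ * X](_ : _ = 1) ?mulr1; last first.
    by rewrite /= expr0n /= add0r sqrrN expr1n sqrtr1.
  have := hr w wr; rewrite h0 !subr0 => k.
  have -> : h w / w - d = (h w - d * w) / w by rewrite mulrBl mulfK.
  rewrite ncM ncV; apply: (@le_lt_trans _ _ (e / 2)); last by rewrite ltr_pdivrMr // ltr_pMr // ltr1n.
  by rewrite ler_pdivrMr // nc_gt0.
have F0 := @goursat_except F s s0 cF dF.
have sn : s != 0 by rewrite gt_eqF.
have key (x y : R) : - s <= x <= s -> - s <= y <= s -> `|x| = s \/ `|y| = s ->
   nc (F (Complex x y) - (0 -i* 1)%C / Complex x y) <= (4 * s)^-1.
  move=> hx hy b; have := near1 x y hx hy b; set z := Complex x y => hz.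
  have sz : s <= nc z.
    by case: b => <-; [exact: le_trans (ler_Re_nc z)|exact: le_trans (ler_Im_nc z)].
  have z0 : z != 0 by rewrite -nc_gt0; exact: lt_le_trans sz.
  rewrite /F (negbTE z0).
  have -> : h z / z * (0 -i* 1)%C - (0 -i* 1)%C / z = - ((0 -i* 1)%C * (1 - h z) / z) by field.
  rewrite ncN !ncM ncV [X in X * _ * _](_ : _ = 1) ?mul1r; last first.
    by rewrite /= expr0n /= add0r sqrrN expr1n sqrtr1.
  by rewrite invfM ler_pM ?nc_ge0 ?invr_ge0 ?nc_ge0 // lef_pV2 // posrE // (lt_le_trans s0).
have hs : - s <= s <= s by apply/andP; split; lra.
have hms : - s <= - s <= s by apply/andP; split; lra.
have ns : `|s| = s by rewrite gtr0_norm.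
have nms : `|- s| = s by rewrite normrN.
have sq (x : R) : - s <= x <= s -> (2 * s)^-1 <= s / (s ^+ 2 + x ^+ 2).
  move=> /andP[h1 h2]; have p : 0 < s ^+ 2 + x ^+ 2 by rewrite ltr_wpDr ?sqr_ge0 ?exprn_gt0.
  by rewrite ler_pdivlMr // mulrC ler_pdivrMr ?mulr_gt0 //; nra.
have inv4 : (4 * s)^-1 = s^-1 / 4 by field.
have inv2 : (2 * s)^-1 = s^-1 / 2 by field.
(* A crude bound replaces the exact value 2 pi. The two horizontal sides give [1 / (i z)] a joint
   integrand of at least [1 / s], from which the errors take at most [1 / (2 s)]; over the length
   [2 s] this leaves 1, and the vertical sides give 1 more. *)
have b1 : s^-1 / 2 * (s - - s) <=
   rint (fun x => Re (F (Complex x (- s))) - Re (F (Complex x s))) (- s) s.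
  rewrite -rint_cst; last lra.
  apply: le_rint; first exact: cont_on_cst.
    by apply: cont_onB; apply: (cont_rect_Re cF).
  move=> x hx.
  have k1 := le_trans (ler_Re_nc _) (key x (- s) hx hms (or_intror nms)).
  have k2 := le_trans (ler_Re_nc _) (key x s hx hs (or_intror ns)).
  have k3 := sq x hx.
  move: k1 k2 k3; rewrite !ReB !Re_ndivi sqrrN mulNr opprK [x ^+ 2 + _]addrC inv4 inv2 !ler_norml.
  move=> /andP[? ?] /andP[? ?] ?; lra.
have b2 : rint (fun y => Im (F (Complex s y)) - Im (F (Complex (- s) y))) (- s) s <=
    - (s^-1 / 2) * (s - - s).
  rewrite -rint_cst; last lra.
  apply: le_rint; last 1 first.
  - move=> y hy.
    have k1 := le_trans (ler_Im_nc _) (key (- s) y hms hy (or_introl nms)).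
    have k2 := le_trans (ler_Im_nc _) (key s y hs hy (or_introl ns)).
    have k3 := sq y hy.
    move: k1 k2 k3; rewrite !ImB !Im_ndivi sqrrN mulNr opprK inv4 inv2 !ler_norml.
    move=> /andP[? ?] /andP[? ?] ?; lra.
  - by apply: cont_onB; apply: (cont_rect_Im cF).
  - exact: cont_on_cst.
have e1 : s^-1 / 2 * (s - - s) = 1 by field.
by move: F0 b1 b2; rewrite /contour mulNr e1; lra.
Qed.

End ExceptionalPoint.

Section MaximumPrinciple.
Context {R : realType}.
Local Notation C := R[i].
Local Notation nc := (@ComplexField.Normc.normc R).
Local Notation Re := (@complex.Re R).
Local Notation Im := (@complex.Im R).
Local Notation S := (sphere R).

Lemma ler_dist_nc (z w : C) : `|nc z - nc w| <= nc (z - w).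
Proof.
rewrite ler_norml; apply/andP; split.
  by rewrite lerNl opprB lerBlDr ncC; apply: le_trans (ncD _ _); rewrite subrK.
by rewrite lerBlDr; apply: le_trans (ncD _ _); rewrite subrK.
Qed.

Lemma continuous_nc : continuous nc.
Proof.
move=> z; apply: continuous_normcP => e e0; exists e => // w; apply: le_lt_trans.
exact: ler_dist_nc.
Qed.

Lemma hausdorff_C : hausdorff_space C.
Proof. exact: norm_hausdorff. Qed.

Lemma compact_box (M : R) : compact [set z : C | `|Re z| <= M /\ `|Im z| <= M].
Proof.
have -> : [set z : C | `|Re z| <= M /\ `|Im z| <= M] =
   (fun p : R * R => Complex p.1 p.2) @` (`[- M, M] `*` `[- M, M]).
  apply/seteqP; split=> [[x y] /= [hx hy]|_ [[x y] /= [hx hy] <-] /=].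
    by exists (x, y) => //=; rewrite !in_itv /= -!ler_norml.
  by move: hx hy; rewrite !in_itv /= -!ler_norml.
apply: continuous_compact; last by apply: compact_setX; exact: segment_compact.
by apply: continuous_subspaceT; exact: continuous_Complex.
Qed.

Lemma compact_closed_bounded (A : set C) (M : R) :
  closed A -> (forall z, A z -> nc z <= M) -> compact A.
Proof.
move=> cA bA; apply: (subclosed_compact cA (compact_box (M := M))) => z /bA zM.
by split; apply: le_trans zM; [exact: ler_Re_nc|exact: ler_Im_nc].
Qed.

Lemma closed_preimage_le (f : C -> R) (M : R) : continuous f -> closed [set z | f z <= M].
Proof. by move=> cf; apply: (closed_comp (f := f) (D := [set x | x <= M])) => [z _|]; [exact: cf|exact: closed_le]. Qed.

Lemma closed_preimage_eq (f : C -> R) (M : R) : continuous f -> closed [set z | f z = M].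
Proof. by move=> cf; apply: (closed_comp (f := f) (D := [set x | x = M])) => [z _|]; [exact: cf|exact: closed_eq]. Qed.

Lemma open_preimage_lt (f : C -> R) (M : R) : continuous f -> open [set z | f z < M].
Proof. by move=> cf; apply: (open_comp (f := f) (D := [set x | x < M])) => [z _|]; [exact: cf|exact: open_lt]. Qed.

Lemma compact_max (f : C -> R) (A : set C) : A !=set0 -> compact A ->
  (forall z, A z -> {for z, continuous f}) -> exists2 c, A c & forall t, A t -> f t <= f c.
Proof.
move=> A0 cA cf; have [|c cS hc] := @compact_EVT_max C R f A A0 cA.
  by apply: continuous_in_subspaceT => z; rewrite inE => /cf.
by exists c => [|t At]; [rewrite inE in cS|apply: hc; rewrite inE].
Qed.

Lemma compact_nc_bounded (A : set C) : compact A -> exists2 M : R, 0 < M & forall z, A z -> nc z < M.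
Proof.
move=> cA; have [->|A0] := eqVneq A set0; first by exists 1.
have [c _ hc] := compact_max ((set0P _).1 A0) cA (fun z _ => @continuous_nc z).
exists (nc c + 1); first by rewrite ltr_wpDl ?nc_ge0.
by move=> z Az; rewrite (le_lt_trans (hc z _)) // ltrDl.
Qed.

Lemma continuous_absRe : continuous (fun z : C => `|Re z|).
Proof.
move=> z; apply: continuous_normcP => e e0; exists e => // w; apply: le_lt_trans.
by apply: le_trans (ler_dist_dist _ _) _; rewrite -ReB; exact: ler_Re_nc.
Qed.

Lemma continuous_absIm : continuous (fun z : C => `|Im z|).
Proof.
move=> z; apply: continuous_normcP => e e0; exists e => // w; apply: le_lt_trans.
by apply: le_trans (ler_dist_dist _ _) _; rewrite -ImB; exact: ler_Im_nc.
Qed.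

Lemma compact_square (s : R) :
  compact [set z : C | [/\ `|Re z| <= s, `|Im z| <= s & `|Re z| = s \/ `|Im z| = s]].
Proof.
apply: (subclosed_compact _ (compact_box (M := s))) => [|z [h1 h2 _]//].
have -> : [set z : C | [/\ `|Re z| <= s, `|Im z| <= s & `|Re z| = s \/ `|Im z| = s]] =
  [set z | `|Re z| <= s] `&` [set z | `|Im z| <= s] `&` ([set z | `|Re z| = s] `|` [set z | `|Im z| = s]).
  by apply/seteqP; split=> z /=; [move=> [? ? ?]|move=> [[? ?] ?]].
have a := continuous_absRe; have b := continuous_absIm.
apply: closedI; first by apply: closedI; exact: closed_preimage_le.
by apply: closedU; exact: closed_preimage_eq.
Qed.

Lemma cdiff_shift (g : C -> C) (c a z : C) : cdiff g (c + a * z) -> cdiff (fun w => g (c + a * w)) z.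
Proof.
move=> dg; have dh := cdiffD (cdiff_cst c z) (cdiffM (cdiff_cst a z) (cdiff_id z)).
exact: (@cdiff_comp R g (fun w => c + a * w) z dg dh).
Qed.

(* If |g| < |g 0| on the boundary, then 1 - (g / g 0)^n contradicts
   [vanishing_center_not_near1] for large n. *)
Lemma max_on_square (g : C -> C) (s : R) : 0 < s ->
  (forall w, `|Re w| <= s -> `|Im w| <= s -> cdiff g w) ->
  exists w, [/\ `|Re w| <= s, `|Im w| <= s, `|Re w| = s \/ `|Im w| = s & nc (g 0) <= nc (g w)].
Proof.
move=> s0 dg; apply: contrapT => nex.
have small w : `|Re w| <= s -> `|Im w| <= s -> `|Re w| = s \/ `|Im w| = s -> nc (g w) < nc (g 0).
  by move=> h1 h2 h3; rewrite ltNge; apply/negP => h4; apply: nex; exists w.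
have ss : `|s| = s by rewrite gtr0_norm.
have [|z [h1 h2 _]|c [c1 c2 c3] hc] := compact_max (f := nc \o g) _ (@compact_square s).
- by exists (Complex s s); rewrite /= ss; split => //; left.
- by apply: continuous_comp; [apply: cdiff_continuous; exact: dg|exact: continuous_nc].
have cg := small c c1 c2 c3.
have g0 : 0 < nc (g 0) by exact: le_lt_trans (nc_ge0 _) cg.
have gn0 : g 0 != 0 by rewrite -nc_gt0.
pose q := nc (g c) / nc (g 0).
have q1 : q < 1 by rewrite ltr_pdivrMr // mul1r.
have q0 : 0 <= q by rewrite divr_ge0 ?nc_ge0.
have [n qn] : exists n, q ^+ n <= 4^-1.
  have : (fun n => q ^+ n) @ \oo --> (0 : R) by apply: cvg_expr; rewrite ger0_norm.
  move/cvgrPdist_lt => /(_ 4^-1) [|N _ hN]; first by rewrite invr_gt0.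
  exists N; have := hN N (leqnn N); rewrite sub0r normrN ger0_norm ?exprn_ge0 //.
  exact: ltW.
have := @vanishing_center_not_near1 R (fun w => 1 - (g w / g 0) ^+ n) s s0; apply.
- move=> x y hx hy; apply: cdiffB; first exact: cdiff_cst.
  apply: cdiffX; apply: cdiffM; last exact: cdiff_cst.
  by apply: dg; rewrite /= ler_norml.
- by rewrite divff // expr1n subrr.
move=> x y hx hy hb; rewrite subKr ncX ncM ncV; apply: le_trans qn.
rewrite lerXn2r // ?nnegrE ?divr_ge0 ?nc_ge0 // ler_wpM2r ?invr_ge0 ?nc_ge0 //.
by apply: (hc (Complex x y)); rewrite /= !ler_norml.
Qed.

(* At a maximum point z0 of |g| with the largest real part, the product of the four functions
   w |-> g (z0 + i^k w) contradicts [max_on_square]. *)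
Lemma max_principle (G Gam : set C) (g : C -> C) (m : R) : open G -> compact (G `|` Gam) ->
  (forall z, (G `|` Gam) z -> {for z, continuous g}) ->
  (forall z, G z -> g z <> 0 -> cdiff g z) ->
  0 <= m -> (forall z, Gam z -> nc (g z) <= m) ->
  forall z, (G `|` Gam) z -> nc (g z) <= m.
Proof.
move=> oG cK cg dg m0 hm z1 Kz1; rewrite leNgt; apply/negP => z1m.
have cng z : (G `|` Gam) z -> {for z, continuous (nc \o g)}.
  by move=> Kz; apply: continuous_comp; [exact: cg|exact: continuous_nc].
have [|c cK' hc] := compact_max _ cK cng; first by exists z1.
set M := nc (g c) in hc; have mM : m < M by exact: lt_le_trans z1m (hc _ Kz1).
have M0 : 0 < M by exact: le_lt_trans mM.
pose S := [set z | (G `|` Gam) z /\ nc (g z) = M].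
have cS : compact S.
  apply: (subclosed_compact _ cK) => [|z []//] z clS.
  have Kz : (G `|` Gam) z.
    by apply: (compact_closed hausdorff_C cK); apply: closure_subset clS => w [].
  split => //; apply: contrapT => /eqP gM.
  have /clS[w [[_ wM] /=]] : nbhs z [set w | nc (g w) != M].
    apply: (cng z Kz [set x | x != M]); apply: open_nbhs_nbhs; split => //; exact: open_neq.
  by rewrite wM eqxx.
have [|z0 [Kz0 z0M] hz0] := compact_max _ cS (fun z _ => @continuous_Re R z).
  by exists c.
have Gz0 : G z0 by case: Kz0 => // /hm; rewrite z0M leNgt mM.
(* Near [z0] the modulus of [g] is close to [M > 0], so [g] has no zero there and the hypothesis
   makes it differentiable. *)
have [r r0 rG] : exists2 r : R, 0 < r & forall w, nc (w - z0) < r -> G w /\ g w <> 0.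
  apply/nbhs_normcP; apply: filterI; first exact: open_nbhs_nbhs.
  have [r r0 hr] := (continuous_ncP g z0).1 (cg z0 Kz0) M M0.
  apply/nbhs_normcP; exists r => // w /hr; rewrite -z0M => h gw0.
  by move: h; rewrite gw0 sub0r ncN ltxx.
pose s := r / 3; have s0 : 0 < s by rewrite divr_gt0.
pose I : C := Complex 0 1.
have inb (a w : C) : nc a = 1 -> `|Re w| <= s -> `|Im w| <= s -> G (z0 + a * w) /\ g (z0 + a * w) <> 0.
  move=> a1 h1 h2; apply: rG; rewrite addrAC subrr add0r ncM a1 mul1r.
  by apply: le_lt_trans (nc_le_ReIm _) _; move: h1 h2; rewrite /s; lra.
have n1 : nc 1 = 1 by exact: nc1.
have nm1 : nc (- 1) = 1 by rewrite ncN nc1.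
have nI : nc I = 1 by rewrite /= expr0n /= add0r expr1n sqrtr1.
have nmI : nc (- I) = 1 by rewrite ncN nI.
(* On the boundary of the square [w] is nonzero, so one of [w], [- w], [I * w], [- I * w] has
   positive real part. By the choice of [z0] the corresponding factor has modulus below [M], and the
   others have modulus at most [M], whereas all four are equal to [M] at the centre. *)
pose g4 w := g (z0 + 1 * w) * g (z0 + (- 1) * w) * (g (z0 + I * w) * g (z0 + (- I) * w)).
have [w Rw Iw|w [Rw Iw bw]] := @max_on_square g4 s s0.
  have D (a : C) : nc a = 1 -> cdiff (fun w => g (z0 + a * w)) w.
    by move=> a1; apply: cdiff_shift; have [h1 h2] := inb a w a1 Rw Iw; exact: dg.
  by apply: cdiffM; apply: cdiffM; exact: D.
rewrite /g4 !mulr0 addr0 !ncM z0M.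
have le (a : C) : nc a = 1 -> nc (g (z0 + a * w)) <= M.
  by move=> a1; apply: hc; left; have [] := inb a w a1 Rw Iw.
have lt (a : C) : nc a = 1 -> 0 < Re (a * w) -> nc (g (z0 + a * w)) < M.
  move=> a1 aw; rewrite lt_neqAle le // andbT; apply/eqP => gM.
  have := hz0 (z0 + a * w) (conj (or_introl (inb a w a1 Rw Iw).1) gM).
  rewrite leNgt => /negP; apply.
  have -> : Re (z0 + a * w) = Re z0 + Re (a * w) by case: (z0) (a * w) => ? ? [].
  by rewrite ltrDl.
move=> H.
have A1 := le 1 n1; have A2 := le _ nm1; have A3 := le _ nI; have A4 := le _ nmI.
have P1 := nc_ge0 (g (z0 + 1 * w)); have P2 := nc_ge0 (g (z0 + -1 * w)).
have P3 := nc_ge0 (g (z0 + I * w)); have P4 := nc_ge0 (g (z0 + - I * w)).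
have L1 := lt 1 n1; have L2 := lt _ nm1; have L3 := lt _ nI; have L4 := lt _ nmI.
have R1 : Re (1 * w) = Re w by rewrite mul1r.
have R2 : Re (- 1 * w) = - Re w by rewrite mulN1r; case: (w).
have R3 : Re (I * w) = - Im w by case: (w) => a b /=; ring.
have R4 : Re (- I * w) = Im w by case: (w) => a b /=; ring.
rewrite R1 in L1; rewrite R2 in L2; rewrite R3 in L3; rewrite R4 in L4.
have M2 : 0 < M * M by rewrite mulr_gt0.
set x1 := nc (g (z0 + 1 * w)) in H A1 P1 L1 *.
set x2 := nc (g (z0 + -1 * w)) in H A2 P2 L2 *.
set x3 := nc (g (z0 + I * w)) in H A3 P3 L3 *.
set x4 := nc (g (z0 + - I * w)) in H A4 P4 L4 *.
have B12 : x1 * x2 <= M * M by rewrite ler_pM.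
have B34 : x3 * x4 <= M * M by rewrite ler_pM.
have C12 : 0 <= x1 * x2 by rewrite mulr_ge0.
have C34 : 0 <= x3 * x4 by rewrite mulr_ge0.
have D12 : M * M <= x1 * x2 by rewrite leNgt; apply/negP => h; nra.
have D34 : M * M <= x3 * x4 by rewrite leNgt; apply/negP => h; nra.
have E1 : M <= x1 by rewrite leNgt; apply/negP => h; nra.
have E2 : M <= x2 by rewrite leNgt; apply/negP => h; nra.
have E3 : M <= x3 by rewrite leNgt; apply/negP => h; nra.
have E4 : M <= x4 by rewrite leNgt; apply/negP => h; nra.
have Re0 : Re w = 0.
  apply/eqP; rewrite eq_le; apply/andP; split; rewrite leNgt; apply/negP => h.
    by have := L1 h; rewrite ltNge E1.
  by have := L2; rewrite oppr_gt0 => /(_ h); rewrite ltNge E2.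
have Im0 : Im w = 0.
  apply/eqP; rewrite eq_le; apply/andP; split; rewrite leNgt; apply/negP => h.
    by have := L4 h; rewrite ltNge E4.
  by have := L3; rewrite oppr_gt0 => /(_ h); rewrite ltNge E3.
by move: bw; rewrite Re0 Im0 normr0 => -[] h; move: s0; rewrite -h ltxx.
Qed.

End MaximumPrinciple.

(** * Topology of the plane and of the sphere *)

Section Connectedness.
Context {R : realType}.
Local Notation C := R[i].
Local Notation nc := (@ComplexField.Normc.normc R).
Local Notation Re := (@complex.Re R).
Local Notation Im := (@complex.Im R).

Lemma connected_sub_open (T : topologicalType) (A U V : set T) : connected A ->
  open U -> open V -> A `<=` U `|` V -> A `&` (U `&` V) = set0 -> A `&` U !=set0 -> A `<=` U.
Proof.
move=> cA oU oV AUV d AU; have E : A `&` U = A.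
  apply: cA => //; first by exists U.
  exists (~` V); first exact: open_closedC.
  apply/seteqP; split=> x [Ax].
    by move=> Ux; split => // Vx; have : (A `&` (U `&` V)) x by []; rewrite d.
  by move=> nV; split => //; case: (AUV x Ax).
by move=> x; rewrite -{1}E => -[].
Qed.

Lemma connected_sub_clopen (T : topologicalType) (A U : set T) : connected A ->
  open U -> closed U -> A `&` U !=set0 -> A `<=` U.
Proof.
move=> cA oU cU; apply: (connected_sub_open cA oU (closed_openC cU)).
  by rewrite setUv.
by rewrite setICr setI0.
Qed.

Lemma continuous_curve (f g : R -> R) : continuous f -> continuous g ->
  continuous (fun t => Complex (f t) (g t) : C).
Proof.
move=> cf cg t A /= /nbhs_normcP[r r0 rA].
have r20 : 0 < r / 2 by rewrite divr_gt0.
have hf : nbhs t (f @^-1` ball (f t) (r / 2)) := cf t _ (nbhsx_ballx (f t) _ r20).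
have hg : nbhs t (g @^-1` ball (g t) (r / 2)) := cg t _ (nbhsx_ballx (g t) _ r20).
apply: (filterS _ (filterI hf hg)) => u [h1 h2]; apply: rA.
apply: le_lt_trans (nc_le_ReIm _) _; move: h1 h2; rewrite /ball /= => h1 h2.
by rewrite [r]splitr ltrD // distrC.
Qed.

Lemma polar (z : C) : exists t, z = Complex (nc z * cos t) (nc z * sin t).
Proof.
case: z => x y; set r := nc _.
have r0 : 0 <= r by exact: nc_ge0.
have [r00|rn0] := eqVneq r 0.
  exists 0; rewrite r00 !mul0r; apply/eqP; rewrite -nc_eq0; exact/eqP.
have rp : 0 < r by rewrite lt_def rn0.
have rE : r ^+ 2 = x ^+ 2 + y ^+ 2 by rewrite /r /= sqr_sqrtr // addr_ge0 ?sqr_ge0.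
have u1 : (x / r) ^+ 2 + (y / r) ^+ 2 = 1.
  by rewrite !expr_div_n -mulrDl -rE divff // sqrf_eq0.
have b : -1 <= x / r <= 1.
  by rewrite -ler_norml -(@ler_pXn2r _ 2) ?nnegrE // expr1n real_normK ?num_real // -u1 lerDl sqr_ge0.
have c1 : cos (acos (x / r)) = x / r by rewrite acosK // in_itv.
have s1 : sin (acos (x / r)) = `|y / r|.
  by rewrite sin_acos // -sqrtr_sqr; congr Num.sqrt; rewrite -u1 addrAC subrr add0r.
have [y0|y0] := leP 0 (y / r).
  by exists (acos (x / r)); rewrite c1 s1 ger0_norm // ![r * _]mulrC !divfK.
by exists (- acos (x / r)); rewrite cosN sinN c1 s1 ltr0_norm // opprK ![r * _]mulrC !divfK.
Qed.

Lemma nc_polar r t : 0 <= r -> nc (Complex (r * cos t) (r * sin t)) = r.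
Proof.
by move=> r0; rewrite /= !exprMn -mulrDr cos2Dsin2 mulr1 sqrtr_sqr ger0_norm.
Qed.

Lemma connected_image (T U : topologicalType) (A : set T) (f : T -> U) :
  connected A -> (forall x, A x -> {for x, continuous f}) -> connected (f @` A).
Proof.
move=> cA cf; apply: connected_continuous_connected => //.
by apply: continuous_in_subspaceT => z; rewrite inE => /cf.
Qed.

Lemma compact_image (T U : topologicalType) (A : set T) (f : T -> U) :
  compact A -> (forall x, A x -> {for x, continuous f}) -> compact (f @` A).
Proof.
move=> cA cf; apply: continuous_compact => //.
by apply: continuous_in_subspaceT => z; rewrite inE => /cf.
Qed.

(** The circles with radius in [I] are connected, and each meets the positive real axis, where these
    radii form a segment. *)
Lemma connected_radial (I : set R) : is_interval I -> (forall x, I x -> 0 < x) ->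
  connected [set z : C | I (nc z)].
Proof.
move=> iI I0; have [[r0 Ir0]|nI] := pselect (I !=set0); last first.
  have -> : [set z : C | I (nc z)] = set0.
    by apply/seteqP; split=> z //= Iz; apply: nI; exists (nc z).
  exact: connected0.
pose seg := (fun t : R => Complex t 0 : C) @` I.
pose circ r := (fun t : R => Complex (r * cos t) (r * sin t) : C) @` setT.
have cseg : connected seg.
  apply: connected_image; first exact/connected_intervalP.
  by move=> x _; exact: continuous_Complexl.
have ccirc r : connected (circ r).
  apply: connected_image; first by apply/connected_intervalP => x y _ _ z _.
  move=> x _; apply: continuous_curve => t; apply: cvgM; try exact: cvg_cst.
    exact: continuous_cos.
  exact: continuous_sin.
have -> : [set z : C | I (nc z)] = \bigcup_(r in I) (seg `|` circ r).
  apply/seteqP; split=> [z /= Iz|_ [r Ir [[t It <-]|[t _ <-]]]] /=.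
  - by exists (nc z) => //; right; have [t zE] := polar z; exists t.
  - by rewrite expr0n /= addr0 sqrtr_sqr gtr0_norm // I0.
  - by have /= -> := nc_polar t (ltW (I0 _ Ir)).
apply: bigcup_connected.
  by exists (Complex r0 0) => r _; left; exists r0.
move=> r Ir; apply: connectedU => //; exists (Complex r 0); split; first by exists r.
by exists 0 => //; rewrite cos0 sin0 mulr1 mulr0.
Qed.

Lemma connected_star (A : set C) (a : C) : A a ->
  (forall z (t : R), A z -> 0 <= t <= 1 -> A (a + (t%:C)%C * (z - a))) -> connected A.
Proof.
move=> Aa hA.
have -> : A = \bigcup_(z in A) ((fun t : R => a + (t%:C)%C * (z - a)) @` `[0, 1]).
  apply/seteqP; split=> [z Az|_ [z Az [t ht <-]]].
    exists z => //; exists 1; first by rewrite /= in_itv /= ler01 lexx.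
    by rewrite mul1r addrC subrK.
  by apply: hA => //; rewrite /= in_itv /= in ht.
apply: bigcup_connected.
  exists a => z Az; exists 0; first by rewrite /= in_itv /= ler01 lexx.
  by rewrite mul0r addr0.
move=> z Az; apply: connected_image.
  exact/connected_intervalP/interval_is_interval.
move=> t _.
have -> : (fun t : R => a + (t%:C)%C * (z - a)) =
   fun t : R => Complex (Re a + t * Re (z - a)) (Im a + t * Im (z - a)).
  by apply/funext => u; case: (a) (z - a) => p q [p' q']; apply/eqP; rewrite eq_complex /=; apply/andP; split; apply/eqP; ring.
by apply: continuous_curve => u; apply: cvgD; try exact: cvg_cst; apply: cvgM; try exact: cvg_cst; exact: cvg_id.
Qed.

Lemma connected_C : connected [set: C].
Proof. exact: (@connected_star _ 0). Qed.

Lemma nc_tri (x y z : C) : nc (x - z) <= nc (x - y) + nc (y - z).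
Proof. by have := ncD (x - y) (y - z); rewrite addrA subrK. Qed.

Lemma connected_disc (a : C) r : 0 < r -> connected [set z : C | nc (z - a) < r].
Proof.
move=> r0; apply: (@connected_star _ a); first by rewrite /= subrr nc0.
move=> z t /= zr /andP[t0 t1]; rewrite addrC addKr ncM ncR ger0_norm //.
by apply: le_lt_trans zr; rewrite ler_piMl // nc_ge0.
Qed.

Lemma open_disc (a : C) r : open [set z : C | nc (z - a) < r].
Proof.
rewrite openE => z /= zr; apply/nbhs_normcP; exists (r - nc (z - a)); first by rewrite subr_gt0.
move=> w; rewrite ltrBrDr => h; rewrite /=; apply: le_lt_trans h.
exact: nc_tri.
Qed.

Lemma compact_disc (a : C) r : compact [set z : C | nc (z - a) <= r].
Proof.
apply: (@compact_closed_bounded R _ (r + nc a)).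
  rewrite -openC openE => z /= /negP; rewrite -ltNge => zr; apply/nbhs_normcP.
  exists (nc (z - a) - r); first by rewrite subr_gt0.
  move=> w wz /=; apply/negP; rewrite -ltNge.
  by have := nc_tri z w a; rewrite (ncC z w); lra.
by move=> z /= zr; apply: le_trans (_ : nc (z - a) + nc a <= _); [rewrite -{1}(subrK a z); exact: ncD|rewrite lerD2r].
Qed.

End Connectedness.

(** * The Riemann sphere as a topological space *)

Section Sphere.
Context {R : realType}.
Local Notation C := R[i].
Local Notation nc := (@ComplexField.Normc.normc R).
Local Notation S := (sphere R).
Local Notation infty := (@infty R).

Lemma nbhs_infty (A : set S) : nbhs infty A <->
  A infty /\ exists M : R, forall z, M <= nc z -> A (fin z).
Proof.
split=> [[W [cW clW] WA]|[A0 [M hM]]].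
  split; first by apply: WA; right.
  have [M M0 hM] := compact_nc_bounded cW.
  exists M => z Mz; apply: WA; left; exists z => // /hM.
  by rewrite ltNge Mz.
exists [set z | nc (z - 0) <= M].
  by split; [exact: compact_disc|apply: compact_closed; [exact: hausdorff_C|exact: compact_disc]].
move=> _ [[z /= /negP + <-]|->] //.
by rewrite -ltNge subr0 => /ltW/hM.
Qed.

Lemma nbhs_fin (z : C) (A : set S) : nbhs (fin z) A <-> nbhs z (fin @^-1` A).
Proof. by []. Qed.

Lemma continuous_fin : continuous (@fin R).
Proof. exact: one_point_compactification_some_continuous. Qed.

Lemma open_fin (U : set C) : open U -> open (@fin R @` U).
Proof. exact: one_point_compactification_open_some. Qed.

Lemma open_preimage_fin (U : set S) : open U -> open (fin @^-1` U).
Proof. by apply: open_comp => z _; exact: continuous_fin. Qed.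

Lemma fin_infty (z : C) : fin z <> infty. Proof. by []. Qed.

Lemma fin_inj : injective (@fin R). Proof. by move=> x y []. Qed.

Lemma sphere_hausdorff : hausdorff_space S.
Proof.
have fi (z : C) : exists U V : set S, [/\ open U, open V, U (fin z), V infty & U `&` V = set0].
  exists (fin @` [set w | nc (w - z) < 1]), (~` (fin @` [set w | nc (w - z) <= 1])); split.
  - by apply: open_fin; exact: open_disc.
  - rewrite openE => -[w /= hw|_].
      apply/nbhs_fin; apply: (@open_nbhs_nbhs C); split; last first.
        by move=> -[w' /= hw' [ww]]; apply: hw; exists w' => //; rewrite -ww.
      rewrite (_ : _ @^-1` _ = ~` [set w | nc (w - z) <= 1]).
        by apply: closed_openC; apply: compact_closed; [exact: hausdorff_C|exact: compact_disc].
      apply/seteqP; split=> x /= hx; first by move=> h; apply: hx; exists x.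
      by move=> [w' /= hw' [ww]]; apply: hx; rewrite -ww.
    apply/nbhs_infty; split; first by move=> [].
    exists (2 + nc z) => x hx [w /= hw [wx]]; subst w.
    by have := ncD (x - z) z; rewrite subrK; lra.
  - by exists z => //=; rewrite subrr nc0 ltr01.
  - by move=> [].
  - apply/seteqP; split=> x // [[w /= hw <-]] h; apply: h; exists w => //=; exact: ltW.
rewrite open_hausdorff => -[z|] [w|] // zw.
- have zw' : z != w by apply: contra_neq zw => ->.
  have hC := @hausdorff_C R; rewrite open_hausdorff in hC.
  have [[A B] [/= zA wB] [oA oB /eqP AB]] := hC z w zw'.
  have E : fin @` A `&` fin @` B = set0.
    rewrite -subset0 => x [[u Au <-] [v Bv [vu]]].
    by have : (A `&` B) u; [by split => //; rewrite -vu|rewrite AB].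
  exists (fin @` A, fin @` B); rewrite /= !inE.
    by split; [exists z => //; rewrite inE in zA|exists w => //; rewrite inE in wB].
  by split; [exact: open_fin|exact: open_fin|].
- have [U [V [oU oV Uz Vi UV]]] := fi z.
  by exists (U, V) => /=; split => //; [exact: mem_set|exact: mem_set|apply/eqP].
- have [U [V [oU oV Uz Vi UV]]] := fi w.
  rewrite setIC in UV.
  by exists (V, U) => /=; split => //; [exact: mem_set|exact: mem_set|apply/eqP].
Qed.

Lemma sphere_compact : compact [set: S].
Proof. exact: one_point_compactification_compact. Qed.

Lemma compact_sphere (A : set S) : closed A -> compact A.
Proof. by move=> cA; apply: (subclosed_compact cA sphere_compact). Qed.

Lemma closed_sphere (A : set S) : compact A -> closed A.
Proof. by apply: compact_closed; exact: sphere_hausdorff. Qed.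

(** The trace on the plane of a clopen set with a finite point is the whole plane, and infinity is
    then a limit of it. A clopen set reduced to infinity is excluded by applying this to its
    complement. *)
Lemma sphere_clopen (B : set S) : open B -> closed B -> B !=set0 -> B = setT.
Proof.
move=> oB cB B0.
have H (D : set S) : open D -> closed D -> forall z : C, D (fin z) -> D = setT.
  move=> oD cD z Dz; have sub : [set: C] `<=` fin @^-1` D.
    apply: connected_sub_clopen; first exact: connected_C.
    - exact: open_preimage_fin.
    - by apply: preimage_closed => // x _; exact: continuous_fin.
    - by exists z.
  apply/seteqP; split=> // -[x|] _; first exact: sub.
  apply: contrapT => nD; have : nbhs infty (~` D) by apply: open_nbhs_nbhs; split=> //; exact: closed_openC.
  move=> /nbhs_infty[_ [M hM]]; apply: (hM (`|M|%:C)%C); last exact: sub.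
  by rewrite ncR normr_id ler_norm.
case: B0 => -[z Bz|Bi]; first exact: (H B oB cB z).
have [[z Bz]|nB] := pselect (exists z, B (fin z)); first exact: (H B oB cB z).
have := H (~` B) (closed_openC cB) (open_closedC oB) 0.
have nB0 : (~` B) (fin 0) by move=> ?; apply: nB; exists 0.
by move=> /(_ nB0) E; have : (~` B) infty by rewrite E.
Qed.

Lemma compact_preimage_fin (K : set S) : closed K -> ~ K infty -> compact (fin @^-1` K).
Proof.
move=> cK Ki; have : nbhs infty (~` K) by apply: open_nbhs_nbhs; split=> //; exact: closed_openC.
move=> /nbhs_infty[_ [M hM]]; apply: (@compact_closed_bounded R _ M).
  by apply: preimage_closed => // x _; exact: continuous_fin.
by move=> z Kz; rewrite leNgt; apply/negP => /ltW/hM; exact.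
Qed.

Lemma open_neq_infty : open (~` [set infty]).
Proof.
rewrite openE => -[z|] //= _; apply/nbhs_fin/nbhs_normcP; exists 1 => //.
Qed.

Lemma finite_partE (F : C -> S) z : F z <> infty -> F z = fin (finite_part F z).
Proof. by rewrite /finite_part; case: (F z). Qed.

Lemma near_finite (F : C -> S) z : {for z, continuous F} -> F z <> infty ->
  \forall w \near z, F w <> infty.
Proof.
by move=> cF Fz; apply: (cF (~` [set infty])); apply: open_nbhs_nbhs; split=> //; exact: open_neq_infty.
Qed.

Lemma holomorphic_continuous (F : C -> S) z : holomorphic_at F z -> {for z, continuous F}.
Proof.
move=> hF A; have [Fz dF] := nbhs_singleton hF.
rewrite finite_partE // => /nbhs_fin hA.
have hA' : nbhs z (finite_part F @^-1` (fin @^-1` A)) := cdiff_continuous (CDiff dF) hA.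
apply: (filterS _ (filterI hF hA')) => w [[Fw _]] /=.
by rewrite /preimage /= -finite_partE.
Qed.

Lemma meromorphic_continuous (f : C -> S) z : meromorphic f -> {for z, continuous f}.
Proof.
move=> [h1 h2]; have [pz|pz] := pselect (poles f z); last exact: holomorphic_continuous (h1 z pz).
move=> A hA; rewrite pz in hA; have [_ cf] := h2 z pz.
have H : nbhs z [set w | w != z -> A (f w)] := cf A hA.
apply: (filterS _ H) => w /= h; have [->|wz] := eqVneq w z; last exact: h.
by rewrite /preimage /= pz; exact: nbhs_singleton hA.
Qed.

Lemma holomorphic_near (F : C -> S) z : holomorphic_at F z ->
  \forall w \near z, holomorphic_at F w.
Proof. exact: nbhs_interior. Qed.

Lemma nbhs_preimage_cdiff (g : C -> C) z (P : set C) :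
  cdiff g z -> nbhs (g z) P -> nbhs z (g @^-1` P).
Proof. by move=> /cdiff_continuous; exact. Qed.

Lemma holomorphic_comp (f g : C -> S) z : holomorphic_at g z ->
  holomorphic_at f (finite_part g z) -> holomorphic_at (fun w => obind f (g w)) z.
Proof.
move=> hg hf; have [gz dgz] := nbhs_singleton hg.
pose P : set C := fun y => f y <> infty /\ derivable (finite_part f) y 1.
have hf' := nbhs_preimage_cdiff (CDiff dgz) (hf : nbhs (finite_part g z) P).
apply: (filterS _ (filterI (holomorphic_near hg) hf')) => w [hgw [fw dfw]].
have [gw dgw] := nbhs_singleton hgw.
have gE := finite_partE gw; split; first by rewrite gE.
apply: derivable_of_cdiff.
have := cdiff_comp (CDiff dfw) (CDiff dgw); apply: cdiff_near.
apply: (filterS _ (near_finite (holomorphic_continuous hgw) gw)).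
by move=> u /finite_partE gu; rewrite [in RHS]/finite_part gu.
Qed.

End Sphere.

(** * Images of compact sets under meromorphic functions *)

Section Images.
Context {R : realType}.
Local Notation C := R[i].
Local Notation nc := (@ComplexField.Normc.normc R).
Local Notation S := (sphere R).
Local Notation infty := (@infty R).

(** The map [y -> 1 / (y - w)] extended by its limit 0 at infinity: composed with [F], it is
    continuous at the poles of [F], which become its zeros. *)
Definition inv_sub (w : C) (s : S) : C := if s is Some y then (y - w)^-1 else 0.

Lemma continuous_inv_sub w s : s <> fin w -> {for s, continuous (inv_sub w)}.
Proof.
case: s => [y|] yw.
  have yw0 : y - w != 0 by rewrite subr_eq0; apply/eqP => h; apply: yw; rewrite h.
  have d : cdiff (fun x => (x - w)^-1) y.
    exact: (@cdiffV R (fun x => x - w) y yw0 (cdiffB (cdiff_id y) (cdiff_cst w y))).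
  by move=> A hA; have := nbhs_preimage_cdiff d hA.
move=> A /nbhs_normcP[r r0 rA]; apply/nbhs_infty; split; first by apply: rA; rewrite subrr nc0.
exists (nc w + r^-1 + 1) => z hz; apply: rA; rewrite subr0 ncV.
have h : r^-1 < nc (z - w).
  by have := nc_tri z w 0; rewrite !subr0; lra.
by rewrite invf_plt ?posrE // (lt_trans _ h) // invr_gt0.
Qed.

Section Image.
Variables (G Gam : set C) (F : C -> S).
Hypotheses (oG : open G) (cK : compact (G `|` Gam)) (cGam : compact Gam).
Hypothesis (cF : forall z, (G `|` Gam) z -> {for z, continuous F}).
Hypothesis (dF : forall z, G z -> F z <> infty -> holomorphic_at F z).

Let K := G `|` Gam.

Lemma image_closed : closed (F @` K).
Proof. by apply: closed_sphere; apply: compact_image. Qed.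

Lemma image_boundary_closed : closed (F @` Gam).
Proof. by apply: closed_sphere; apply: compact_image => // z ?; apply: cF; right. Qed.

(** Let the disc of radius [d] about [w] miss the image of [Gam], and suppose that some [w'] within
    [d / 2] of [w] is not a value. Then [1 / (F - w')] is at most [2 / d] on [Gam] but exceeds
    [2 / d] where [F = w], against the maximum principle. *)
Lemma image_nbhs_fin w : (F @` K) (fin w) -> ~ (F @` Gam) (fin w) -> nbhs (fin w) (F @` K).
Proof.
move=> [a Ka Fa] nG.
have Ga : G a by case: Ka => // h; case: nG; exists a.
have : nbhs (fin w) (~` (F @` Gam)).
  by apply: open_nbhs_nbhs; split => //; apply: closed_openC; exact: image_boundary_closed.
move=> /nbhs_fin/nbhs_normcP[d d0 hd].
apply/nbhs_fin/nbhs_normcP; exists (d / 2); first by rewrite divr_gt0.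
move=> w' ww'; apply: contrapT => nw'.
have Fw' z : K z -> F z <> fin w' by move=> Kz Fz; apply: nw'; exists z.
have ww0 : w - w' != 0.
  by rewrite subr_eq0; apply/eqP => e; apply: (Fw' a) => //; rewrite Fa e.
have := @max_principle R G Gam (inv_sub w' \o F) (2 / d) oG cK.
have c1 z : K z -> {for z, continuous (inv_sub w' \o F)}.
  by move=> Kz; apply: continuous_comp; [exact: cF|apply: continuous_inv_sub; exact: Fw'].
move=> /(_ c1) H; suff : nc (inv_sub w' (F a)) <= 2 / d.
  have p : 0 < nc (w - w') by rewrite nc_gt0.
  rewrite Fa /= ncV; apply/negP; rewrite -ltNge -[2 / d]invf_div ltf_pV2 ?posrE ?divr_gt0 //.
  by rewrite ncC.
apply: H => //; last 2 first.
- by rewrite divr_ge0 // ltW.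
- move=> z Gz; rewrite /comp; case Fz : (F z) => [y|]; last first.
    by rewrite [inv_sub _ _]/(0 : C) nc0 divr_ge0 // ltW.
  rewrite [inv_sub _ _]/(y - w')^-1.
  have : d <= nc (y - w).
    by rewrite leNgt; apply/negP => /hd; apply; exists z.
  move=> h; have := nc_tri y w' w; rewrite ncV -[2 / d]invf_div lef_pV2 ?posrE ?divr_gt0 //; last first.
    by rewrite nc_gt0 subr_eq0; apply/eqP => e; apply: (Fw' z); [right|rewrite Fz e].
  by move: h ww'; lra.
move=> z Gz /=; case Fz : (F z) => [y|] //= nz.
have hF := dF Gz; rewrite Fz in hF; have {}hF := hF (@fin_infty _ y).
have [_ dz] := nbhs_singleton hF.
have fz : finite_part F z = y by rewrite /finite_part Fz.
have dd : cdiff (fun x => (finite_part F x - w')^-1) z.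
  apply: (@cdiffV R (fun x => finite_part F x - w') z _ (cdiffB (CDiff dz) (cdiff_cst w' z))).
  by rewrite fz subr_eq0; apply/eqP => e; apply: (Fw' z); [left|rewrite Fz e].
apply: cdiff_near dd; apply: (filterS _ hF) => u [Fu _].
by rewrite /comp (finite_partE Fu).
Qed.

(** The finite points of large modulus form a connected set [T] that misses the image of [Gam]. If
    the image meets [T], it is open and closed in it by [image_nbhs_fin], hence contains it; the
    other case is absurd. *)
Lemma image_nbhs_infty : (F @` K) infty -> ~ (F @` Gam) infty -> nbhs infty (F @` K).
Proof.
move=> Ki nG.
have : nbhs infty (~` (F @` Gam)).
  by apply: open_nbhs_nbhs; split => //; apply: closed_openC; exact: image_boundary_closed.
move=> /nbhs_infty[_ [M hM]].
pose T : set S := fin @` [set y : C | [set r | `|M| < r] (nc y)].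
have cT : connected T.
  apply: connected_image; last by move=> x _; exact: continuous_fin.
  apply: (@connected_radial R [set r | `|M| < r]).
    by move=> x y /= hx _ z /andP[xz _]; exact: lt_le_trans xz.
  by move=> x /=; exact: le_lt_trans.
have TG w : (F @` Gam) (fin w) -> nc w <= `|M|.
  move=> h; rewrite leNgt; apply/negP => Mw; apply: (hM w) => //.
  by rewrite (le_trans (ler_norm M)) // ltW.
suff TK : T `<=` F @` K.
  apply/nbhs_infty; split => //; exists (`|M| + 1) => z hz; apply: TK; exists z => //=.
  by apply: lt_le_trans hz; rewrite ltrDl.
have [[z Kz Tz]|nT] := pselect (exists2 z, K z & T (F z)).
  apply: (@subset_trans _ ((F @` K) `&` T)); last by move=> s [].
  apply: (@connected_sub_open _ T ((F @` K) `&` T) (~` (F @` K)) cT) => //.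
  - rewrite openE => s [Ks [w /= hw ws]]; subst s.
    apply: filterI.
      by apply: image_nbhs_fin => // /TG; rewrite leNgt hw.
    apply: open_nbhs_nbhs; split; last by exists w.
    apply: open_fin; have -> : [set y : C | [set r | `|M| < r] (nc y)] = ~` [set y | nc y <= `|M|].
      by apply/seteqP; split=> y /=; rewrite ltNge => /negP.
    by apply: closed_openC; apply: closed_preimage_le; exact: continuous_nc.
  - by apply: closed_openC; exact: image_closed.
  - by move=> s Ts; have [Ks|nKs] := pselect ((F @` K) s); [left|right].
  - by rewrite -subset0 => s [_ [[]]].
  - by exists (F z); split => //; split => //; exists z.
have KF z : K z -> F z <> infty -> nc (finite_part F z) <= `|M|.
  move=> Kz Fz; rewrite leNgt; apply/negP => h; apply: nT; exists z => //.
  by rewrite finite_partE //; exists (finite_part F z).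
(* If the image avoids [T], continuity makes every point near a pole a pole. The poles in [K] are
   then open and closed in the plane, hence fill it, although [K] is bounded. *)
pose P := [set z | K z /\ F z = infty].
have oP : open P.
  rewrite openE => z [Kz Fz].
  have Gz : G z by case: Kz => // h; case: nG; exists z.
  have nN : nbhs (F z) [set s | forall y, s = fin y -> `|M| < nc y].
    rewrite Fz; apply/nbhs_infty; split => //; exists (`|M| + 1) => y hy _ [<-].
    by apply: lt_le_trans hy; rewrite ltrDl.
  have nz : nbhs z (F @^-1` [set s | forall y, s = fin y -> `|M| < nc y]) := cF (or_introl Gz) nN.
  have nGz : nbhs z G by exact: open_nbhs_nbhs.
  apply: (filterS _ (filterI nGz nz)) => u [Gu hu]; split; first by left.
  apply: contrapT => Fu; have := hu _ (finite_partE Fu).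
  by rewrite ltNge KF //; left.
have clP : closed P.
  move=> z clz; have Kz : K z.
    by apply: (compact_closed (@hausdorff_C R) cK); apply: closure_subset clz => w [].
  split => //; apply: contrapT => Fz.
  by have [w [[_ Fw] nFw]] := clz _ (near_finite (cF Kz) Fz).
have := connected_sub_clopen (@connected_C R) oP clP.
case: Ki => a Ka Fa; have Pa : ([set: C] `&` P) !=set0 by exists a.
move=> /(_ Pa) CP; have [B B0 hB] := compact_nc_bounded cK.
have /hB : (G `|` Gam) (B%:C)%C by have [] := CP (B%:C)%C I.
by rewrite ncR gtr0_norm // ltxx.
Qed.

Lemma image_diff_open : open ((F @` K) `\` (F @` Gam)).
Proof.
rewrite openE => s [Ks nG]; apply: filterI.
  by case: s Ks nG => [w|]; [exact: image_nbhs_fin|exact: image_nbhs_infty].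
by apply: open_nbhs_nbhs; split => //; apply: closed_openC; exact: image_boundary_closed.
Qed.

(** Off the image of [Gam] the image of [K] is open by [image_diff_open], and it is closed by
    compactness, so a connected set that avoids the image of [Gam] cannot leave it. *)
Lemma image_absorbs (T : set S) : connected T -> T `&` (F @` Gam) = set0 ->
  T `&` (F @` K) !=set0 -> T `<=` F @` K.
Proof.
move=> cT TG TK; have nTG s : T s -> ~ (F @` Gam) s.
  by move=> Ts Gs; have : (T `&` (F @` Gam)) s by []; rewrite TG.
suff sub : T `<=` (F @` K) `\` (F @` Gam) by move=> s /sub[].
apply: (@connected_sub_open _ T _ _ cT image_diff_open (closed_openC image_closed)).
- by move=> t Tt; have [?|?] := pselect ((F @` K) t); [left; split => //; exact: nTG|right].
- by rewrite -subset0 => t [_ [[]]].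
- by case: TK => t [Tt Kt]; exists t; split => //; split => //; exact: nTG.
Qed.

End Image.

(** By injectivity, the value at the centre of a small disc is not taken on the boundary circle, so
    [image_diff_open] makes it an interior value. *)
Lemma open_image_inj (psi : C -> C) (V : set C) : open V ->
  (forall z, V z -> cdiff psi z) -> {in V &, injective psi} -> open (psi @` V).
Proof.
move=> oV dpsi inj; rewrite openE => _ [z Vz <-].
have [r r0 hr] : exists2 r : R, 0 < r & forall w, nc (w - z) < r -> V w.
  by apply/nbhs_normcP; exact: open_nbhs_nbhs.
pose G : set C := [set w | nc (w - z) < r / 2]; pose Gam : set C := [set w | nc (w - z) = r / 2].
have KE : G `|` Gam = [set w | nc (w - z) <= r / 2].
  by apply/seteqP; split=> w /=; rewrite le_eqVlt; [case=> [->|->]; rewrite ?orbT ?eqxx|move=> /orP[/eqP|]; [right|left]].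
have KV w : (G `|` Gam) w -> V w by rewrite KE => h; apply: hr; apply: le_lt_trans h _; rewrite ltr_pdivrMr // ltr_pMr // ltr1n.
have cK : compact (G `|` Gam) by rewrite KE; exact: compact_disc.
have cGam : compact Gam.
  apply: (subclosed_compact _ cK); last by move=> w ?; right.
  apply: (closed_preimage_eq (f := fun w => nc (w - z))) => w.
  by apply: continuous_normcP => e e0; exists e => // u; apply: le_lt_trans; apply: le_trans (ler_dist_nc _ _) _; rewrite opprB addrA subrK.
have hpsi w : (G `|` Gam) w -> holomorphic_at (@fin R \o psi) w.
  move=> /KV Vw; have : nbhs w V by exact: open_nbhs_nbhs.
  by apply: filterS => u Vu; split => //; apply: derivable_of_cdiff; exact: dpsi.
have := @image_diff_open G Gam (fin \o psi) (@open_disc R z (r / 2)) cK cGam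
  (fun w Kw => holomorphic_continuous (hpsi w Kw)) (fun w Gw _ => hpsi w (or_introl Gw)).
move=> /open_preimage_fin oI; have : nbhs (psi z) (fin @^-1` (((fin \o psi) @` (G `|` Gam)) `\` ((fin \o psi) @` Gam))).
  apply: open_nbhs_nbhs; split => //; split.
    by exists z => //; left; rewrite /G /= subrr nc0 divr_gt0.
  move=> [w Gw /fin_inj pw]; have wz : w = z.
    by apply: inj => //; rewrite inE //; apply: KV; right.
  by move: Gw; rewrite /Gam /= wz subrr nc0 => /esym/eqP; rewrite gt_eqF // divr_gt0.
by apply: filterS => w [[u Ku /fin_inj uw] _]; exists u => //; exact: KV.
Qed.

End Images.

(** * Normality of the iterates *)

Section UniformConvergence.
Context {R : realType}.
Local Notation C := R[i].
Local Notation nc := (@ComplexField.Normc.normc R).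
Local Notation Re := (@complex.Re R).
Local Notation Im := (@complex.Im R).

Lemma subseq_ge (phi : nat -> nat) : {homo phi : i j / (i < j)%N} -> forall n, (n <= phi n)%N.
Proof. by move=> h; elim=> // n ih; exact: leq_ltn_trans ih (h _ _ (ltnSn n)). Qed.

Lemma real_bw (u : nat -> R) (M : R) : (forall n, `|u n| <= M) ->
  exists phi : nat -> nat, {homo phi : i j / (i < j)%N} /\
  exists l, forall e : R, 0 < e -> exists N, forall n, (N <= n)%N -> `|u (phi n) - l| < e.
Proof.
move=> hM; have [|phi iphi /cvg_ex[l /cvgrPdist_lt cphi]] := @bolzano_weierstrass R u.
  by exists M; split; [exact: num_real|move=> x Mx y _ /=; apply: le_trans (hM y) (ltW Mx)].
exists phi; split; first by move=> i j ij; rewrite ltnNge; have := iphi j i; rewrite !leEnat => ->; rewrite -ltnNge.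
by exists l => e /cphi[N _ hN]; exists N => n Nn; rewrite distrC; exact: (hN n Nn).
Qed.

Lemma complex_bw (u : nat -> C) (M : R) : (forall n, nc (u n) <= M) ->
  exists phi : nat -> nat, {homo phi : i j / (i < j)%N} /\
  exists l, forall e : R, 0 < e -> exists N, forall n, (N <= n)%N -> nc (u (phi n) - l) < e.
Proof.
move=> hM.
have [p1 [h1 [l1 c1]]] := @real_bw (fun n => Re (u n)) M (fun n => le_trans (ler_Re_nc _) (hM n)).
have [p2 [h2 [l2 c2]]] := @real_bw (fun n => Im (u (p1 n))) M (fun n => le_trans (ler_Im_nc _) (hM _)).
exists (p1 \o p2); split; first by move=> i j ij; exact: h1 _ _ (h2 _ _ ij).
exists (Complex l1 l2) => e e0; have e2 : 0 < e / 2 by rewrite divr_gt0.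
have [N1 hN1] := c1 _ e2; have [N2 hN2] := c2 _ e2.
exists (maxn N1 N2) => n; rewrite geq_max => /andP[n1 n2].
apply: le_lt_trans (nc_le_ReIm _) _; rewrite ReB ImB [e]splitr ltrD //; last exact: hN2.
by apply: hN1; apply: leq_trans n1 _; exact: subseq_ge.
Qed.

(** Letting [j] tend to infinity preserves each Cauchy estimate with the same [N]. When [N] does not
    depend on a parameter, the limits are therefore attained uniformly in that parameter. *)
Lemma real_cauchy (u : nat -> R) :
  (forall e : R, 0 < e -> exists N, forall i j, (N <= i)%N -> (N <= j)%N -> `|u i - u j| <= e) ->
  exists l, forall (e : R) N, (forall i j, (N <= i)%N -> (N <= j)%N -> `|u i - u j| <= e) ->
    forall i, (N <= i)%N -> `|u i - l| <= e.
Proof.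
move=> cu; have : cvg (u @ \oo).
  apply: cauchy_cvg; apply: cauchy_exP => e e0.
  have e2 : 0 < e / 2 by rewrite divr_gt0.
  have [N hN] := cu _ e2; exists (u N); exists N => // n Nn /=.
  by apply: le_lt_trans (hN _ _ (leqnn N) Nn) _; rewrite ltr_pdivrMr // ltr_pMr // ltr1n.
move=> /cvg_ex[l /cvgrPdist_lt cl]; exists l => e N hN i Ni.
apply/ler_addgt0Pl => d d0; have [n _ hn] := cl _ d0.
have h1 := hn (maxn n N) (leq_maxl _ _); have h2 := hN i (maxn n N) Ni (leq_maxr _ _).
rewrite -(subrK (u (maxn n N)) (u i)) -addrA; apply: le_trans (ler_normD _ _) _.
by rewrite [leRHS]addrC lerD // ltW // distrC.
Qed.

Lemma complex_cauchy (u : nat -> C) :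
  (forall e : R, 0 < e -> exists N, forall i j, (N <= i)%N -> (N <= j)%N -> nc (u i - u j) <= e) ->
  exists l, forall (e : R) N, (forall i j, (N <= i)%N -> (N <= j)%N -> nc (u i - u j) <= e) ->
    forall i, (N <= i)%N -> nc (u i - l) <= 2 * e.
Proof.
move=> cu.
have [|l1 h1] := @real_cauchy (fun n => Re (u n)).
  move=> e /cu[N hN]; exists N => i j Ni Nj; rewrite -ReB.
  exact: le_trans (ler_Re_nc _) (hN i j Ni Nj).
have [|l2 h2] := @real_cauchy (fun n => Im (u n)).
  move=> e /cu[N hN]; exists N => i j Ni Nj; rewrite -ImB.
  exact: le_trans (ler_Im_nc _) (hN i j Ni Nj).
exists (Complex l1 l2) => e N hN i Ni.
apply: le_trans (nc_le_ReIm _) _; rewrite ReB ImB mulr_natl mulr2n lerD //.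
  by apply: h1 Ni => a b Na Nb; rewrite -ReB; exact: le_trans (ler_Re_nc _) (hN a b Na Nb).
by apply: h2 Ni => a b Na Nb; rewrite -ImB; exact: le_trans (ler_Im_nc _) (hN a b Na Nb).
Qed.

Lemma unif_continuous (T : set C) (h : C -> C) : compact T ->
  (forall z, T z -> {for z, continuous h}) ->
  forall e : R, 0 < e -> exists2 d : R, 0 < d &
    forall x y, T x -> T y -> nc (x - y) < d -> nc (h x - h y) <= e.
Proof.
move=> cT ch e e0; apply: contrapT => nd.
have bad (n : nat) : exists xy : C * C, [/\ T xy.1, T xy.2, nc (xy.1 - xy.2) < n.+1%:R^-1 & e < nc (h xy.1 - h xy.2)].
  apply: contrapT => nb; apply: nd; exists (n.+1%:R^-1) => [|x y Tx Ty xy]; first by rewrite invr_gt0 ltr0Sn.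
  by rewrite leNgt; apply/negP => he; apply: nb; exists (x, y).
have {bad}[s hs] := choice bad.
have [M M0 hM] := compact_nc_bounded cT.
have [|phi [hphi [l cl]]] := @complex_bw (fun n => (s n).1) M.
  by move=> n; apply/ltW/hM; have [] := hs n.
have Tl : T l.
  apply: (compact_closed (@hausdorff_C R) cT) => B /nbhs_normcP[r r0 rB].
  have [N hN] := cl _ r0; exists (s (phi N)).1; split; first by have [] := hs (phi N).
  exact: rB (hN N (leqnn N)).
have e2 : 0 < e / 2 by rewrite divr_gt0.
have [r r0 hr] := (continuous_ncP h l).1 (ch l Tl) _ e2.
have r2 : 0 < r / 2 by rewrite divr_gt0.
have [N1 hN1] := cl _ r2.
have [N2 hN2] : exists N, N.+1%:R^-1 < r / 2.
  have [k hk] := ltr_add_invr r2; exists k; move: hk; rewrite add0r //.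
pose n := maxn N1 N2.
have [Tx Ty xy hxy] := hs (phi n).
have h1 : nc ((s (phi n)).1 - l) < r / 2 by apply: hN1; exact: leq_maxl.
have h2 : nc ((s (phi n)).1 - (s (phi n)).2) < r / 2.
  apply: lt_trans xy _; apply: le_lt_trans hN2; rewrite lef_pV2 ?posrE ?ltr0Sn // ler_nat ltnS.
  by apply: leq_trans (subseq_ge hphi n); exact: leq_maxr.
have k1 := hr (s (phi n)).1; have k2 := hr (s (phi n)).2.
have h3 := nc_tri (s (phi n)).2 (s (phi n)).1 l.
rewrite [X in _ <= X + _]ncC in h3.
have h4 := nc_tri (h (s (phi n)).1) (h l) (h (s (phi n)).2).
rewrite [X in _ <= _ + X]ncC in h4.
have {}k1 := k1 ltac:(lra); have {}k2 := k2 ltac:(lra).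
lra.
Qed.

End UniformConvergence.

(** * Iterates, normality and rotations *)

Section Dynamics.
Context {R : realType}.
Local Notation C := R[i].
Local Notation nc := (@ComplexField.Normc.normc R).
Local Notation S := (sphere R).
Local Notation infty := (@infty R).

Section Iterates.
Variable f : C -> S.
Hypothesis mf : meromorphic f.

Definition orbit (n : nat) : C -> C := finite_part (fun z => iterate f n (fin z)).

Lemma iterateD m n (s : S) : iterate f (m + n) s = iterate f m (iterate f n s).
Proof. exact: iterD. Qed.

Lemma iterate_infty n : iterate f n infty = infty.
Proof. by elim: n => //= n ->. Qed.

Lemma iterate_finite_le m n (s : S) : (m <= n)%N -> iterate f n s <> infty -> iterate f m s <> infty.
Proof. by move=> mn h e; apply: h; rewrite -(subnK mn) iterateD e iterate_infty. Qed.

Lemma orbitE n z : iterate f n (fin z) <> infty -> iterate f n (fin z) = fin (orbit n z).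
Proof. exact: finite_partE. Qed.

Lemma iterate_holomorphic n z : iterate f n (fin z) <> infty ->
  holomorphic_at (fun w => iterate f n (fin w)) z.
Proof.
elim: n => [_|n ih h]; first by near=> w; split=> //; exact: derivable_id.
have hn : iterate f n (fin z) <> infty by exact: iterate_finite_le h.
apply: (holomorphic_comp (ih hn)); apply: mf.1 => pz; apply: h.
by rewrite -[n.+1]addn0 -[RHS]pz addn0 -[iterate f n.+1 _]/(obind f (iterate f n (fin z))) orbitE.
Unshelve. all: by end_near. Qed.

Lemma orbit_cdiff n z : iterate f n (fin z) <> infty -> cdiff (orbit n) z.
Proof. by move=> /iterate_holomorphic/nbhs_singleton[_ d]; exact: CDiff. Qed.

Lemma orbit_continuous n z : iterate f n (fin z) <> infty -> {for z, continuous (orbit n)}.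
Proof. by move=> /orbit_cdiff/cdiff_continuous. Qed.

(** Finiteness is asked one step earlier than continuity: the last application of [f] may land on
    infinity, since [f] is continuous into the sphere at its poles. *)
Lemma iterate_continuous n z : iterate f n (fin z) <> infty ->
  {for z, continuous (fun w => iterate f n.+1 (fin w))}.
Proof.
move=> h A; have hE : iterate f n.+1 (fin z) = f (orbit n z).
  by rewrite -[iterate f n.+1 _]/(obind f (iterate f n (fin z))) orbitE.
rewrite hE => hA.
have hA' : nbhs (orbit n z) (f @^-1` A) := meromorphic_continuous mf hA.
have h2 := nbhs_preimage_cdiff (orbit_cdiff h) hA'.
have h3 := near_finite (holomorphic_continuous (iterate_holomorphic h)) h.
apply: (filterS _ (filterI h2 h3)) => w [/= Aw fw].
suff : A (iterate f n.+1 (fin w)) by [].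
by rewrite -[iterate f n.+1 _]/(obind f (iterate f n (fin w))) orbitE.
Qed.

Lemma chordal_le (a b : C) : chordal (fin a) (fin b) <= 2 * nc (a - b).
Proof.
have h (c : C) : 1 <= Num.sqrt (1 + nc c ^+ 2).
  by rewrite -[leLHS]sqrtr1 ler_sqrt ?lerDl ?sqr_ge0 // addr_ge0 ?sqr_ge0.
have p : 1 <= Num.sqrt (1 + nc a ^+ 2) * Num.sqrt (1 + nc b ^+ 2) by rewrite -[leLHS]mulr1 ler_pM.
have n0 : 0 <= 2 * nc (a - b) by rewrite mulr_ge0 ?nc_ge0.
by rewrite /chordal /fin ler_pdivrMr ?(lt_le_trans ltr01 p) // ler_peMr.
Qed.

(** A difference of two iterates is holomorphic on [G], so the maximum principle extends a uniform
    Cauchy estimate from [Gam] to all of [G]. The limit is then uniform, and chordal distance is at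
    most twice Euclidean distance. *)
Lemma normality (G Gam : set C) : open G -> compact (G `|` Gam) ->
  (forall n z, (G `|` Gam) z -> iterate f n (fin z) <> infty) ->
  (forall m : nat -> nat, exists phi : nat -> nat, {homo phi : i j / (i < j)%N} /\
    forall e : R, 0 < e -> exists N, forall i j, (N <= i)%N -> (N <= j)%N ->
      forall z, Gam z -> nc (orbit (m (phi i)) z - orbit (m (phi j)) z) <= e) ->
  fin @` G `<=` fatou_set f.
Proof.
move=> oG cK hfin TB _ [z0 Gz0 <-]; exists (fin @` G); split.
- exact: open_fin.
- by exists z0.
- by move=> n _ [w Gw <-] k _; apply: hfin; left.
move=> s hs.
have hs' n : exists k, iterate f k = s n by have [k _ <-] := hs n; exists k.
have {hs hs'}[m hm] := choice hs'.
have [phi [hphi unif]] := TB m.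
pose u n := orbit (m (phi n)).
have {}unif (e : R) : 0 < e -> exists N, forall i j, (N <= i)%N -> (N <= j)%N ->
      forall z, (G `|` Gam) z -> nc (u i z - u j z) <= e.
  move=> e0; have [N hN] := unif _ e0; exists N => i j Ni Nj.
  apply: (@max_principle R G Gam (fun z => u i z - u j z) e oG cK).
  - move=> z Kz; apply: cdiff_continuous.
    exact: (cdiffB (orbit_cdiff (hfin _ _ Kz)) (orbit_cdiff (hfin _ _ Kz))).
  - move=> z Gz _; have Kz : (G `|` Gam) z by left.
    exact: (cdiffB (orbit_cdiff (hfin _ _ Kz)) (orbit_cdiff (hfin _ _ Kz))).
  - exact: ltW.
  - exact: hN.
have lim z : exists l, (G `|` Gam) z -> forall (e : R) N, (forall i j, (N <= i)%N -> (N <= j)%N -> nc (u i z - u j z) <= e) ->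
    forall i, (N <= i)%N -> nc (u i z - l) <= 2 * e.
  have [Kz|nK] := pselect ((G `|` Gam) z); last by exists 0.
  have [|l hl] := @complex_cauchy R (u^~ z); last by exists l.
  by move=> e /unif[N hN]; exists N => i j Ni Nj; exact: hN.
have {lim}[l hl] := choice lim.
exists phi, (fun s => if s is Some z then fin (l z) else infty); split => // K' cK' K'G e e0.
(* One factor 2 comes from [complex_cauchy] and another from [chordal_le], so the final bound is
   [e / 2]. *)
have e8 : 0 < e / 8 by rewrite divr_gt0.
have [N hN] := unif _ e8; exists N => // n Nn s' /K'G[z Gz <-].
have Kz : (G `|` Gam) z by left.
rewrite -hm orbitE; last exact: hfin.
have := hl z Kz (e / 8) N (fun i j Ni Nj => hN i j Ni Nj z Kz) n Nn.
have := chordal_le (u n z) (l z); rewrite /u /fin /=; lra.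
Qed.

Lemma natr_dist_lt1 (a b : nat) : `|a%:R - b%:R : R| < 1 -> a = b.
Proof.
rewrite ltr_distl => /andP[h1 h2]; case: (ltngtP a b) => // h.
  have {h} : a.+1%:R <= b%:R :> R by rewrite ler_nat.
  by rewrite -natr1 => h; exfalso; lra.
have {h} : b.+1%:R <= a%:R :> R by rewrite ler_nat.
by rewrite -natr1 => h; exfalso; lra.
Qed.

Section Rotation.
Variables (p : nat) (rho : C) (psi : C -> C) (T : set C).
Hypotheses (p0 : (0 < p)%N) (rho1 : nc rho = 1) (cT : compact T).
Hypothesis rhoT : forall z, T z -> T (rho * z).
Hypothesis cpsi : forall z, T z -> {for z, continuous psi}.
Hypothesis conj : forall z, T z -> iterate f p (fin (psi z)) = fin (psi (rho * z)).
Hypothesis psifin : forall n z, T z -> iterate f n (fin (psi z)) <> infty.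

Lemma rotation_iterate q z : T z -> T (rho ^+ q * z) /\
  iterate f (q * p) (fin (psi z)) = fin (psi (rho ^+ q * z)).
Proof.
move=> Tz; elim: q => [|q [ih1 ih2]]; first by rewrite expr0 mul1r.
rewrite exprS -mulrA; split; first exact: rhoT.
by rewrite mulSn iterateD ih2 conj.
Qed.

Lemma rotation_orbit q k z : T z -> orbit (k + q * p) (psi z) = orbit k (psi (rho ^+ q * z)).
Proof.
by move=> Tz; rewrite /orbit /finite_part iterateD; have [_ ->] := rotation_iterate q Tz.
Qed.

(* The bounded sequence (1 + r_n) rho^(q_n), where m_n = q_n p + r_n, has a convergent
   subsequence, along which r_n is eventually constant and rho^(q_n) converges. *)
Lemma rotation_totally_bounded (m : nat -> nat) : exists phi : nat -> nat,
  {homo phi : i j / (i < j)%N} /\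
  forall (k : nat) (e : R), 0 < e -> exists N, forall i j, (N <= i)%N -> (N <= j)%N ->
    forall z, T z -> nc (orbit (m (phi i) + k) (psi z) - orbit (m (phi j) + k) (psi z)) <= e.
Proof.
pose q n := (m n %/ p)%N; pose r n := (m n %% p)%N.
have nq n : nc (rho ^+ n) = 1 by rewrite ncX rho1 expr1n.
(* The modulus [r n + 1] records the residue, so terms at distance below 1 have the same one; being
   at least 1, it also lets the distance of two such terms bound that of the powers of [rho]. *)
pose y n : C := rho ^+ q n * ((r n).+1%:R%:C)%C.
have ny n : nc (y n) = (r n).+1%:R by rewrite ncM nq mul1r ncR ger0_norm.
have [|phi [hphi [l cl]]] := @complex_bw R y p%:R.
  by move=> n; rewrite ny ler_nat ltn_mod.
exists phi; split => // k e e0.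
have cauchy (d : R) : 0 < d -> exists N, forall i j, (N <= i)%N -> (N <= j)%N -> nc (y (phi i) - y (phi j)) < d.
  move=> d0; have d2 : 0 < d / 2 by rewrite divr_gt0.
  have [N hN] := cl _ d2; exists N => i j Ni Nj.
  have := nc_tri (y (phi i)) l (y (phi j)); rewrite [X in _ <= _ + X]ncC.
  by have := hN i Ni; have := hN j Nj; lra.
have [N1 hN1] := cauchy 1 ltr01.
have rc i : (N1 <= i)%N -> r (phi i) = r (phi N1).
  move=> Ni; have := ler_dist_nc (y (phi i)) (y (phi N1)).
  move/le_lt_trans => /(_ _ (hN1 i N1 Ni (leqnn _))); rewrite !ny.
  by rewrite -!natr1 opprD addrACA subrr addr0; exact: natr_dist_lt1.
pose r0 := r (phi N1).
have hc z : T z -> {for z, continuous (fun z => orbit (r0 + k) (psi z))}.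
  move=> Tz; apply: (@continuous_comp _ _ _ psi (orbit (r0 + k))); first exact: cpsi.
  by apply: orbit_continuous; exact: psifin.
have [d d0 hd] := unif_continuous cT hc e0.
have [B B0 hB] := compact_nc_bounded cT.
have dB : 0 < d / B by rewrite divr_gt0.
have [N2 hN2] := cauchy _ dB.
exists (maxn N1 N2) => i j; rewrite !geq_max => /andP[i1 i2] /andP[j1 j2] z Tz.
have mE n : (N1 <= n)%N -> (m (phi n) + k = (r0 + k) + q (phi n) * p)%N.
  by move=> Nn; rewrite {1}(divn_eq (m (phi n)) p) -/(q (phi n)) -/(r (phi n)) rc // -/r0; lia.
rewrite !mE // !rotation_orbit //.
apply: hd; [exact: (rotation_iterate _ Tz).1|exact: (rotation_iterate _ Tz).1|].
rewrite -mulrBl ncM; have := hN2 i j i2 j2.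
rewrite /y !rc // -/r0 -mulrBl ncM ncR ger0_norm // => h.
have h2 : nc (rho ^+ q (phi i) - rho ^+ q (phi j)) < d / B.
  by apply: le_lt_trans h; rewrite ler_peMr ?nc_ge0 // ler1n.
apply: (@le_lt_trans _ _ (nc (rho ^+ q (phi i) - rho ^+ q (phi j)) * B)).
  by rewrite ler_wpM2l ?nc_ge0 // ltW // hB.
by rewrite -ltr_pdivlMr.
Qed.
End Rotation.
End Iterates.

End Dynamics.

(** * The two sides of a Herman ring *)

Section Coronas.
Context {R : realType}.
Local Notation C := R[i].
Local Notation nc := (@ComplexField.Normc.normc R).
Local Notation S := (sphere R).

Definition corona (a b : R) : set C := [set z | a < nc z < b].

Lemma connected_corona a b : 0 <= a -> connected (corona a b).
Proof.
move=> a0; apply: (@connected_radial R [set x | a < x < b]) => [x y /= /andP[ax xb] /andP[ay yb] z /andP[xz zy]|x /= /andP[ax _]].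
  by rewrite (lt_le_trans ax) //= (le_lt_trans zy).
exact: le_lt_trans ax.
Qed.

Lemma open_corona a b : open (corona a b).
Proof.
have -> : corona a b = ~` [set z | nc z <= a] `&` [set z | nc z < b].
  apply/seteqP; split=> z /=; first by move=> /andP[az zb]; split=> //; apply/negP; rewrite -ltNge.
  by move=> [/negP]; rewrite -ltNge /corona /= => -> ->.
apply: openI; last by apply: open_preimage_lt; exact: continuous_nc.
by apply: closed_openC; apply: closed_preimage_le; exact: continuous_nc.
Qed.

Definition closed_corona (a b : R) : set C := [set z | a <= nc z <= b].

Lemma compact_closed_corona a b : compact (closed_corona a b).
Proof.
apply: (@compact_closed_bounded R _ b); last by move=> z /andP[].
have -> : closed_corona a b = ~` [set z | nc z < a] `&` [set z | nc z <= b].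
  apply/seteqP; split=> z /=; first by move=> /andP[az zb]; split=> //; apply/negP; rewrite -leNgt.
  by move=> [/negP]; rewrite -leNgt /closed_corona /= => -> ->.
apply: closedI; last by apply: closed_preimage_le; exact: continuous_nc.
by apply: open_closedC; apply: open_preimage_lt; exact: continuous_nc.
Qed.

Lemma compact_increasing (K : set S) (V : nat -> set S) : compact K ->
  (forall n, open (V n)) -> (forall m n, (m <= n)%N -> V m `<=` V n) ->
  (forall s, K s -> exists n, V n s) -> exists n, K `<=` V n.
Proof.
move=> /compact_near_coveringP cK oV iV KV.
have [|N _ hN] := cK nat \oo (fun n s => V n s) _; last by exists N; exact: (hN N (leqnn N)).
move=> s /KV[n Vns]; exists (V n, [set m | (n <= m)%N]) => /=.
  by split; [exact: open_nbhs_nbhs|exists n].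
by move=> [s' m] /= [h1 h2]; exact: (iV n m).
Qed.

Lemma separate_closed (A B : set S) : closed A -> closed B -> A `&` B = set0 ->
  exists UA UB : set S, [/\ open UA, open UB, A `<=` UA, B `<=` UB & UA `&` UB = set0].
Proof.
move=> cA cB AB.
have [|i Ai clB] := compact_normal (@sphere_hausdorff R) (@sphere_compact R) cA (t := ~` B).
  move=> s As; apply: open_nbhs_nbhs; split; first exact: closed_openC.
  by move=> Bs; have : (A `&` B) s by []; rewrite AB.
exists (interior i), (~` closure i); split.
- exact: open_interior.
- by apply: closed_openC; exact: closed_closure.
- by move=> s As; exact: Ai.
- by move=> s Bs cs; exact: (clB s cs Bs).
- by rewrite -subset0 => s [h1 h2]; apply: h2; apply: subset_closure; exact: interior_subset h1.
Qed.

(** A relatively clopen subset contains or avoids each of [X] and [Y]. If it separated them, [Y]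
    would be relatively open in the open union, hence open. This serves for a component of the
    complement of the ring and a half of the ring, which are disjoint. *)
Lemma connected_glue (T : topologicalType) (X Y : set T) : connected X -> connected Y ->
  open (Y `|` X) -> ~ open Y -> connected (Y `|` X).
Proof.
move=> cX cY oD nY P [x0 Px0] [W oW PO] [F cF PF].
have side (Z : set T) : connected Z -> Z `<=` Y `|` X -> Z `<=` P \/ Z `&` P = set0.
  move=> cZ ZD; have [->|ZP] := eqVneq (Z `&` P) set0; [by right|left].
  have E : Z `&` P = Z.
    apply: cZ; first exact/set0P.
      by exists W => //; rewrite PO setIA (setIidl ZD).
    by exists F => //; rewrite PF setIA (setIidl ZD).
  by rewrite -E => z [].
have [XP|XP] := side X cX (@subsetUr _ _ _); have [YP|YP] := side Y cY (@subsetUl _ _ _).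
- by apply/seteqP; split=> [z|z [/YP|/XP]//]; rewrite PO => -[].
- case: nY; have -> : Y = (Y `|` X) `&` ~` F; last by apply: openI => //; exact: closed_openC.
  apply/seteqP; split=> z.
    move=> Yz; split; [by left|move=> Fz; have : (Y `&` P) z by split=> //; rewrite PF; split=> //; left].
    by rewrite YP.
  by move=> [[//|/XP]]; rewrite PF => -[].
- case: nY; have -> : Y = (Y `|` X) `&` W; last exact: openI.
  apply/seteqP; split=> z; first by move=> /YP; rewrite PO.
  move=> [[//|Xz] Oz]; have : (X `&` P) z by split=> //; rewrite PO; split=> //; right.
  by rewrite XP.
- have : (Y `|` X) x0 by move: Px0; rewrite PO => -[].
  by case=> h; [have : (Y `&` P) x0 by []; rewrite YP|have : (X `&` P) x0 by []; rewrite XP].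
Qed.

(** Any [rho] of modulus 1 and any [H] are allowed: inversion of the annulus replaces [rho] by its
    inverse, and in period two the image f(H) receives a chart as well. *)
Definition rotation_chart (g : S -> S) (H : set S) (r : R) (rho : C) (psi : C -> C) :=
  [/\ 1 < r, nc rho = 1, (forall z, annulus r z -> cdiff psi z),
      set_bij (annulus r) H (fin \o psi) &
      forall z, annulus r z -> g (fin (psi z)) = fin (psi (rho * z))].

Lemma annulus_neq0 (r : R) z : annulus r z -> z != 0.
Proof. by move=> /andP[z1 _]; rewrite -nc_gt0 (lt_trans ltr01). Qed.

Lemma annulus_inv (r : R) z : 0 < r -> annulus r z -> annulus r ((r%:C)%C / z).
Proof.
move=> r0 az; have z0 := annulus_neq0 az; have /andP[z1 zr] := az.
have nz : 0 < nc z by rewrite nc_gt0.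
rewrite /annulus /= ncM ncV ncR gtr0_norm //.
by rewrite ltr_pdivlMr // mul1r zr ltr_pdivrMr // ltr_pMr.
Qed.

(** The map [z -> r / z] exchanges the two ends of the annulus and conjugates a rotation to its
    inverse; it serves to prescribe which end runs into which component. *)
Lemma rotation_chart_inv g H (r : R) rho psi : rotation_chart g H r rho psi ->
  rotation_chart g H r rho^-1 (fun z => psi ((r%:C)%C / z)).
Proof.
move=> [r1 rho1 dpsi [h1 h2 h3] cj]; have r0 : 0 < r by exact: lt_trans r1.
have rn : (r%:C)%C != 0 :> C by rewrite -nc_gt0 ncR gtr0_norm.
have inv2 (z : C) : (r%:C)%C / ((r%:C)%C / z) = z by rewrite invf_div mulrCA divff // mulr1.
split => //; first by rewrite ncV rho1 invr1.
- move=> z az; have z0 := annulus_neq0 az.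
  apply: (@cdiff_comp R psi (fun z => (r%:C)%C / z)).
    by apply: dpsi; exact: annulus_inv.
  exact: (cdiffM (cdiff_cst _ z) (cdiffV (z0 : (fun x : C => x) z != 0) (cdiff_id z))).
- split.
  + by move=> z az; apply: h1; exact: annulus_inv.
  + move=> x y; rewrite !inE => ax ay /= e.
    have := h2 ((r%:C)%C / x) ((r%:C)%C / y); rewrite !inE => /(_ (annulus_inv r0 ax) (annulus_inv r0 ay) e).
    by move=> /(congr1 (fun u => (r%:C)%C / u)); rewrite !inv2.
  + by move=> s /h3[z az <-]; exists ((r%:C)%C / z); [exact: annulus_inv|rewrite /= inv2].
- move=> z az; rewrite cj; last exact: annulus_inv.
  by rewrite invfM invrK mulrCA.
Qed.

End Coronas.

(** * Images of coronas under a chart *)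

Section Charts.
Context {R : realType}.
Local Notation C := R[i].
Local Notation nc := (@ComplexField.Normc.normc R).
Local Notation S := (sphere R).

Definition ring_image (psi : C -> C) (a b : R) : set S := (fin \o psi) @` corona a b.
Definition closed_ring_image (psi : C -> C) (a b : R) : set S := (fin \o psi) @` closed_corona a b.

Section Chart.
Variables (g : S -> S) (H : set S) (r : R) (rho : C) (psi : C -> C).
Hypothesis chart : rotation_chart g H r rho psi.

Lemma chart_inj x y : annulus r x -> annulus r y -> fin (psi x) = fin (psi y) -> x = y.
Proof. by have [_ _ _ [_ h _] _] := chart => ax ay; apply: h; rewrite inE. Qed.

Lemma chart_continuous z : annulus r z -> {for z, continuous (fin \o psi)}.
Proof.
have [_ _ d _ _] := chart => az A hA.
exact: (nbhs_preimage_cdiff (d z az) (hA : nbhs (psi z) (fin @^-1` A))).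
Qed.

Lemma corona_annulus a b : 1 <= a -> b <= r -> corona a b `<=` annulus r.
Proof. by move=> a1 br z /andP[az zb]; rewrite /annulus /= (le_lt_trans a1) //= (lt_le_trans zb). Qed.

Lemma closed_corona_annulus a b : 1 < a -> b < r -> closed_corona a b `<=` annulus r.
Proof. by move=> a1 br z /andP[az zb]; rewrite /annulus /= (lt_le_trans a1) //= (le_lt_trans zb). Qed.

Lemma ring_image_open a b : 1 <= a -> b <= r -> open (ring_image psi a b).
Proof.
move=> a1 br; have sub := corona_annulus a1 br; rewrite /ring_image -image_comp; apply: open_fin.
apply: open_image_inj; first exact: open_corona.
  by move=> z /sub az; have [_ _ d _ _] := chart; exact: d.
by move=> x y; rewrite !inE => /sub ax /sub ay e; apply: chart_inj => //; rewrite e.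
Qed.

Lemma ring_image_connected a b : 1 <= a -> b <= r -> connected (ring_image psi a b).
Proof.
move=> a1 br; apply: connected_image; first by apply: connected_corona; exact: le_trans a1.
by move=> x /(corona_annulus a1 br); exact: chart_continuous.
Qed.

Lemma closed_ring_image_compact a b : 1 < a -> b < r -> compact (closed_ring_image psi a b).
Proof.
move=> a1 br; apply: compact_image; first exact: compact_closed_corona.
by move=> x /(closed_corona_annulus a1 br); exact: chart_continuous.
Qed.

Lemma closed_ring_image_closed a b : 1 < a -> b < r -> closed (closed_ring_image psi a b).
Proof. by move=> a1 br; apply: closed_sphere; exact: closed_ring_image_compact. Qed.

Lemma chart_range : H = ring_image psi 1 r.
Proof.
have [_ _ _ [h1 _ h3] _] := chart; apply/seteqP; split=> [s /h3[z az <-]|_ [z az <-]].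
  by exists z.
exact: h1.
Qed.

Lemma chart_surj s : H s -> exists2 z, annulus r z & fin (psi z) = s.
Proof. by have [_ _ _ [_ _ h3] _] := chart => /h3[z az <-]; exists z. Qed.

Lemma chart_in z : annulus r z -> H (fin (psi z)).
Proof. by have [_ _ _ [h1 _ _] _] := chart; exact: h1. Qed.

Lemma chart_open : open H.
Proof. by rewrite chart_range; exact: ring_image_open. Qed.

(* The end |z| -> 1 of the annulus runs into B and the end |z| -> r into A. *)
Definition separated_ends (A B : set S) := exists (UA UB : set S) (e : R),
  [/\ open UA /\ open UB, A `<=` UA /\ B `<=` UB, UA `&` UB = set0, 0 < e &
      ring_image psi 1 (1 + e) `<=` UB /\ ring_image psi (r - e) r `<=` UA].

End Chart.

Section Sides.
Variables (g : S -> S) (H A B : set S) (r : R).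
Hypotheses (cA : closed A) (cB : closed B) (conA : connected A) (conB : connected B).
Hypotheses (A0 : A !=set0) (B0 : B !=set0) (AB : A `&` B = set0) (HAB : ~` H = A `|` B).

Lemma side_not_openB : ~ open B.
Proof.
move=> oB; have E := sphere_clopen oB cB B0; have [a Aa] := A0.
by have : (A `&` B) a; [split => //; rewrite E|rewrite AB].
Qed.

Lemma side_not_openA : ~ open A.
Proof.
move=> oA; have E := sphere_clopen oA cA A0; have [a Ba] := B0.
by have : (A `&` B) a; [split => //; rewrite E|rewrite AB].
Qed.

Lemma side_cover s : A s \/ B s \/ H s.
Proof.
have [Hs|nH] := pselect (H s); first by right; right.
by have : (~` H) s by []; rewrite HAB => -[|]; [left|right; left].
Qed.

Lemma sideA_notH s : A s -> ~ H s.
Proof. by move=> As; have : (~` H) s by rewrite HAB; left. Qed.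

Lemma sideB_notH s : B s -> ~ H s.
Proof. by move=> Bs; have : (~` H) s by rewrite HAB; right. Qed.

(** Disjoint neighbourhoods [UA] and [UB] of the two components leave out only a compact part of
    [H], so each end of the annulus lies in their union, and in one of them by connectedness. Both
    ends cannot lie in the same one, since the other component would be open; the wrong order is
    repaired by inversion. *)
Lemma chart_separated_ends rho psi : rotation_chart g H r rho psi ->
  exists rho' psi', rotation_chart g H r rho' psi' /\ separated_ends r psi' A B.
Proof.
move=> chart; have [r1 _ _ _ _] := chart; have r0 : 0 < r by exact: lt_trans r1.
have [UA [UB [oUA oUB AUA BUB UAB]]] := separate_closed cA cB AB.
have disj s : UA s -> UB s -> False by move=> ? ?; have : (UA `&` UB) s by []; rewrite UAB.
pose K := ~` (UA `|` UB).
have cK : compact K by apply: compact_sphere; apply: open_closedC; exact: openU.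
pose d n : R := n.+1%:R^-1.
have d0 n : 0 < d n by rewrite invr_gt0 ltr0Sn.
have dd m n : (m <= n)%N -> d n <= d m by move=> mn; rewrite lef_pV2 ?posrE ?ltr0Sn // ler_nat ltnS.
have [n hn] : exists n, K `<=` ring_image psi (1 + d n) (r - d n).
  apply: compact_increasing => //.
  - by move=> n; apply: (ring_image_open chart); have := d0 n; lra.
  - move=> m n /dd mn _ [z /andP[z1 z2] <-]; exists z => //; apply/andP; split; lra.
  - move=> s Ks; have [As|[Bs|Hs]] := side_cover s; [by case: Ks; left; exact: AUA|by case: Ks; right; exact: BUB|].
    have [z /andP[z1 z2] <-] := chart_surj chart Hs.
    have [k1 hk1] := ltr_add_invr z1; have [k2 hk2] := ltr_add_invr z2.
    exists (maxn k1 k2); exists z => //; apply/andP; split.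
      by apply: le_lt_trans hk1; rewrite lerD2l; apply: dd; exact: leq_maxl.
    rewrite ltrBrDr; apply: le_lt_trans hk2; rewrite lerD2l; apply: dd; exact: leq_maxr.
(* The second bound gives [1 + e <= r - e], so that both end rings stay inside the annulus. *)
pose e := Num.min (d n) ((r - 1) / 2).
have e0 : 0 < e by rewrite lt_min d0 divr_gt0 // subr_gt0.
have ed : e <= d n by rewrite ge_min lexx.
have er : e <= (r - 1) / 2 by rewrite ge_min lexx orbT.
have ends z : annulus r z -> nc z < 1 + e \/ r - e < nc z -> (UA `|` UB) (fin (psi z)).
  move=> az hz; apply: contrapT => nU; have [w hw ww] := hn _ nU.
  have /andP[w1 w2] := hw.
  have aw : annulus r w by apply: (corona_annulus _ _ hw); have := d0 n; lra.
  have wz := chart_inj chart aw az ww; subst w; case: hz; lra.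
have endin : ring_image psi 1 (1 + e) `<=` UA \/ ring_image psi 1 (1 + e) `<=` UB.
  have c : connected (ring_image psi 1 (1 + e)) by apply: (ring_image_connected chart); lra.
  have cov : ring_image psi 1 (1 + e) `<=` UA `|` UB.
    move=> _ [z hz <-]; have /andP[z1 z2] := hz; apply: ends; last by left.
    by apply: (corona_annulus _ _ hz); lra.
  have [ne|ne] := pselect (ring_image psi 1 (1 + e) `&` UA !=set0).
    by left; apply: (connected_sub_open c oUA oUB cov _ ne); rewrite UAB setI0.
  by right=> s hs; case: (cov s hs) => // Us; case: ne; exists s.
have endout : ring_image psi (r - e) r `<=` UA \/ ring_image psi (r - e) r `<=` UB.
  have c : connected (ring_image psi (r - e) r) by apply: (ring_image_connected chart); lra.
  have cov : ring_image psi (r - e) r `<=` UA `|` UB.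
    move=> _ [z hz <-]; have /andP[z1 z2] := hz; apply: ends; last by right.
    by apply: (corona_annulus _ _ hz); lra.
  have [ne|ne] := pselect (ring_image psi (r - e) r `&` UA !=set0).
    by left; apply: (connected_sub_open c oUA oUB cov _ ne); rewrite UAB setI0.
  by right=> s hs; case: (cov s hs) => // Us; case: ne; exists s.
have clK : closed (closed_ring_image psi (1 + e) (r - e)) by apply: (closed_ring_image_closed chart); lra.
have mid s : H s -> ~ closed_ring_image psi (1 + e) (r - e) s ->
    ring_image psi 1 (1 + e) s \/ ring_image psi (r - e) r s.
  move=> /(chart_surj chart)[z /andP[z1 z2] <-] nK; have [h|h] := ltP (nc z) (1 + e).
    by left; exists z => //; rewrite /corona /= z1.
  have [h'|h'] := leP (nc z) (r - e); last by right; exists z => //; rewrite /corona /= h'.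
  by case: nK; exists z => //; rewrite /closed_corona /= h.
case: endin endout => [inA|inB] [outA|outB].
(* Both ends lie in [UA]: removing the compact middle ring from [UB] leaves exactly [B]. *)
- case: side_not_openB; have -> : B = UB `&` ~` closed_ring_image psi (1 + e) (r - e).
    apply/seteqP; split=> s.
      move=> Bs; split; [exact: BUB|move=> [z hz zs]; apply: (sideB_notH Bs)].
      by rewrite -zs; apply: (chart_in chart); apply: (closed_corona_annulus _ _ hz); lra.
    move=> [Us ns]; have [As|[//|Hs]] := side_cover s; first by case: (disj s (AUA s As) Us).
    by case: (mid s Hs ns) => h; case: (disj s _ Us); [exact: inA|exact: outA].
  by apply: openI => //; exact: closed_openC.
- exists rho^-1, (fun z => psi ((r%:C)%C / z)); split; first exact: rotation_chart_inv.
  (* The width after inversion: [(r - e) * (1 + e / r) <= r] sends the new inner end into the old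
     outer one, and [(1 + e) * (r - e / r) >= r] sends the new outer end into the old inner one. *)
  have re : 0 < e / r by rewrite divr_gt0.
  exists UA, UB, (e / r); split => //; split.
    move=> _ [z /andP[z1 z2] <-]; apply: outB; exists ((r%:C)%C / z) => //.
    have z0 : 0 < nc z by exact: lt_trans z1.
    rewrite /corona /= ncM ncV ncR gtr0_norm //; apply/andP; split.
      rewrite ltr_pdivlMr //; apply: (@lt_le_trans _ _ ((r - e) * (1 + e / r))).
        by rewrite ltr_pM2l //; lra.
      have -> : (r - e) * (1 + e / r) = r - e ^+ 2 / r by field; rewrite gt_eqF.
      by rewrite lerBlDr lerDl divr_ge0 ?sqr_ge0 // ltW.
    by rewrite ltr_pdivrMr // ltr_pMr.
  move=> _ [z /andP[z1 z2] <-]; apply: inA; exists ((r%:C)%C / z) => //.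
  have er1 : e / r < 1 by rewrite ltr_pdivrMr // mul1r; lra.
  have z0 : 0 < nc z by lra.
  rewrite /corona /= ncM ncV ncR gtr0_norm //; apply/andP; split.
    by rewrite ltr_pdivlMr // mul1r.
  rewrite ltr_pdivrMr //; apply: (@le_lt_trans _ _ ((1 + e) * (r - e / r))); last first.
    by rewrite ltr_pM2l //; lra.
  have h1 : e / r <= e by rewrite ler_pdivrMr // ler_peMr //; lra.
  nra.
- by exists rho, psi; split => //; exists UA, UB, e; split.
- case: side_not_openA; have -> : A = UA `&` ~` closed_ring_image psi (1 + e) (r - e).
    apply/seteqP; split=> s.
      move=> As; split; [exact: AUA|move=> [z hz zs]; apply: (sideA_notH As)].
      by rewrite -zs; apply: (chart_in chart); apply: (closed_corona_annulus _ _ hz); lra.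
    move=> [Us ns]; have [//|[Bs|Hs]] := side_cover s; first by case: (disj s Us (BUB s Bs)).
    by case: (mid s Hs ns) => h; case: (disj s Us); [exact: inB|exact: outB].
  by apply: openI => //; exact: closed_openC.
Qed.

Section Good.
Variables (rho : C) (psi : C -> C).
Hypotheses (chart : rotation_chart g H r rho psi) (ends : separated_ends r psi A B).
Variable s : R.
Hypothesis sr : 1 < s < r.

(** Points of [UB] outside [B] and outside a compact middle ring lie in the inner end, because the
    outer end lies in [UA]. So [UB] minus that ring is an open neighbourhood of [B] inside the
    union. *)
Lemma inner_side_open : open (B `|` ring_image psi 1 s).
Proof.
have [UA [UB [e [[oUA oUB] [AUA BUB] UAB e0 [hin hout]]]]] := ends.
have disj x : UA x -> UB x -> False by move=> ? ?; have : (UA `&` UB) x by []; rewrite UAB.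
have /andP[s1 s2] := sr.
pose e' := Num.min e (s - 1).
have e'0 : 0 < e' by rewrite lt_min e0 subr_gt0.
have e's : e' <= s - 1 by rewrite ge_min lexx orbT.
have clK : closed (closed_ring_image psi (1 + e') (r - e)) by apply: (closed_ring_image_closed chart); lra.
have -> : B `|` ring_image psi 1 s = (UB `&` ~` closed_ring_image psi (1 + e') (r - e)) `|` ring_image psi 1 s.
  apply/seteqP; split=> x [hx|]; [|by right| |by right].
    left; split; [exact: BUB|move=> [z hz zx]; apply: (sideB_notH hx)].
    by rewrite -zx; apply: (chart_in chart); apply: (closed_corona_annulus _ _ hz); lra.
  case: hx => Ux nx; have [Ax|[Bx|Hx]] := side_cover x; [by case: (disj x (AUA x Ax) Ux)|by left|right].
  have [z /andP[z1 z2] zx] := chart_surj chart Hx; exists z => //; rewrite /corona /= z1 /=.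
  rewrite ltNge; apply/negP => sz; have [h|h] := leP (nc z) (r - e).
    by apply: nx; exists z => //; rewrite /closed_corona /= h andbT; lra.
  by apply: (disj x _ Ux); apply: hout; exists z => //; rewrite /corona /= h.
apply: openU; last by apply: (ring_image_open chart); lra.
by apply: openI => //; exact: closed_openC.
Qed.

Lemma outer_side_open : open (A `|` ring_image psi s r).
Proof.
have [UA [UB [e [[oUA oUB] [AUA BUB] UAB e0 [hin hout]]]]] := ends.
have disj x : UA x -> UB x -> False by move=> ? ?; have : (UA `&` UB) x by []; rewrite UAB.
have /andP[s1 s2] := sr.
pose e' := Num.min e (r - s).
have e'0 : 0 < e' by rewrite lt_min e0 subr_gt0.
have e's : e' <= r - s by rewrite ge_min lexx orbT.
have clK : closed (closed_ring_image psi (1 + e) (r - e')) by apply: (closed_ring_image_closed chart); lra.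
have -> : A `|` ring_image psi s r = (UA `&` ~` closed_ring_image psi (1 + e) (r - e')) `|` ring_image psi s r.
  apply/seteqP; split=> x [hx|]; [|by right| |by right].
    left; split; [exact: AUA|move=> [z hz zx]; apply: (sideA_notH hx)].
    by rewrite -zx; apply: (chart_in chart); apply: (closed_corona_annulus _ _ hz); lra.
  case: hx => Ux nx; have [Ax|[Bx|Hx]] := side_cover x; [by left|by case: (disj x Ux (BUB x Bx))|right].
  have [z /andP[z1 z2] zx] := chart_surj chart Hx; exists z => //; rewrite /corona /= z2 andbT.
  rewrite ltNge; apply/negP => sz; have [h|h] := leP (1 + e) (nc z).
    by apply: nx; exists z => //; rewrite /closed_corona /= h /=; lra.
  by apply: (disj x Ux); apply: hin; exists z => //; rewrite /corona /= h andbT.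
apply: openU; last by apply: (ring_image_open chart); lra.
by apply: openI => //; exact: closed_openC.
Qed.

Lemma inner_side_connected : connected (B `|` ring_image psi 1 s).
Proof.
have /andP[s1 s2] := sr; apply: connected_glue => //.
- by apply: (ring_image_connected chart); lra.
- exact: inner_side_open.
- exact: side_not_openB.
Qed.

Lemma outer_side_connected : connected (A `|` ring_image psi s r).
Proof.
have /andP[s1 s2] := sr; apply: connected_glue => //.
- by apply: (ring_image_connected chart); lra.
- exact: outer_side_open.
- exact: side_not_openA.
Qed.
End Good.
End Sides.

End Charts.

(** * The essential singularity *)

Section FatouSet.
Context {R : realType}.
Local Notation C := R[i].
Local Notation nc := (@ComplexField.Normc.normc R).
Local Notation S := (sphere R).
Local Notation infty := (@infty R).

Section Fatou.
Variable f : C -> S.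

Lemma fatou_finite s n : fatou_set f s -> iterate f n s <> infty.
Proof. by move=> [U [_ Us hU _]]; exact: (hU n.+1 s Us n (ltnSn n)). Qed.

Lemma fatou_open : open (fatou_set f).
Proof.
rewrite openE => s [U [oU Us hU nU]].
have : nbhs s U by exact: open_nbhs_nbhs.
by apply: filterS => w Uw; exists U.
Qed.

Lemma component_absorbs (F H V : set S) : components F H ->
  connected V -> V `<=` F -> V `&` H !=set0 -> V `<=` H.
Proof.
move=> [x Fx <-] cV VF [y [Vy Hy]]; rewrite (same_connected_component Hy).
exact: connected_component_max.
Qed.

(** A small disc about a point of the Fatou set is connected, so it lies in a single component and
    avoids [H] when its centre does. Infinity is not in the Fatou set, as [f] is undefined there. *)
Lemma fatou_diff_open H : fatou_component f H -> open (fatou_set f `\` H).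
Proof.
move=> cH; rewrite openE => -[z|] [Fz nH]; last by case: (fatou_finite (n := 0%N) Fz).
have : nbhs (fin z) (fatou_set f) by apply: open_nbhs_nbhs; split => //; exact: fatou_open.
move=> /nbhs_fin/nbhs_normcP[d d0 hd]; pose V := fin @` [set w | nc (w - z) < d].
have cV : connected V.
  by apply: connected_image; [exact: connected_disc|move=> x _; exact: continuous_fin].
have Vz : V (fin z) by exists z => //=; rewrite subrr nc0.
have VF : V `<=` fatou_set f by move=> _ [w hw <-]; exact: hd.
have : nbhs (fin z) V by apply: open_nbhs_nbhs; split => //; apply: open_fin; exact: open_disc.
apply: filterS => w Vw; split; first exact: VF.
move=> Hw; apply: nH; apply: (component_absorbs cH cV VF _ Vz); by exists w.
Qed.
End Fatou.

Lemma components_disjoint (F A B : set S) : components F A -> components F B ->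
  A <> B -> A `&` B = set0.
Proof.
move=> [x Fx <-] [y Fy <-] AB; rewrite -subset0 => z [xz yz]; apply: AB.
by rewrite (same_connected_component xz) (same_connected_component yz).
Qed.

(** * A curve in the ring and its two sides *)

Section Ring.
Variables (f : C -> S) (p : nat) (H A B : set S) (r : R) (rho : C) (psi : C -> C).
Hypotheses (mf : meromorphic f) (p0 : (0 < p)%N) (Hcomp : fatou_component f H).
Hypotheses (cA : closed A) (cB : closed B) (conA : connected A) (conB : connected B).
Hypotheses (Ai : A infty) (B0 : B !=set0) (AB : A `&` B = set0) (HAB : ~` H = A `|` B).
Hypothesis chart : rotation_chart (iterate f p) H r rho psi.
Hypothesis ends : separated_ends r psi A B.

Definition inner s := B `|` ring_image psi 1 s.
Definition outer s := A `|` ring_image psi s r.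
Definition curve s := closed_ring_image psi s s.

Lemma Hfatou : H `<=` fatou_set f.
Proof. by case: Hcomp => x Fx <-; exact: connected_component_sub. Qed.

Lemma A_neq0 : A !=set0. Proof. by exists infty. Qed.

Lemma curveP s x : curve s x <-> exists2 z, nc z = s & fin (psi z) = x.
Proof.
split=> [[z /andP[z1 z2] <-]|[z zs <-]]; last by exists z => //; rewrite /closed_corona /= zs lexx.
by exists z => //; apply/eqP; rewrite eq_le z1 z2.
Qed.

Section Radius.
Variable s : R.
Hypothesis sr : 1 < s < r.

Lemma curve_annulus z : nc z = s -> annulus r z.
Proof. by rewrite /annulus /= => ->. Qed.

Lemma curve_H : curve s `<=` H.
Proof. by move=> x /curveP[z /curve_annulus az <-]; exact: (chart_in chart). Qed.

Lemma inner_ring_H : ring_image psi 1 s `<=` H.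
Proof.
move=> _ [z hz <-]; apply: (chart_in chart); apply: (corona_annulus _ _ hz) => //.
by move: sr => /andP[? ?]; exact: ltW.
Qed.

Lemma outer_ring_H : ring_image psi s r `<=` H.
Proof.
move=> _ [z hz <-]; apply: (chart_in chart); apply: (corona_annulus _ _ hz) => //.
by move: sr => /andP[? ?]; exact: ltW.
Qed.

Lemma inner_open : open (inner s).
Proof. exact: inner_side_open chart ends s sr. Qed.
Lemma outer_open : open (outer s).
Proof. exact: outer_side_open chart ends s sr. Qed.
Lemma inner_connected : connected (inner s).
Proof. by have A0 := A_neq0; exact: inner_side_connected chart ends s sr. Qed.
Lemma outer_connected : connected (outer s).
Proof. by have A0 := A_neq0; exact: outer_side_connected chart ends s sr. Qed.

Lemma cover_sides x : inner s x \/ curve s x \/ outer s x.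
Proof.
have [Ax|[Bx|Hx]] := side_cover HAB x; [by right; right; left|by left; left|].
have [z /andP[z1 z2] zx] := chart_surj chart Hx.
have [h|h|h] := ltgtP (nc z) s.
- by left; right; exists z => //; rewrite /corona /= z1.
- by right; right; right; exists z => //; rewrite /corona /= h.
- by right; left; apply/curveP; exists z.
Qed.

Lemma inner_outer x : inner s x -> outer s x -> False.
Proof.
have /andP[s1 s2] := sr.
move=> [Bx|Ix] [Ax|Ox].
- by have : (A `&` B) x by []; rewrite AB.
- by apply: (sideB_notH HAB Bx); exact: outer_ring_H.
- by apply: (sideA_notH HAB Ax); exact: inner_ring_H.
- case: Ix Ox => z /andP[z1 z2] <- [w /andP[w1 w2] e].
  have := chart_inj chart (x := w) (y := z); rewrite /annulus /= => /(_ _ _ e) h.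
  have wz : w = z by apply: h; apply/andP; split; lra.
  by subst w; lra.
Qed.

Lemma inner_curve x : inner s x -> curve s x -> False.
Proof.
have /andP[s1 s2] := sr.
move=> [Bx|Ix] cx; first by apply: (sideB_notH HAB Bx); exact: curve_H.
case: Ix cx => z /andP[z1 z2] <- /curveP[w ws e].
have wz : w = z by apply: (chart_inj chart) e; rewrite /annulus /=; apply/andP; split; lra.
by subst w; lra.
Qed.

Lemma outer_curve x : outer s x -> curve s x -> False.
Proof.
have /andP[s1 s2] := sr.
move=> [Ax|Ix] cx; first by apply: (sideA_notH HAB Ax); exact: curve_H.
case: Ix cx => z /andP[z1 z2] <- /curveP[w ws e].
have wz : w = z by apply: (chart_inj chart) e; rewrite /annulus /=; apply/andP; split; lra.
by subst w; lra.
Qed.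

Lemma inner_curveE : inner s `|` curve s = ~` outer s.
Proof.
apply/seteqP; split=> x; first by case=> h o; [exact: (inner_outer h o)|exact: (outer_curve o h)].
by move=> nx; have [h|[h|h]] := cover_sides x; [left|right|].
Qed.

Lemma outer_curveE : outer s `|` curve s = ~` inner s.
Proof.
apply/seteqP; split=> x; first by case=> h o; [exact: (inner_outer o h)|exact: (inner_curve o h)].
by move=> nx; have [h|[h|h]] := cover_sides x; [|right|left].
Qed.

Lemma curve_preimage : fin @^-1` curve s = psi @` closed_corona s s.
Proof.
by apply/seteqP; split=> [x [z hz /fin_inj e]|_ [z hz <-]]; exists z.
Qed.

Lemma compact_curve : compact (psi @` closed_corona s s).
Proof.
have /andP[s1 s2] := sr.
rewrite -curve_preimage; apply: compact_preimage_fin.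
  exact: (closed_ring_image_closed chart).
by move=> /curveP[z _].
Qed.

Lemma rotation_curve x : curve s x -> curve s (iterate f p x).
Proof.
have [_ rho1 _ _ cj] := chart.
move=> /curveP[z zs <-]; rewrite cj; last exact: curve_annulus.
by apply/curveP; exists (rho * z) => //; rewrite ncM rho1 mul1r.
Qed.

Lemma rho_neq0 : rho != 0.
Proof. by have [_ rho1 _ _ _] := chart; rewrite -nc_gt0 rho1. Qed.

Lemma rotation_curve_surj x : curve s x -> exists2 y, curve s y & iterate f p y = x.
Proof.
have [_ rho1 _ _ cj] := chart.
move=> /curveP[z zs <-]; have zs' : nc (rho^-1 * z) = s by rewrite ncM ncV rho1 invr1 mul1r.
exists (fin (psi (rho^-1 * z))); first by apply/curveP; exists (rho^-1 * z).
by rewrite cj; [rewrite mulVKf // rho_neq0|exact: curve_annulus].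
Qed.

Lemma rotation_inner x : ring_image psi 1 s x -> ring_image psi 1 s (iterate f p x).
Proof.
have [_ rho1 _ _ cj] := chart; have /andP[s1 s2] := sr.
move=> [z hz <-]; rewrite /comp cj; last by apply: (corona_annulus _ _ hz) => //; exact: ltW.
by exists (rho * z) => //; rewrite /corona /= ncM rho1 mul1r.
Qed.

Lemma inner_ring_neq0 : ring_image psi 1 s !=set0.
Proof.
have /andP[s1 s2] := sr.
exists (fin (psi (((1 + s) / 2)%:C)%C)), ((((1 + s) / 2)%:C)%C) => //.
by rewrite /corona /= -[X in Num.sqrt X]/_ ; have := ncR ((1 + s) / 2); rewrite /= => ->; rewrite ger0_norm; lra.
Qed.

End Radius.

Lemma bounded_side_essential (v : S) : ~ range f v ->
  exists x : S, B x /\ essential_singularities f p x.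
Proof.
move=> nv; apply: contrapT => ness.
have [r1 rho1 dpsi _ cj] := chart.
pose s := (1 + r) / 2; have sr : 1 < s < r by rewrite /s; apply/andP; split; lra.
(* Without essential singularities in [B], f^(p-1) is finite there, so f^p is continuous into the
   sphere; only its last step may hit a pole. For [p = 1] the iterate in question is the
   identity. *)
have finB z : B (fin z) -> iterate f p.-1 (fin z) <> infty.
  move=> Bz e; case: (posnP p.-1) => [p1|p1]; first by move: e; rewrite p1.
  apply: ness; exists (fin z); split => //; right; exists z => //; exists p.-1.
  by rewrite p1 leqnn.
pose G := fin @^-1` inner s; pose Gam := psi @` closed_corona s s.
have KE : G `|` Gam = fin @^-1` (inner s `|` curve s) by rewrite preimage_setU curve_preimage.
have KE' : G `|` Gam = fin @^-1` (~` outer s) by rewrite KE inner_curveE.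
have oG : open G by apply: open_preimage_fin; exact: inner_open.
have cK : compact (G `|` Gam).
  rewrite KE'; apply: compact_preimage_fin; first by apply: open_closedC; exact: outer_open.
  by apply; left.
have cGam : compact Gam by exact: compact_curve.
have finK z : (G `|` Gam) z -> iterate f p.-1 (fin z) <> infty.
  rewrite KE => -[[Bz|Iz]|cz]; first exact: finB.
    by apply: fatou_finite; apply: Hfatou; exact: (inner_ring_H sr).
  by apply: fatou_finite; apply: Hfatou; exact: (curve_H sr).
pose F z := iterate f p (fin z).
have cF z : (G `|` Gam) z -> {for z, continuous F}.
  by move=> /finK h; rewrite /F -(prednK p0); exact: iterate_continuous.
have dF z : G z -> F z <> infty -> holomorphic_at F z by move=> _; exact: iterate_holomorphic.
have FGam : F @` Gam = curve s.
  apply/seteqP; split=> [_ [_ [z hz <-] <-]|x cx].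
    by apply: rotation_curve => //; exists z.
  have [y cy <-] := rotation_curve_surj sr cx.
  by have [z zs e] := (curveP s y).1 cy; exists (psi z); [exists z => //; rewrite /closed_corona /= zs lexx|rewrite /F e].
have absorb (T : set S) : connected T -> (forall x, T x -> curve s x -> False) ->
    (exists2 x, T x & (F @` (G `|` Gam)) x) -> T `<=` F @` (G `|` Gam).
  move=> cT Tc [x Tx Fx]; apply: (image_absorbs oG cK cGam cF dF cT) => //; last by exists x.
  by rewrite FGam -subset0 => y [Ty cy]; exact: (Tc y).
have [Fi|nFi] := pselect ((F @` (G `|` Gam)) infty).
  have oF : outer s `<=` F @` (G `|` Gam).
    by apply: absorb; [exact: outer_connected|move=> x; exact: outer_curve|exists infty => //; left].
  have iF : inner s `<=` F @` (G `|` Gam).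
    apply: absorb; [exact: inner_connected|move=> x; exact: inner_curve|].
    have [x Ix] := inner_ring_neq0 sr; exists (iterate f p x); first by right; exact: rotation_inner.
    have [z _ zx] := chart_surj chart (inner_ring_H sr Ix).
    by exists (psi z); [left; rewrite /G /= zx; right|rewrite /F zx].
  have : (F @` (G `|` Gam)) v.
    have [h|[h|h]] := cover_sides s v; [exact: iF|rewrite -FGam in h; case: h => z hz <-; exists z => //; right => //|exact: oF].
  move=> [z Kz Fz]; apply: nv; exists (orbit f p.-1 z) => //.
  rewrite -Fz /F -{2}(prednK p0) -[iterate f p.-1.+1 _]/(obind f (iterate f p.-1 (fin z))).
  by rewrite orbitE //; exact: finK.
(* A single value in the outer side would force the whole outer side to be covered, infinity
   included. *)
have FK z : (G `|` Gam) z -> F z <> infty /\ (G `|` Gam) (orbit f p z).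
  move=> Kz; have Fz : F z <> infty by move=> e; apply: nFi; exists z.
  split => //; rewrite KE' /= -orbitE // => oz; apply: nFi.
  apply: (absorb (outer s)); [exact: outer_connected|move=> x; exact: outer_curve| |by left].
  by exists (F z) => //; exists z.
have Fq q z : (G `|` Gam) z -> exists2 w, (G `|` Gam) w & iterate f (q * p) (fin z) = fin w.
  elim: q z => [|q ih] z Kz; first by exists z.
  have [Fz Kz'] := FK z Kz; have [w Kw e] := ih _ Kz'.
  by exists w => //; rewrite mulSn addnC iterateD -/(F z) /F orbitE.
(* After the full rounds of [p] steps the point is still in the compact set, where f^(p-1) is
   finite; fewer than [p] steps remain. *)
have fink n z : (G `|` Gam) z -> iterate f n (fin z) <> infty.
  move=> Kz; rewrite (divn_eq n p) addnC iterateD; have [w Kw ->] := Fq (n %/ p)%N z Kz.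
  apply: (iterate_finite_le _ (finK w Kw)).
  by rewrite -ltnS prednK // ltn_mod.
have sub : inner s `<=` fatou_set f.
  have circ z : closed_corona s s z -> nc z = s by move=> /andP[? ?]; apply/eqP; rewrite eq_le; apply/andP.
  have h1 z : closed_corona s s z -> closed_corona s s (rho * z) by rewrite /closed_corona /= ncM rho1 mul1r.
  have h2 z : closed_corona s s z -> {for z, continuous psi}.
    by move=> /circ zs; apply: cdiff_continuous; apply: dpsi; exact: (curve_annulus sr).
  have h3 z : closed_corona s s z -> iterate f p (fin (psi z)) = fin (psi (rho * z)).
    by move=> /circ zs; apply: cj; exact: (curve_annulus sr).
  have h4 n z : closed_corona s s z -> iterate f n (fin (psi z)) <> infty.
    by move=> hz; apply: fink; right; exists z.
  have TB := @rotation_totally_bounded R f mf p rho psi (closed_corona s s) p0 rho1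
    (@compact_closed_corona R s s) h1 h2 h3 h4.
  have GF : fin @` G `<=` fatou_set f.
    apply: (normality mf oG cK fink) => m; have [phi [hphi h]] := TB m.
    exists phi; split => // e e0; have [N hN] := h 0%N e e0; exists N => i j Ni Nj _ [z hz <-].
    by have := hN i j Ni Nj z hz; rewrite !addn0.
  move=> [z|] hz; first by apply: GF; exists z.
  by case: (inner_outer sr hz); left.
apply: (side_not_openB cB A_neq0 B0 AB).
have -> : B = inner s `&` (fatou_set f `\` H).
  apply/seteqP; split=> x; last by move=> [[//|/(inner_ring_H sr)] + [_]].
  move=> Bx; split; first by left.
  by split; [apply: sub; left|exact: (sideB_notH HAB)].
by apply: openI; [exact: inner_open|exact: fatou_diff_open].
Qed.

End Ring.

End FatouSet.

(** * Period two with a single pole *)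

Section OnePole.
Context {R : realType}.
Local Notation C := R[i].
Local Notation nc := (@ComplexField.Normc.normc R).
Local Notation S := (sphere R).
Local Notation infty := (@infty R).

Lemma continuous_obind (f : C -> S) z : meromorphic f ->
  {for (fin z), continuous (obind f : S -> S)}.
Proof. by move=> mf A hA; apply/nbhs_fin; exact: (meromorphic_continuous mf hA). Qed.

Lemma circleP (s : R) (z : C) : closed_corona s s z <-> nc z = s.
Proof.
split=> [/andP[z1 z2]|zs]; first by apply/eqP; rewrite eq_le z1 z2.
by rewrite /closed_corona /= zs lexx.
Qed.

Section PeriodTwo.
Variables (f : C -> S) (H A B : set S) (r : R) (rho : C) (psi : C -> C) (a : C) (v : S).
Hypotheses (mf : meromorphic f) (Hcomp : fatou_component f H).
Hypotheses (cA : closed A) (cB : closed B) (conA : connected A) (conB : connected B).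
Hypotheses (Ai : A infty) (AB : A `&` B = set0) (HAB : ~` H = A `|` B).
Hypothesis chart : rotation_chart (iterate f 2) H r rho psi.
Hypothesis ends : separated_ends r psi A B.
Hypotheses (pole : poles f = [set a]) (Ba : B (fin a)) (nv : ~ range f v).
Hypothesis period : ~ (obind f @` H `<=` H).

Let r1 : 1 < r. Proof. by case: chart. Qed.
Let rho1 : nc rho = 1. Proof. by case: chart. Qed.
Let B0 : B !=set0. Proof. by exists (fin a). Qed.
Let A0 : A !=set0. Proof. by exists infty. Qed.

Let Hfin n x : H x -> iterate f n x <> infty.
Proof. by move=> /(Hfatou Hcomp); exact: fatou_finite. Qed.

Let psifin n z : annulus r z -> iterate f n (fin (psi z)) <> infty.
Proof. by move=> /(chart_in chart); exact: Hfin. Qed.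

Let h z := orbit f 1 (psi z).

Let hE z : annulus r z -> f (psi z) = fin (h z).
Proof. by move=> az; rewrite /h -orbitE //; exact: psifin. Qed.

Let f_h z : annulus r z -> f (h z) = fin (psi (rho * z)).
Proof.
move=> az; have [_ _ _ _ cj] := chart; rewrite -cj //.
by rewrite -[iterate f 2 _]/(obind f (f (psi z))) hE.
Qed.

Let rot_annulus z : annulus r z -> annulus r (rho * z).
Proof. by rewrite /annulus /= ncM rho1 mul1r. Qed.

Let h_iterate n z : annulus r z -> iterate f n (fin (h z)) = iterate f n.+1 (fin (psi z)).
Proof. by move=> az; rewrite -hE // -addn1 iterateD. Qed.

(** Injectivity of [h] follows from [f_h], which recovers [psi (rho * z)] from [h z]. The rotation
    is the same as on [H] because [f] commutes with its second iterate. *)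
Let chart1 : rotation_chart (iterate f 2) (ring_image h 1 r) r rho h.
Proof.
have [_ _ d _ cj] := chart; split => //.
- move=> z az; apply: (@cdiff_comp R (orbit f 1) psi); last exact: d.
  by apply: (orbit_cdiff mf); exact: psifin.
- split.
  + by move=> z az; exists z.
  + move=> x y; rewrite !inE => ax ay e.
    have e' : fin (psi (rho * x)) = fin (psi (rho * y)).
      by rewrite -!f_h //; move/fin_inj : e => ->.
    have := chart_inj chart (rot_annulus ax) (rot_annulus ay) e'.
    by apply: mulfI; rewrite -nc_gt0 rho1.
  + by move=> s [z az <-]; exists z.
- move=> z az; rewrite h_iterate // -addn1 addnC iterateD cj // -hE //.
  exact: rot_annulus.
Qed.

Let image_H : obind f @` H = ring_image h 1 r.
Proof.
apply/seteqP; split=> [_ [x /(chart_surj chart)[z az <-] <-]|_ [z az <-]].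
  by exists z => //; rewrite /comp -hE.
by exists (fin (psi z)); [exact: (chart_in chart az)|rewrite /= hE].
Qed.

(** On a closed corona around [z0] the iterates composed with [h] are totally bounded by the
    rotation, and [h] maps the open corona onto an open set, so [normality] applies there. *)
Let image_H_fatou : ring_image h 1 r `<=` fatou_set f.
Proof.
move=> _ [z0 az0 <-]; have /andP[z1 z2] := az0.
pose s1 := (1 + nc z0) / 2; pose s2 := (nc z0 + r) / 2.
have s11 : 1 < s1 by rewrite /s1; lra.
have s2r : s2 < r by rewrite /s2; lra.
have s1z : s1 < nc z0 by rewrite /s1; lra.
have zs2 : nc z0 < s2 by rewrite /s2; lra.
have sub := closed_corona_annulus s11 s2r.
pose T := closed_corona s1 s2.
pose G := h @` corona s1 s2; pose Gam := h @` (T `&` [set z | nc z = s1 \/ nc z = s2]).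
have KE : G `|` Gam = h @` T.
  apply/seteqP; split=> [_ [[z /andP[h1 h2] <-]|[z [Tz _] <-]]|_ [z Tz <-]].
  - by exists z => //; apply/andP; split; exact: ltW.
  - by exists z.
  - have /andP[h1 h2] := Tz; have [e1|n1] := eqVneq (nc z) s1; first by right; exists z => //; split => //; left.
    have [e2|n2] := eqVneq (nc z) s2; first by right; exists z => //; split => //; right.
    by left; exists z => //; rewrite /corona /= !lt_neqAle h1 h2 n2 eq_sym n1.
have d1 z : T z -> cdiff h z by move=> /sub az; have [_ _ d _ _] := chart1; exact: d.
have cj1 z : T z -> iterate f 2 (fin (h z)) = fin (h (rho * z)) by move=> /sub az; have [_ _ _ _ d] := chart1; exact: d.
have hfin n z : T z -> iterate f n (fin (h z)) <> infty by move=> /sub az; rewrite h_iterate //; exact: psifin.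
have rT z : T z -> T (rho * z) by rewrite /T /closed_corona /= ncM rho1 mul1r.
have cT : compact T by exact: compact_closed_corona.
have ch z : T z -> {for z, continuous h} by move=> Tz; apply: cdiff_continuous; exact: d1.
have TB := @rotation_totally_bounded R f mf 2 rho h T isT rho1 cT rT ch cj1 hfin.
have oG : open G.
  apply: open_image_inj; first exact: open_corona.
    by move=> z /andP[h1 h2]; apply: d1; apply/andP; split; exact: ltW.
  move=> x y; rewrite !inE => /andP[x1 x2] /andP[y1 y2] e; apply: (chart_inj chart1); last by rewrite e.
    by apply: sub; apply/andP; split; exact: ltW.
  by apply: sub; apply/andP; split; exact: ltW.
apply: (normality mf oG (Gam := Gam)).
- by rewrite KE; exact: compact_image.
- by rewrite KE => n _ [z Tz <-]; exact: hfin.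
- move=> m; have [phi [hphi hu]] := TB m.
  exists phi; split => // e e0; have [N hN] := hu 0%N e e0; exists N => i j Ni Nj _ [z [Tz _] <-].
  by have := hN i j Ni Nj z Tz; rewrite !addn0.
- by exists (h z0) => //; exists z0 => //; rewrite /corona /= s1z.
Qed.

Let ring1_connected : connected (ring_image h 1 r).
Proof. exact: (ring_image_connected chart1). Qed.

(** A common point would absorb f(H), connected and contained in the Fatou set, into the component
    [H], against [period]. *)
Let ring1_disjoint x : ring_image h 1 r x -> H x -> False.
Proof.
move=> hx Hx; apply: period; rewrite image_H.
by apply: (component_absorbs Hcomp ring1_connected image_H_fatou); exists x.
Qed.

Let S1 (s : R) := fin @^-1` inner B psi s.
Let T1 (s : R) := psi @` closed_corona s s.
Let FK s := f @` (S1 s `|` T1 s).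
Let curve1 s := closed_ring_image h s s.

Let curve1P s x : curve1 s x <-> exists2 z, nc z = s & fin (h z) = x.
Proof. exact: curveP. Qed.

Let hol z : f z <> infty -> holomorphic_at f z. Proof. by move=> fz; exact: mf.1. Qed.

(** These play the part of the outer and the inner side of the image curve: [E1] contains infinity
    because the pole lies in [B], and [D1] contains the omitted value. *)
Let E1 (s : R) := FK s `\` curve1 s.
Let D1 (s : R) := ~` FK s.

Section Radius.
Variable s : R.
Hypothesis sr : 1 < s < r.

Lemma circle_annulus z : nc z = s -> annulus r z.
Proof. by rewrite /annulus /= => ->. Qed.

Lemma K_preimage : S1 s `|` T1 s = fin @^-1` (~` outer A r psi s).
Proof. by rewrite -(inner_curveE AB HAB chart sr) preimage_setU curve_preimage. Qed.

Lemma open_S1 : open (S1 s).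
Proof. by apply: open_preimage_fin; exact: (inner_open HAB chart ends sr). Qed.

Lemma open_outer : open (outer A r psi s).
Proof. exact: (outer_open HAB chart ends sr). Qed.

Lemma compact_K : compact (S1 s `|` T1 s).
Proof.
rewrite K_preimage; apply: compact_preimage_fin; first by apply: open_closedC; exact: open_outer.
by apply; left.
Qed.

Lemma compact_T1 : compact (T1 s).
Proof. exact: (compact_curve chart sr). Qed.

Lemma image_T1 : f @` T1 s = curve1 s.
Proof.
apply/seteqP; split=> [_ [_ [z /circleP zs <-] <-]|x /curve1P[z zs <-]].
  by rewrite hE; [apply/curve1P; exists z|exact: circle_annulus].
by exists (psi z); [exists z => //; exact/circleP|rewrite hE //; exact: circle_annulus].
Qed.

Lemma FK_infty : FK s infty.
Proof.
exists a; first by left; left.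
by have : poles f a by rewrite pole.
Qed.

Lemma FK_v : ~ FK s v.
Proof. by move=> [z _ fz]; apply: nv; exists z. Qed.

Lemma FK_closed : closed (FK s).
Proof. by apply: (image_closed compact_K) => z _; exact: meromorphic_continuous. Qed.

Lemma E1_open : open (E1 s).
Proof.
rewrite /E1 -image_T1; apply: (image_diff_open open_S1 compact_K compact_T1) => z _; [exact: meromorphic_continuous|exact: hol].
Qed.

Lemma D1_open : open (D1 s). Proof. by apply: closed_openC; exact: FK_closed. Qed.

Lemma curve1_FK : curve1 s `<=` FK s.
Proof. by rewrite -image_T1 => _ [z Tz <-]; exists z => //; right. Qed.

Lemma infty_curve1 : ~ curve1 s infty.
Proof. by move=> /curve1P[z _]. Qed.

Lemma D1_E1 x : D1 s x \/ curve1 s x \/ E1 s x.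
Proof.
have [Fx|nF] := pselect (FK s x); last by left.
by have [cx|nc] := pselect (curve1 s x); [right; left|right; right].
Qed.

Lemma curve1_ring : curve1 s `<=` ring_image h 1 r.
Proof. by move=> _ /curve1P[z zs <-]; exists z => //; exact: circle_annulus. Qed.

(** If one point of the outer half of f(H) were covered, all of it would be. Then [FK s] would be
    the union of the open sets [E1 s] and f(H), hence open and closed, hence the sphere, which the
    omitted value forbids. *)
Lemma outer_ring1_notFK x : ring_image h s r x -> FK s x -> False.
Proof.
have /andP[s1 s2] := sr; move=> Rx Fx.
have sub : ring_image h s r `<=` FK s.
  apply: (image_absorbs open_S1 compact_K compact_T1 _ _ (ring_image_connected chart1 _ _)).
  - by move=> z _; exact: meromorphic_continuous.
  - by move=> z _; exact: hol.
  - exact: ltW.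
  - exact: lexx.
  - rewrite image_T1 -subset0 => _ [[z /andP[z1 z2] <-] /curve1P[w ws e]].
    have wz : w = z.
      by apply: (chart_inj chart1) e; [exact: circle_annulus|rewrite /annulus /=; apply/andP; split; lra].
    by subst w; lra.
  - by exists x.
have FE : FK s = E1 s `|` ring_image h 1 r.
  apply/seteqP; split=> y; first by have [d|[c|e]] := D1_E1 y => // _; [right; exact: curve1_ring|left].
  case=> [[]//|[z az <-]]; have /andP[z1 z2] := az; have [zs|zs|zs] := ltgtP (nc z) s.
  - exists (psi z); last by rewrite hE.
    by left; right; exists z => //; rewrite /corona /= z1.
  - by apply: sub; exists z => //; rewrite /corona /= zs.
  - by apply: curve1_FK; apply/curve1P; exists z.
have oF : open (FK s) by rewrite FE; apply: openU; [exact: E1_open|exact: (ring_image_open chart1)].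
by apply: FK_v; rewrite (sphere_clopen oF FK_closed (ex_intro _ _ FK_infty)).
Qed.

End Radius.

(** * The closed region between the two curves *)

Section Trap.
Variable s : R.
Hypothesis sr : 1 < s < r.

(** One subsequence serves both curves: [h z] is one step ahead of [psi z] on the same orbit, so the
    estimates with shifts [k = 0] and [k = 1] are combined. *)
Lemma curves_bounded (m : nat -> nat) : exists phi : nat -> nat, {homo phi : i j / (i < j)%N} /\
  forall e : R, 0 < e -> exists N, forall i j, (N <= i)%N -> (N <= j)%N ->
    forall z, (T1 s `|` h @` closed_corona s s) z -> nc (orbit f (m (phi i)) z - orbit f (m (phi j)) z) <= e.
Proof.
have [_ _ dpsi _ cj] := chart.
have circ z : closed_corona s s z -> annulus r z by move=> /circleP zs; exact: circle_annulus zs.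
have h1 z : closed_corona s s z -> closed_corona s s (rho * z) by rewrite /closed_corona /= ncM rho1 mul1r.
have h2 z : closed_corona s s z -> {for z, continuous psi}.
  by move=> /circ az; apply: cdiff_continuous; exact: dpsi.
have h3 z : closed_corona s s z -> iterate f 2 (fin (psi z)) = fin (psi (rho * z)) by move=> /circ; exact: cj.
have h4 n z : closed_corona s s z -> iterate f n (fin (psi z)) <> infty by move=> /circ; exact: psifin.
have [phi [hphi hu]] := @rotation_totally_bounded R f mf 2 rho psi (closed_corona s s) isT rho1
    (@compact_closed_corona R s s) h1 h2 h3 h4 m.
exists phi; split => // e e0; have [N0 hN0] := hu 0%N e e0; have [N1 hN1] := hu 1%N e e0.
exists (maxn N0 N1) => i j; rewrite !geq_max => /andP[i0 i1] /andP[j0 j1] _ [[z hz <-]|[z hz <-]].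
  by have := hN0 i j i0 j0 z hz; rewrite !addn0.
have E n : orbit f n (h z) = orbit f (n + 1) (psi z).
  by rewrite /orbit /finite_part h_iterate ?addn1 //; exact: circ.
by rewrite !E; exact: hN1.
Qed.

Variable X : set S.
Hypothesis oX : open X.
Let KX := X `|` curve psi s `|` curve1 s.
Hypotheses (cKX : closed KX) (KXi : ~ KX infty).
Hypothesis poleX : ~ KX (fin a).

Let GX := fin @^-1` X.
Let GamX := T1 s `|` h @` closed_corona s s.

Lemma trap_preimage : GX `|` GamX = fin @^-1` KX.
Proof.
by rewrite /KX !preimage_setU /curve1 -/(curve h s) !curve_preimage /GamX setUA.
Qed.

Lemma trap_compact : compact (GX `|` GamX).
Proof. by rewrite trap_preimage; exact: compact_preimage_fin. Qed.

Lemma compact_h_circle : compact (h @` closed_corona s s).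
Proof. exact: (compact_curve chart1 sr). Qed.

Lemma trap_finite z : KX (fin z) -> f z <> infty.
Proof. by move=> Kz fz; have : poles f z by []; rewrite pole => za; apply: poleX; rewrite -za. Qed.

Lemma trap_image_curve x : (f @` GamX) x -> curve psi s x \/ curve1 s x.
Proof.
move=> [y [Ty|[z /circleP zs zy]] yx]; first by right; rewrite -image_T1 //; exists y.
left; apply/curveP; rewrite -yx -zy f_h; last exact: circle_annulus zs.
by exists (rho * z) => //; rewrite ncM rho1 mul1r.
Qed.

(** Since [f] maps each of the two curves into the other, [T] avoids the image of the boundary. One
    value in [T] would make every point of [T] a value, infinity included, but the region contains
    no pole. *)
Lemma trap_misses (T : set S) : connected T -> T infty -> T `&` (curve psi s `|` curve1 s) = set0 ->
  forall z, KX (fin z) -> ~ T (f z).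
Proof.
move=> cT Ti Td z Kz Tz.
have sub : T `<=` f @` (GX `|` GamX).
  apply: (image_absorbs (open_preimage_fin oX) trap_compact _ _ _ cT).
  - by apply: compactU; [exact: compact_T1 sr|exact: compact_h_circle].
  - by move=> w _; exact: meromorphic_continuous.
  - by move=> w _; exact: hol.
  - rewrite -subset0 => x [Tx /trap_image_curve cx].
    by have : (T `&` (curve psi s `|` curve1 s)) x by []; rewrite Td.
  - by exists (f z); split => //; exists z => //; rewrite trap_preimage.
have [w Kw fw] := sub _ Ti; rewrite trap_preimage in Kw.
exact: (trap_finite Kw).
Qed.

(** Invariance keeps all iterates finite on the region, and [curves_bounded] provides the estimates
    on its boundary that [normality] asks for. *)
Lemma trap_fatou : (forall z, KX (fin z) -> KX (f z)) -> X `<=` fatou_set f.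
Proof.
move=> fK.
have fin_orbit n z : KX (fin z) -> exists2 w, KX (fin w) & iterate f n (fin z) = fin w.
  elim: n z => [|n ih] z Kz; first by exists z.
  have [w Kw e] := ih z Kz; have Kfw := fK w Kw.
  rewrite -[iterate f n.+1 _]/(obind f (iterate f n (fin z))) e /=.
  by case fw : (f w) => [y|]; [exists y => //; rewrite -[fin y]fw|case: (trap_finite Kw)].
have sub : fin @` GX `<=` fatou_set f.
  apply: (normality mf (open_preimage_fin oX) trap_compact) => [n z|m].
    by rewrite trap_preimage => Kz; have [w _ ->] := fin_orbit n z Kz.
  exact: curves_bounded.
move=> [z|] Xz; first by apply: sub; exists z.
by case: KXi; left; left.
Qed.

End Trap.

(** For a point of the ring this is injectivity of [h]. For a point of [B], a smaller radius [t]
    puts [curve1 s] into the outer half of f(H) relative to [t], which [outer_ring1_notFK] keeps out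
    of the image. *)
Lemma image_S1_curve1 s z : 1 < s < r -> S1 s z -> ~ curve1 s (f z).
Proof.
move=> sr Sz /curve1P[w ws e]; have /andP[s1 s2] := sr.
have aw : annulus r w by rewrite /annulus /= ws.
case: Sz => [Bz|[u /andP[u1 u2] uz]].
  pose t := (1 + s) / 2; have tr : 1 < t < r by rewrite /t; apply/andP; split; lra.
  apply: (outer_ring1_notFK tr (x := fin (h w))).
    by exists w => //; rewrite /corona /= ws /t; apply/andP; split; lra.
  by rewrite e; exists z => //; left; left.
have au : annulus r u by rewrite /annulus /=; apply/andP; split; lra.
move: e; rewrite -(fin_inj uz) hE // => /(chart_inj chart1 aw au) wu.
by move: u2; rewrite -wu ws ltxx.
Qed.

Theorem period_two_absurd : False.
Proof.
have r1' := r1; pose s := (1 + r) / 2; have sr : 1 < s < r by rewrite /s; apply/andP; split; lra.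
have /andP[s1 s2] := sr.
have E1i : E1 s infty by split; [exact: FK_infty|exact: infty_curve1].
have D1v : D1 s v by exact: FK_v.
have oE1 := E1_open sr; have oD1 := D1_open sr.
(* No value on the inner side falls on the image curve, so [E1 s] is a continuous image of a
   connected set. *)
have E1E : E1 s = obind f @` inner B psi s.
  apply/seteqP; split=> [x [[z [Sz|Tz] <-] nc1]|_ [[z|] Iz <-]].
  - by exists (fin z).
  - by case: nc1; rewrite -image_T1 //; exists z.
  - by split; [exists z => //; left|exact: image_S1_curve1].
  - by case: (inner_outer AB HAB chart sr Iz); left.
have cE1 : connected (E1 s).
  rewrite E1E; apply: connected_image; first exact: (inner_connected cB conB Ai B0 AB HAB chart ends sr).
  move=> [z|] Iz; first exact: continuous_obind.
  by case: (inner_outer AB HAB chart sr Iz); left.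
(* The side [D1] with its curve is the complement of an open set containing infinity, hence compact
   in the plane: the image argument can be run a second time, from this side. *)
pose G1 := fin @^-1` D1 s; pose K1 := G1 `|` h @` closed_corona s s.
have K1E : K1 = fin @^-1` (~` E1 s).
  rewrite /K1 -curve_preimage -preimage_setU; congr (_ @^-1` _).
  apply/seteqP; split=> x; first by move=> [d [e _]|c [_ nc1]].
  by move=> ne; have [d|[c|e]] := D1_E1 s x; [left|right|].
have cK1 : compact K1.
  rewrite K1E; apply: compact_preimage_fin; first exact: open_closedC.
  by apply.
have oG1 : open G1 by exact: open_preimage_fin.
have fGam1 x : (f @` (h @` closed_corona s s)) x -> curve psi s x.
  move=> [_ [z /circleP zs <-] <-]; apply/curveP; rewrite f_h; last exact: circle_annulus zs.
  by exists (rho * z) => //; rewrite ncM rho1 mul1r.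
have absorb (T : set S) : connected T -> (forall x, T x -> curve psi s x -> False) ->
    (exists2 x, T x & (f @` K1) x) -> T `<=` f @` K1.
  move=> cT Tc [x Tx Fx].
  apply: (image_absorbs oG1 cK1 (compact_h_circle sr) _ _ cT).
  - by move=> w _; exact: meromorphic_continuous.
  - by move=> w _; exact: hol.
  - by rewrite -subset0 => y [Ty /fGam1 cy]; exact: (Tc y).
  - by exists x.
have cont := outer_connected cA conA Ai B0 AB HAB chart ends sr.
have cinn := inner_connected cB conB Ai B0 AB HAB chart ends sr.
(* The outer half of f(H) is not covered by the first image, so it lies in [D1], and [f] sends it to
   the outer half of [H]. *)
have oF1 : outer A r psi s `<=` f @` K1.
  apply: absorb => //; first by move=> x; exact: (outer_curve HAB chart sr).
  pose t := (s + r) / 2; pose z : C := (t%:C)%C.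
  have nz : nc z = t by rewrite ncR gtr0_norm // /t; lra.
  have hz : corona s r z by apply/andP; rewrite nz /t; split; lra.
  have az : annulus r z by apply/andP; rewrite nz /t; split; lra.
  exists (f (h z)).
    by rewrite f_h //; right; exists (rho * z) => //; apply/andP; rewrite ncM rho1 mul1r; exact/andP.
  exists (h z) => //; left; move=> Fx; apply: (outer_ring1_notFK sr _ Fx).
  by exists z.
have v_side : inner B psi s v.
  have [//|[cv|ov]] := cover_sides HAB chart s v.
    have /curveP[z zs vz] := cv.
    case: nv; exists (h (rho^-1 * z)) => //; rewrite f_h; last first.
      by rewrite /annulus /= ncM ncV rho1 invr1 mul1r zs.
    by rewrite mulVKf // -nc_gt0 rho1.
  by have [z _ fz] := oF1 v ov; case: nv; exists z.
have iF1 x : inner B psi s x -> ~ (f @` K1) x.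
  move=> Ix Fx.
  have sub : inner B psi s `<=` f @` K1.
    by apply: absorb => //; [move=> y; exact: (inner_curve HAB chart sr)|exists x].
  by have [z _ fz] := sub v v_side; apply: nv; exists z.
have curveH : curve psi s `<=` H by exact: (curve_H chart sr).
(* Infinity lies in the covered outer side but is not taken on the boundary curve, so the unique
   pole lies in [D1] as well as in [B]. *)
have D1a : D1 s (fin a).
  have [z Kz fz] : (f @` K1) infty by apply: oF1; left.
  have : poles f z by []; rewrite pole => za; rewrite -za; case: Kz => // -[w /circleP ws wz].
  by move: fz; rewrite -wz f_h //; exact: circle_annulus ws.
have c1B (Y : set S) : ring_image h 1 r `<=` Y -> curve1 s `<=` Y.
  by move=> sub x cx; apply: sub; exact: (curve1_ring sr).
have R1AB x : ring_image h 1 r x -> A x \/ B x.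
  by move=> Rx; have [?|[?|Hx]] := side_cover HAB x; [left|right|case: (ring1_disjoint Rx)].
have dAB x : A x -> B x -> False by move=> ? ?; have : (A `&` B) x by []; rewrite AB.
have innerH : inner B psi s `&` H !=set0.
  by have [x Ix] := inner_ring_neq0 psi sr; exists x; split; [right|exact: (inner_ring_H chart sr)].
have outerH : outer A r psi s `&` H !=set0.
  pose t := (s + r) / 2; pose z : C := (t%:C)%C.
  have nz : nc z = t by rewrite ncR gtr0_norm // /t; lra.
  have hz : ring_image psi s r (fin (psi z)) by exists z => //; apply/andP; rewrite nz /t; split; lra.
  by exists (fin (psi z)); split; [right|exact: (outer_ring_H chart sr)].
have cH : connected H by rewrite (chart_range chart); exact: (ring_image_connected chart).
have cov x : ~ curve1 s x -> (D1 s `|` E1 s) x.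
  by move=> nx; have [d|[c|e]] := D1_E1 s x; [left| |right].
have dDE : D1 s `&` E1 s = set0 by rewrite -subset0 => x [d [e _]].
have oHc := fatou_diff_open Hcomp.
(* f(H) is connected and misses [H], so it lies in [B] or in [A]: its curve is nested inside or
   outside the first one. *)
have [[x [Rx nAx]]|nA] := pselect (ring_image h 1 r `&` ~` A !=set0).
- have RB : ring_image h 1 r `<=` B.
    have sub : ring_image h 1 r `<=` ~` A.
      apply: (connected_sub_open ring1_connected (closed_openC cA) (closed_openC cB)).
      + by move=> y _; have [Ay|] := pselect (A y); [right=> By; exact: (dAB y)|left].
      + by rewrite -subset0 => y [Ry [nA nB]]; case: (R1AB y Ry).
      + by exists x.
    by move=> y Ry; case: (R1AB y Ry) => // /(sub y Ry).
  have c1I y : curve1 s y -> B y by exact: c1B.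
  have OHE : outer A r psi s `|` H `<=` E1 s.
    apply: (connected_sub_open _ oE1 oD1).
    + exact: connectedU.
    + move=> y hy; rewrite setUC; apply: cov => /c1I By; case: hy => [oy|Hy].
        by apply: (inner_outer AB HAB chart sr _ oy); left.
      exact: (sideB_notH HAB By).
    + by rewrite [E1 s `&` _]setIC dDE setI0.
    + by exists infty; split => //; left; left.
  (* The image curve is inside. Values on this region lie in [FK s] because the region is part of
     the closed inner side, and they miss the outer side by [trap_misses], the pole being in
     [D1]. *)
  pose X := inner B psi s `&` E1 s.
  have oX : open X by apply: openI => //; exact: (inner_open HAB chart ends sr).
  have KXE : X `|` curve psi s `|` curve1 s = ~` outer A r psi s `&` FK s.
    rewrite -(inner_curveE AB HAB chart sr); apply/seteqP; split=> y.
      case=> [[[Iy [Fy _]]|cy]|cy].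
      + by split => //; left.
      + by split; [right|have [] := OHE y (or_intror (curveH y cy))].
      + by split; [left; left; exact: c1I|exact: curve1_FK cy].
    move=> [Iy Fy]; have [c1|nc1] := pselect (curve1 s y); first by right.
    by left; case: Iy => [Iy|cy]; [left|right].
  have cKX : closed (X `|` curve psi s `|` curve1 s).
    by rewrite KXE; apply: closedI; [apply: open_closedC; exact: open_outer|exact: FK_closed].
  have KXi : ~ (X `|` curve psi s `|` curve1 s) infty by rewrite KXE => -[no _]; apply: no; left.
  have KXa : ~ (X `|` curve psi s `|` curve1 s) (fin a) by rewrite KXE => -[_]; exact: D1a.
  have XF : X `<=` fatou_set f.
    apply: (trap_fatou sr oX cKX KXi KXa) => z Kz; rewrite KXE; split; last first.
      exists z => //; rewrite K_preimage //; move: Kz; rewrite KXE; by case.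
    apply: (trap_misses sr oX cKX KXi KXa cont _ _ Kz); first by left.
    rewrite -subset0 => y [oy [cy|/c1I By]]; first exact: (outer_curve HAB chart sr oy cy).
    by apply: (inner_outer AB HAB chart sr _ oy); left.
  apply: (side_not_openB cB A0 B0 AB).
  (* Moving outwards, [B] consists of the uncovered side, the ring f(H), and the Fatou points
     outside [H] between the curves; all three sets are open. *)
  have -> : B = D1 s `|` ring_image h 1 r `|` (X `&` (fatou_set f `\` H)).
    apply/seteqP; split=> y.
      move=> By; have [d|[c1|e]] := D1_E1 s y; [by left; left|by left; right; exact: (curve1_ring sr)|].
      have Xy : X y by split => //; left.
      by right; split => //; split; [exact: XF|exact: (sideB_notH HAB By)].
    case=> [[d|/RB//]|[[[//|Ry] _] [_ nH]]]; last by case: nH; exact: (inner_ring_H chart sr).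
    have [Ay|[//|Hy]] := side_cover HAB y.
      by case: d; have [] := OHE y (or_introl (or_introl Ay)).
    by case: d; have [] := OHE y (or_intror Hy).
  by apply: openU; [apply: openU => //; exact: (ring_image_open chart1)|exact: openI].
- have RA : ring_image h 1 r `<=` A.
    by move=> y Ry; apply: contrapT => nAy; apply: nA; exists y.
  have c1I y : curve1 s y -> A y by exact: c1B.
  have IHD : inner B psi s `|` H `<=` D1 s.
    apply: (connected_sub_open _ oD1 oE1).
    + exact: connectedU.
    + move=> y hy; apply: cov => /c1I Ay; case: hy => [iy|Hy].
        by apply: (inner_outer AB HAB chart sr iy); left.
      exact: (sideA_notH HAB Ay).
    + by rewrite dDE setI0.
    + by exists v; split => //; left.
  (* The image curve is outside. Values on this region miss the inner side by [iF1], and miss [E1]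
     by [trap_misses], the pole being in the inner side. *)
  pose X := outer A r psi s `&` D1 s.
  have oX : open X by apply: openI => //; exact: open_outer.
  have KXE : X `|` curve psi s `|` curve1 s = ~` inner B psi s `&` ~` E1 s.
    rewrite -(outer_curveE AB HAB chart sr); apply/seteqP; split=> y.
      case=> [[[oy dy]|cy]|cy].
      + by split; [left|move=> [Fy _]].
      + by split; [right|move=> [Fy _]; exact: (IHD y (or_intror (curveH y cy)))].
      + by split; [left; left; exact: c1I|move=> [_]].
    move=> [Oy nE]; have [d|[c1|//]] := D1_E1 s y; last by right.
    by left; case: Oy => [Oy|cy]; [left|right].
  have cKX : closed (X `|` curve psi s `|` curve1 s).
    by rewrite KXE; apply: closedI; apply: open_closedC => //; exact: (inner_open HAB chart ends sr).
  have KXi : ~ (X `|` curve psi s `|` curve1 s) infty by rewrite KXE => -[_]; exact.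
  have KXa : ~ (X `|` curve psi s `|` curve1 s) (fin a) by rewrite KXE => -[ni _]; apply: ni; left.
  have XF : X `<=` fatou_set f.
    apply: (trap_fatou sr oX cKX KXi KXa) => z Kz; rewrite KXE; split.
      move=> iz; apply: (iF1 _ iz); exists z => //; rewrite K1E; move: Kz; rewrite KXE; by case.
    apply: (trap_misses sr oX cKX KXi KXa cE1 E1i _ Kz).
    rewrite -subset0 => y [[Fy nc1] [cy|//]].
    exact: (IHD y (or_intror (curveH y cy))).
  apply: (side_not_openA cA A0 B0 AB).
  have -> : A = E1 s `|` ring_image h 1 r `|` (X `&` (fatou_set f `\` H)).
    apply/seteqP; split=> y.
      move=> Ay; have [d|[c1|e]] := D1_E1 s y; [|by left; right; exact: (curve1_ring sr)|by left; left].
      have Xy : X y by split => //; left.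
      by right; split => //; split; [exact: XF|exact: (sideA_notH HAB Ay)].
    case=> [[[Fy _]|/RA//]|[[[//|Ry] _] [_ nH]]]; last by case: nH; exact: (outer_ring_H chart sr).
    have [//|[By|Hy]] := side_cover HAB y.
      by case: (IHD y (or_introl (or_introl By))).
    by case: (IHD y (or_intror Hy)).
  by apply: openU; [apply: openU => //; exact: (ring_image_open chart1)|exact: openI].
Qed.
End PeriodTwo.

End OnePole.

Section HermanRings.
Context {R : realType}.
Local Notation C := R[i].
Local Notation nc := (@ComplexField.Normc.normc R).
Local Notation S := (sphere R).
Local Notation infty := (@infty R).

Lemma nc_rotation_factor (t : R) : nc (rotation_factor t) = 1.
Proof. by rewrite /= cos2Dsin2 sqrtr1. Qed.

Lemma herman_ring_chart (f : C -> S) p H : herman_ring f p H ->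
  exists r rho psi, rotation_chart (iterate f p) H r rho psi.
Proof.
move=> [_ _ [r [t [psi [r1 _ dpsi bij cj]]]]]; exists r, (rotation_factor t), psi.
split => //; first exact: nc_rotation_factor.
by move=> z az; apply: CDiff; exact: dpsi.
Qed.

(** A chart takes only finite values, so infinity belongs to the complement of [H]; exactly one of
    the two components contains it, and the other is the bounded one. *)
Lemma herman_ring_sides (f : C -> S) p H : herman_ring f p H -> exists A B : set S,
  [/\ closed A /\ closed B, connected A /\ connected B, A infty /\ B !=set0,
      A `&` B = set0 /\ ~` H = A `|` B &
      forall B', bounded_complement_component H B' <-> B' = B].
Proof.
move=> hH; have [r [rho [psi chart]]] := herman_ring_chart hH.
have [_ [A1 [B1 [AB1 compE]]] _] := hH.
have cH : closed (~` H) by apply: open_closedC; exact: (chart_open chart).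
have Hi : (~` H) infty by move=> /(chart_surj chart)[z].
have comp_infty : components (~` H) (connected_component (~` H) infty) by exists infty.
have [A [B [AB Ai E]]] : exists A B, [/\ A <> B, A infty & components (~` H) = [set A; B]].
  have := comp_infty; rewrite compE => -[e|e].
    exists A1, B1; split => //; rewrite -e; exact: connected_component_refl.
  exists B1, A1; split; [by move=> e'; apply: AB1|rewrite -e; exact: connected_component_refl|].
  by rewrite setUC.
have cA : components (~` H) A by rewrite E; left.
have cB : components (~` H) B by rewrite E; right.
have dAB := components_disjoint cA cB AB.
have closedc X : components (~` H) X -> closed X by move=> [x _ <-]; exact: component_closed.
have connc X : components (~` H) X -> connected X by move=> [x _ <-]; exact: component_connected.
have sub X : components (~` H) X -> X `<=` ~` H by move=> [x _ <-]; exact: connected_component_sub.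
have Bi : ~ B infty by move=> Bi; have : (A `&` B) infty by []; rewrite dAB.
exists A, B; split.
- by split; exact: closedc.
- by split; exact: connc.
- by split => //; case: cB => x nx <-; exists x; exact: connected_component_refl.
- split => //; apply/seteqP; split=> x; last by case; exact: sub.
  move=> nx; have : components (~` H) (connected_component (~` H) x) by exists x.
  by rewrite E => -[e|e]; [left|right]; rewrite -e; exact: connected_component_refl.
- move=> B'; split; last by move=> ->.
  by move=> [cB' nB']; move: cB'; rewrite E => -[e|//]; case: nB'; rewrite e.
Qed.

Lemma bounded_component_essential (f : C -> S) p H : class_Mo f -> herman_ring f p H ->
  forall B, bounded_complement_component H B ->
  exists s, B s /\ essential_singularities f p s.
Proof.
move=> [[[mf _] _] [v nv]] hH B.
have [A [B1 [[cA cB] [conA conB] [Ai B0] [AB HAB] bE]]] := herman_ring_sides hH.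
move=> /bE ->; have [r [rho0 [psi0 chart0]]] := herman_ring_chart hH.
have A0 : A !=set0 by exists infty.
have [rho [psi [chart ends]]] := chart_separated_ends cA cB A0 B0 AB HAB chart0.
have [[Hcomp p0 _ _] _ _] := hH.
exact: (bounded_side_essential mf p0 Hcomp cA cB conA conB Ai B0 AB HAB chart ends nv).
Qed.

(** For [p = 1] no [k] satisfies [1 <= k <= 0], so infinity is the only essential singularity, and
    the bounded component does not contain it. *)
Lemma no_invariant_herman_ring (f : C -> S) H : class_Mo f -> ~ herman_ring f 1 H.
Proof.
move=> hf hH; have [A [B [_ _ _ _ bE]]] := herman_ring_sides hH.
have bB : bounded_complement_component H B by exact/bE.
have [s [Bs [si|[z [k [/andP[k1 k0] _]] _]]]] := bounded_component_essential hf hH bB.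
  by case: bB => _; apply; rewrite -si.
by move: (leq_trans k1 k0).
Qed.

Lemma one_pole_no_period_two (f : C -> S) a H : class_Mo f -> poles f = [set a] ->
  ~ herman_ring f 2 H.
Proof.
move=> hf pole hH; have [[[mf _] _] [v nv]] := hf.
have [A [B [[cA cB] [conA conB] [Ai B0] [AB HAB] bE]]] := herman_ring_sides hH.
have bB : bounded_complement_component H B by exact/bE.
(* For [p = 2] the finite essential singularities are the poles of [f], so the one found in the
   bounded component is [a]. *)
have Ba : B (fin a).
  have [s [Bs [si|[z [k [/andP[k1 k2] e]] zs]]]] := bounded_component_essential hf hH bB.
    by case: bB => _; case; rewrite -si.
  have k11 : k = 1%N by apply/eqP; rewrite eqn_leq k1 k2.
  have : poles f z by rewrite /poles /= -e k11.
  by rewrite pole => <-; rewrite zs.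
have [r [rho0 [psi0 chart0]]] := herman_ring_chart hH.
have A0 : A !=set0 by exists infty.
have [rho [psi [chart ends]]] := chart_separated_ends cA cB A0 B0 AB HAB chart0.
have [[Hcomp _ _ per] _ _] := hH.
apply: (period_two_absurd mf Hcomp cA cB conA conB Ai AB HAB chart ends pole Ba nv).
by move=> sub; exact: (per 1%N isT (conj Hcomp sub)).
Qed.

End HermanRings.

Theorem theorem2p18 (R : realType) (f : R[i] -> sphere R) (hf : class_Mo f) :
  (forall (p : nat) (H : set (sphere R)), herman_ring f p H ->
     forall B : set (sphere R), bounded_complement_component H B ->
       exists s : sphere R, B s /\ essential_singularities f p s) /\
  (~ exists H : set (sphere R), herman_ring f 1 H) /\
  ((exists a : R[i], poles f = [set a]) ->
     ~ exists H : set (sphere R), herman_ring f 2 H).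
Proof.
split; first by move=> p H; exact: bounded_component_essential.
split; first by move=> [H]; exact: no_invariant_herman_ring.
by move=> [a pole] [H]; exact: one_pole_no_period_two pole.
Qed.
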